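(* Let $(R,\mathfrak{m})$ be a one-dimensional, singular (i.e. non-regular), generically Gorenstein Cohen--Macaulay commutative Noetherian local ring, and let $E=\operatorname{End}_R(\mathfrak{m})$ (a commutative ring, module-finite over $R$). Assume that $R$ is almost Gorenstein. Then $\Omega\mathrm{CM}(R)$ is of finite type if and only if $\mathrm{CM}(E)$ is of finite type.
   Context: All subcategories are full. A ring $A$ is generically Gorenstein if $A_\mathfrak{p}$ is Gorenstein for every minimal prime $\mathfrak{p}$. For a commutative Noetherian ring $A$: $\operatorname{mod}(A)$ is the category of finitely generated $A$-modules. A finitely generated $A$-module $M$ is called Cohen--Macaulay if $\operatorname{depth} M_\mathfrak{p}\ge \operatorname{ht} A_\mathfrak{p}$ for all primes $\mathfrak{p}$ of $A$ (the depth of the zero module is $\infty$); $\mathrm{CM}(A)$ is the subcategory of Cohen--Macaulay $A$-modules; $\Omega\mathrm{CM}(A)$ is the subcategory of first syzygies of Cohen--Macaulay modules, i.e. modules $M$ fitting in an exact sequence $0\to M\to A^{\oplus n}\to N\to 0$ with $N\in\mathrm{CM}(A)$. A subcategory $\mathcal{X}$ of $\operatorname{mod}(A)$ is of finite type if there is $M\in\operatorname{mod}(A)$ with $\operatorname{add}(M)=\mathcal{X}$, where $\operatorname{add}(M)$ consists of all modules isomorphic to direct summands of finite direct sums of copies of $M$. $R$ is almost Gorenstein (in the sense of Goto--Matsuoka--Phuong) if $R$ possesses a canonical ideal $I$ (an ideal $I\neq R$ isomorphic as an $R$-module to a canonical module of $R$) such that $e_1(I)\le r(R)$. Here $r(R)$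 is the Cohen--Macaulay type $\dim_{R/\mathfrak m}\operatorname{Ext}^1_R(R/\mathfrak{m},R)$ of $R$, and $e_1(I)$ is the first Hilbert coefficient, defined by $\ell_R(R/I^{n+1})=e_0(I)(n+1)-e_1(I)$ for all $n\gg0$. *)

(* Defs.v *)
From HB Require Import structures.
From mathcomp Require Import all_boot all_order all_algebra.
From mathcomp Require Import ring_quotient generic_quotient.
From mathcomp Require Import boolp functions.
From mathcomp Require Import ring.

(* Conventions.  Subsets of rings and modules are boolean predicates, as in
   MathComp; [boolp] makes every Prop-valued predicate one of them.  Ideals of A
   are submodules of the regular module, [submodClosed A^o] (the whole ring is
   allowed); prime ideals are [prime_idealr A], hence proper.  Module categories
   are full, so a subcategory is a predicate on [lmodType A]. *)

Set Implicit Arguments.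
Unset Strict Implicit.
Unset Printing Implicit Defensive.

Import GRing.Theory.
Local Open Scope ring_scope.
Local Open Scope quotient_scope.

Section Submodule.
Variables (A : comNzRingType) (M : lmodType A) (N : submodClosed M).

Record submod : Type := Submod { submod_val : M; _ : submod_val \in N }.

HB.instance Definition _ := [isSub for submod_val].
HB.instance Definition _ := [Choice of submod by <:].
HB.instance Definition _ := [SubChoice_isSubLmodule of submod by <:].

End Submodule.

Section QuotientModule.
Variables (A : comNzRingType) (M : lmodType A) (N : submodClosed M).

(* MathComp quotients are indexed by [zmodClosed], which [submodClosed] does not
   inherit from: this alias of N carries the missing structure. *)
Definition zmod_of_submod : {pred M} := N.

Lemma zmod_of_submod_closed : zmod_closed zmod_of_submod.
Proof. exact: GRing.submod_closedB (GRing.submodClosedP N). Qed.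

HB.instance Definition _ :=
  GRing.isZmodClosed.Build M zmod_of_submod zmod_of_submod_closed.

Definition quotmod : Type := Quotient.quot zmod_of_submod.

HB.instance Definition _ := GRing.Zmodule.on quotmod.
HB.instance Definition _ := EqQuotient.on quotmod.

Definition quotmod_scale (a : A) (x : quotmod) : quotmod :=
  \pi_quotmod (a *: repr x).

Lemma quotmod_piP (x y : M) : (\pi_quotmod x = \pi_quotmod y) <-> (x - y \in N).
Proof.
rewrite -[_ \in N]/(_ \in zmod_of_submod) Quotient.idealrBE.
by split=> [->//|/eqP].
Qed.

Lemma quotmod_scaleE a (x : M) :
  quotmod_scale a (\pi_quotmod x) = \pi_quotmod (a *: x).
Proof.
apply/quotmod_piP; rewrite -scalerBr rpredZ //.
by apply/quotmod_piP; rewrite reprK.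
Qed.

Lemma quotmod_piD (x y : M) :
  \pi_quotmod (x + y) = \pi_quotmod x + \pi_quotmod y.
Proof. exact: (@Quotient.pi_add M zmod_of_submod x y). Qed.

Let scaleA a b x :
  quotmod_scale a (quotmod_scale b x) = quotmod_scale (a * b) x.
Proof. by elim/quotW: x => x; rewrite [quotmod_scale b _]quotmod_scaleE !quotmod_scaleE scalerA. Qed.

Let scale1 : left_id 1 quotmod_scale.
Proof. by elim/quotW => x; rewrite quotmod_scaleE scale1r. Qed.

Let scaleDr : right_distributive quotmod_scale +%R.
Proof.
move=> a; elim/quotW => x; elim/quotW => y.
by rewrite -quotmod_piD !quotmod_scaleE scalerDr quotmod_piD.
Qed.

Let scaleDl x : {morph quotmod_scale^~ x : a b / a + b}.
Proof.
move=> a b; elim/quotW: x => x.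
by rewrite !quotmod_scaleE scalerDl quotmod_piD.
Qed.

HB.instance Definition _ := GRing.Zmodule_isLmodule.Build A quotmod
  scaleA scale1 scaleDr scaleDl.

End QuotientModule.

Section HomModule.
Variables (A : comNzRingType) (M N : lmodType A).

Definition linear_pred : {pred M -> N} := [pred f : M -> N | `[< linear f >]].

Lemma linear_pred_closed : submod_closed linear_pred.
Proof.
split; first by rewrite inE; apply/asboolP => a x y /=; rewrite scaler0 addr0.
move=> c f g; rewrite !inE => /asboolP lf /asboolP lg.
apply/asboolP => a x y.
have E z : (c *: f + g) z = c *: f z + g z by [].
rewrite !E lf lg !scalerDr !scalerA [c * a]mulrC -!addrA; congr (_ + _).
by rewrite addrCA.
Qed.

HB.instance Definition _ :=
  GRing.isSubmodClosed.Build A (M -> N) linear_pred linear_pred_closed.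

Record hom : Type := Hom { hom_fun :> M -> N; _ : hom_fun \in linear_pred }.

HB.instance Definition _ := [isSub for hom_fun].
HB.instance Definition _ := [Choice of hom by <:].
HB.instance Definition _ := [SubChoice_isSubLmodule of hom by <:].

Lemma hom_is_linear (h : hom) : linear (hom_fun h).
Proof. by apply/asboolP; case: h. Qed.

HB.instance Definition _ (h : hom) :=
  GRing.isLinear.Build A M N *:%R (hom_fun h) (hom_is_linear h).

End HomModule.

Section EndomorphismRing.
Variables (A : comNzRingType) (M : lmodType A).

Definition endo : Type := hom M M.

HB.instance Definition _ := GRing.Lmodule.on endo.

Lemma endo1_subproof : (fun x : M => x) \in @linear_pred A M M.
Proof. by rewrite inE; apply/asboolP. Qed.

Definition endo1 : endo := Hom endo1_subproof.

Lemma endoM_subproof (f g : endo) :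
  (fun x : M => hom_fun f (hom_fun g x)) \in @linear_pred A M M.
Proof.
by rewrite inE; apply/asboolP => a x y; rewrite (hom_is_linear g) (hom_is_linear f).
Qed.

Definition endoM (f g : endo) : endo := Hom (endoM_subproof f g).

Let endo_eqP (f g : endo) : (forall x, hom_fun f x = hom_fun g x) -> f = g.
Proof. by move=> E; apply/val_inj/funext. Qed.

Let endoMA : associative endoM.
Proof. by move=> f g h; apply: endo_eqP. Qed.

Let endo1M : left_id endo1 endoM.
Proof. by move=> f; apply: endo_eqP. Qed.

Let endoM1 : right_id endo1 endoM.
Proof. by move=> f; apply: endo_eqP. Qed.

Let endoMDl : left_distributive endoM +%R.
Proof. by move=> f g h; apply: endo_eqP. Qed.

Let endoMDr : right_distributive endoM +%R.
Proof.
move=> f g h; apply: endo_eqP => x.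
exact: (raddfD (hom_fun f)).
Qed.

HB.instance Definition _ := GRing.Zmodule_isPzRing.Build endo
  endoMA endo1M endoM1 endoMDl endoMDr.

End EndomorphismRing.

(* The endomorphism ring of an ideal containing a nonzerodivisor is commutative. *)
Lemma endo_ideal_mulC (A : comNzRingType) (I : submodClosed A^o)
    (a : submod I) :
    (forall x : A, (submod_val a : A) * x = 0 -> x = 0) ->
  commutative (@GRing.mul (endo (submod I))).
Proof.
pose v (y : submod I) : A := submod_val y => regA f g.
have vZ (h : endo (submod I)) (b : A) (z : submod I) :
    v (hom_fun h (b *: z)) = b * v (hom_fun h z).
  by rewrite linearZ.
have swap (h : endo (submod I)) (y z : submod I) :
    v y * v (hom_fun h z) = v z * v (hom_fun h y).
  rewrite -!vZ; congr (v (hom_fun h _)); apply: val_inj.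
  exact: (mulrC (v y) (v z)).
apply/val_inj/funext => x; apply: val_inj; apply/eqP.
rewrite -subr_eq0; apply/eqP/regA.
have fgE : v a * v (hom_fun f (hom_fun g x)) = v a * v (hom_fun g (hom_fun f x)).
  rewrite [RHS]swap -vZ.
  have -> : v a *: hom_fun g x = v (hom_fun g a) *: x.
    by apply: val_inj; rewrite /= [LHS](swap g a x) [LHS]mulrC.
  by rewrite vZ mulrC.
by rewrite mulrBr; apply/eqP; rewrite subr_eq0; apply/eqP.
Qed.

Section Localization.
Variables (A : comNzRingType) (p : prime_idealr A).

Record denom : Type := Denom { dval : A; _ : dval \notin (p : {pred A}) }.

HB.instance Definition _ := [isSub for dval].
HB.instance Definition _ := [Choice of denom by <:].

Lemma denom1_subproof : 1 \notin (p : {pred A}).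
Proof. by rewrite idealr1. Qed.

Definition denom1 : denom := Denom denom1_subproof.

Lemma denomM_subproof (s t : denom) : dval s * dval t \notin (p : {pred A}).
Proof. by rewrite prime_idealrM negb_or (valP s) (valP t). Qed.

Definition denomM (s t : denom) : denom := Denom (denomM_subproof s t).

Section Fractions.
Variable M : lmodType A.

Definition loc_eq (x y : M * denom) : bool :=
  `[< exists u : denom,
        (dval u * dval y.2) *: x.1 = (dval u * dval x.2) *: y.1 >].

Lemma loc_eq_refl : reflexive loc_eq.
Proof. by move=> x; apply/asboolP; exists denom1. Qed.

Lemma loc_eq_sym : symmetric loc_eq.
Proof. by move=> x y; apply/asboolP/asboolP => -[u e]; exists u. Qed.

Lemma loc_eq_trans : transitive loc_eq.
Proof.
move=> [y [t Ht]] [x [s Hs]] [z [r Hr]].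
move=> /asboolP[u /= e1] /asboolP[v /= e2].
apply/asboolP; exists (denomM (denomM u v) (Denom Ht)) => /=.
move: u v e1 e2 => [u _] [v _] /= e1 e2.
have -> : u * v * t * r = v * r * (u * t) by ring.
rewrite -scalerA e1 scalerA.
have -> : v * r * (u * s) = u * s * (v * r) by ring.
by rewrite -scalerA e2 scalerA; congr (_ *: _); ring.
Qed.

Canonical loc_equiv := EquivRel loc_eq loc_eq_refl loc_eq_sym loc_eq_trans.

(* The localization of M at p, as a quotient of M x (A \ p). *)
Definition loc : Type := {eq_quot loc_eq}.

HB.instance Definition _ : EqQuotient _ loc_eq loc := EqQuotient.on loc.
HB.instance Definition _ := Choice.on loc.

Definition frac (x : M) (s : denom) : loc := \pi_loc (x, s).

Lemma fracP x s y t : frac x s = frac y t <->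
  exists u : denom, (dval u * dval t) *: x = (dval u * dval s) *: y.
Proof.
split; first by move=> /eqmodP /asboolP.
by move=> e; apply/eqmodP/asboolP.
Qed.

(* Equality of fractions follows from cross-multiplication (u = 1). *)
Lemma frac_eq x s y t : dval t *: x = dval s *: y -> frac x s = frac y t.
Proof. by move=> e; apply/fracP; exists denom1; rewrite !mul1r. Qed.

Lemma frac_repr a : frac (repr a).1 (repr a).2 = a.
Proof. by rewrite /frac -surjective_pairing reprK. Qed.

Lemma locP a : exists x s, a = frac x s.
Proof. by exists (repr a).1, (repr a).2; rewrite frac_repr. Qed.

Definition loc0 : loc := frac 0 denom1.
Definition loc_opp (a : loc) : loc := frac (- (repr a).1) (repr a).2.
Definition loc_add (a b : loc) : loc :=
  frac (dval (repr b).2 *: (repr a).1 + dval (repr a).2 *: (repr b).1)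
       (denomM (repr a).2 (repr b).2).

Lemma loc_oppE x s : loc_opp (frac x s) = frac (- x) s.
Proof.
have /fracP[u e] := frac_repr (frac x s).
by apply/fracP; exists u; rewrite !scalerN e.
Qed.

Lemma loc_addE x s y t : loc_add (frac x s) (frac y t) =
  frac (dval t *: x + dval s *: y) (denomM s t).
Proof.
rewrite /loc_add.
have /fracP[] := frac_repr (frac x s); have /fracP[] := frac_repr (frac y t).
move: (repr _) (repr _) => [x' s'] [y' t'] v /= e2 u e1.
apply/fracP; exists (denomM u v) => /=; rewrite !scalerDr !scalerA.
move: u v s t s' t' e1 e2 => [u _] [v _] [s _] [t _] [s' _] [t' _] /= e1 e2.
congr (_ + _).
  have -> : u * v * (s * t) * t' = v * t * t' * (u * s) by ring.
  by rewrite -scalerA e1 scalerA; congr (_ *: _); ring.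
have -> : u * v * (s * t) * s' = u * s * s' * (v * t) by ring.
by rewrite -scalerA e2 scalerA; congr (_ *: _); ring.
Qed.

Let loc_addA : associative loc_add.
Proof.
move=> a b c; have [x [s ->]] := locP a; have [y [t ->]] := locP b.
have [z [r ->]] := locP c; rewrite !loc_addE; apply: frac_eq.
move: s t r => [s _] [t _] [r _] /=.
rewrite !scalerDr !scalerA -!addrA.
by congr (_ *: _ + (_ *: _ + _ *: _)); ring.
Qed.

Let loc_addC : commutative loc_add.
Proof.
move=> a b; have [x [s ->]] := locP a; have [y [t ->]] := locP b.
rewrite !loc_addE; apply: frac_eq => /=.
by rewrite addrC mulrC.
Qed.

Let loc_add0 : left_id loc0 loc_add.
Proof.
move=> a; have [x [s ->]] := locP a; rewrite loc_addE; apply: frac_eq => /=.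
by rewrite scaler0 add0r scale1r mul1r.
Qed.

Let loc_addN : left_inverse loc0 loc_opp loc_add.
Proof.
move=> a; have [x [s ->]] := locP a.
rewrite loc_oppE loc_addE; apply: frac_eq => /=.
by rewrite scalerN addNr !scaler0.
Qed.

HB.instance Definition _ :=
  GRing.isZmodule.Build loc loc_addA loc_addC loc_add0 loc_addN.

Lemma fracD x s y t :
  frac x s + frac y t = frac (dval t *: x + dval s *: y) (denomM s t).
Proof. exact: loc_addE. Qed.

End Fractions.

Definition loc_ring : Type := loc A^o.

HB.instance Definition _ := GRing.Zmodule.on loc_ring.

Definition ringfrac (a : A) (s : denom) : loc_ring := frac (a : A^o) s.

Lemma loc_ringP (a : loc_ring) : exists x s, a = ringfrac x s.
Proof. exact: (locP a). Qed.

Lemma ringfrac_repr (a : loc_ring) : ringfrac (repr a).1 (repr a).2 = a.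
Proof. exact: frac_repr. Qed.

Section Scaling.
Variable M : lmodType A.

Definition loc_scale (a : loc_ring) (b : loc M) : loc M :=
  frac (((repr a).1 : A) *: (repr b).1) (denomM (repr a).2 (repr b).2).

Lemma loc_scaleE (a : A) s (y : M) t :
  loc_scale (ringfrac a s) (frac y t) = frac (a *: y) (denomM s t).
Proof.
rewrite /loc_scale.
have /fracP[] := frac_repr (ringfrac a s); have /fracP[] := frac_repr (frac y t).
move: (repr _) (repr _) => [a' s'] [y' t'] v /= e2 u e1.
apply/fracP; exists (denomM u v) => /=; rewrite !scalerA.
move: u v s t s' t' e1 e2 => [u _] [v _] [s _] [t _] [s' _] [t' _] /= e1 e2.
have e1' : u * s * a' = u * s' * a by [].
have -> : u * v * (s * t) * a' = u * s * a' * (v * t) by ring.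
by rewrite e1' -scalerA e2 scalerA; congr (_ *: _); ring.
Qed.

End Scaling.

Definition loc_mul (a b : loc_ring) : loc_ring := loc_scale a (b : loc A^o).
Definition loc1 : loc_ring := ringfrac 1 denom1.

Lemma loc_mulE a s b t :
  loc_mul (ringfrac a s) (ringfrac b t) = ringfrac (a * b) (denomM s t).
Proof. exact: loc_scaleE. Qed.

Lemma ringfracD a s b t :
  ringfrac a s + ringfrac b t = ringfrac (dval t * a + dval s * b) (denomM s t).
Proof. exact: fracD. Qed.

Lemma ringfrac_eq a s b t : dval t * a = dval s * b -> ringfrac a s = ringfrac b t.
Proof. by move=> e; apply: frac_eq. Qed.

Let loc_mulA : associative loc_mul.
Proof.
move=> a b c; have [x [s ->]] := loc_ringP a; have [y [t ->]] := loc_ringP b.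
have [z [r ->]] := loc_ringP c; rewrite !loc_mulE; apply: ringfrac_eq.
by move: s t r => [s _] [t _] [r _] /=; ring.
Qed.

Let loc_mulC : commutative loc_mul.
Proof.
move=> a b; have [x [s ->]] := loc_ringP a; have [y [t ->]] := loc_ringP b.
rewrite !loc_mulE; apply: ringfrac_eq.
by move: s t => [s _] [t _] /=; ring.
Qed.

Let loc_mul1 : left_id loc1 loc_mul.
Proof.
move=> a; have [x [s ->]] := loc_ringP a.
rewrite loc_mulE; apply: ringfrac_eq.
by move: s => [s _] /=; ring.
Qed.

Let loc_mulDl : left_distributive loc_mul +%R.
Proof.
move=> a b c; have [x [s ->]] := loc_ringP a; have [y [t ->]] := loc_ringP b.
have [z [r ->]] := loc_ringP c.
rewrite ringfracD !loc_mulE ringfracD; apply: ringfrac_eq.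
by move: s t r => [s _] [t _] [r _] /=; ring.
Qed.

Let loc1_neq0 : loc1 != 0 :> loc_ring.
Proof.
apply/eqP => /fracP[u /= e].
have : dval u = 0 by have : dval u * 1 * 1 = dval u * 1 * 0 := e; rewrite mulr0 !mulr1.
by move=> u0; have := valP u; rewrite /= u0 idealr0.
Qed.

HB.instance Definition _ := GRing.Zmodule_isComNzRing.Build loc_ring
  loc_mulA loc_mulC loc_mul1 loc_mulDl loc1_neq0.

Section LocalizedModule.
Variable M : lmodType A.

Let scaleA (a b : loc_ring) (x : loc M) :
  loc_scale a (loc_scale b x) = loc_scale (a * b) x.
Proof.
have [y [s ->]] := loc_ringP a; have [z [t ->]] := loc_ringP b.
have [w [r ->]] := locP x.
rewrite -[ringfrac y s * _]/(loc_mul _ _) loc_mulE !loc_scaleE; apply: frac_eq.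
rewrite !scalerA; congr (_ *: _).
by move: s t r => [s _] [t _] [r _] /=; ring.
Qed.

Let scale1 : left_id (1 : loc_ring) (@loc_scale M).
Proof.
move=> x; have [y [s ->]] := locP x.
rewrite -[1]/(ringfrac 1 denom1) loc_scaleE; apply: frac_eq.
by rewrite scale1r /= mul1r.
Qed.

Let scaleDr : right_distributive (@loc_scale M) +%R.
Proof.
move=> a x y; have [b [s ->]] := loc_ringP a.
have [z [t ->]] := locP x; have [w [r ->]] := locP y.
rewrite fracD !loc_scaleE fracD; apply: frac_eq.
move: s t r => [s _] [t _] [r _] /=.
rewrite !scalerDr !scalerA.
by congr (_ *: _ + _ *: _); ring.
Qed.

Let scaleDl x : {morph (@loc_scale M)^~ x : a b / a + b}.
Proof.
move=> a b; have [y [s ->]] := loc_ringP a; have [z [t ->]] := loc_ringP b.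
have [w [r ->]] := locP x.
rewrite ringfracD !loc_scaleE fracD; apply: frac_eq.
move: s t r => [s _] [t _] [r _] /=.
by rewrite !scalerA -!scalerDl scalerA; congr (_ *: _); ring.
Qed.

HB.instance Definition _ := GRing.Zmodule_isLmodule.Build loc_ring (loc M)
  scaleA scale1 scaleDr scaleDl.

End LocalizedModule.

(* The maximal ideal of the localization at p. *)
Definition loc_max : {pred loc_ring} :=
  [pred z | `[< exists a s, (a \in (p : {pred A})) /\ z = ringfrac a s >]].

End Localization.

Arguments loc_max {A} p.

Section Modules.
Variable A : comNzRingType.

Definition generated_by (M : lmodType A) (n : nat) : Prop :=
  exists v : 'I_n -> M, forall x, exists c : 'I_n -> A, x = \sum_i c i *: v i.

Definition fin_gen (M : lmodType A) : Prop := exists n, generated_by M n.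

Definition noetherian : Prop := forall I : submodClosed A^o, fin_gen (submod I).

Definition mod_iso (M N : lmodType A) : Prop :=
  exists f : {linear M -> N}, bijective f.

Definition short_exact (L M N : lmodType A)
    (f : {linear L -> M}) (g : {linear M -> N}) : Prop :=
  [/\ injective f,
      forall y, g y = 0 <-> exists x, f x = y
    & forall z, exists y, g y = z].

Definition projective (P : lmodType A) : Prop :=
  forall (M N : lmodType A) (g : {linear M -> N}) (h : {linear P -> N}),
    (forall z, exists y, g y = z) ->
  exists h' : {linear P -> M}, forall x, g (h' x) = h x.

Definition injective_module (I : lmodType A) : Prop :=
  forall (M N : lmodType A) (f : {linear M -> N}) (h : {linear M -> I}),
    injective f ->
  exists h' : {linear N -> I}, forall x, h' (f x) = h x.

(* M has an injective resolution of length at most n. *)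
Fixpoint inj_dim_le (n : nat) (M : lmodType A) : Prop :=
  if n is n'.+1 then
    exists (I C : lmodType A) (f : {linear M -> I}) (g : {linear I -> C}),
      [/\ injective_module I, short_exact f g & inj_dim_le n' C]
  else injective_module M.

Definition finite_inj_dim (M : lmodType A) : Prop := exists n, inj_dim_le n M.

(* V is isomorphic to Ext^i(N, M), computed from a projective resolution of N:
   Ext^1(N, M) is the cokernel of Hom(P, M) -> Hom(K, M), and
   Ext^(i+2)(N, M) = Ext^(i+1)(K, M), for 0 -> K -> P -> N -> 0 with P
   projective. *)
Fixpoint is_Ext (i : nat) (N M V : lmodType A) : Prop :=
  match i with
  | 0 => mod_iso (hom N M) V
  | 1 => exists (K P : lmodType A) (f : {linear K -> P}) (g : {linear P -> N})
           (q : {linear hom K M -> V}),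
         [/\ projective P, short_exact f g,
             forall h, q h = 0 <->
               exists h' : hom P M, forall x, h x = h' (f x)
           & forall z, exists h, q h = z]
  | i'.+1 => exists (K P : lmodType A) (f : {linear K -> P})
               (g : {linear P -> N}),
             [/\ projective P, short_exact f g & is_Ext i' K M V]
  end.

(* There is a chain of n + 1 primes, i.e. the Krull dimension is at least n. *)
Definition krull_dim_ge (n : nat) : Prop :=
  exists P : nat -> prime_idealr A, forall i, (i < n)%N ->
    {subset (P i : {pred A}) <= (P i.+1 : {pred A})} /\
    ~ {subset (P i.+1 : {pred A}) <= (P i : {pred A})}.

Definition krull_dim (n : nat) : Prop :=
  krull_dim_ge n /\ ~ krull_dim_ge n.+1.

Definition seq_image (M : lmodType A) (s : seq A) (x : M) : Prop :=
  exists z : nat -> M, x = \sum_(i < size s) s`_i *: z i.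

(* M / (s) M is nonzero, and s_i is a nonzerodivisor on
   M / (s_0, ..., s_(i-1)) M for all i. *)
Definition regular_seq (M : lmodType A) (s : seq A) : Prop :=
  (exists x : M, ~ seq_image s x) /\
  forall i, (i < size s)%N -> forall x : M,
    seq_image (take i s) (s`_i *: x) -> seq_image (take i s) x.

(* depth M >= n over a local ring with maximal ideal m; the depth of 0 is
   infinite. *)
Definition depth_ge (m : {pred A}) (M : lmodType A) (n : nat) : Prop :=
  (forall x : M, x = 0) \/
  exists s : seq A, [/\ size s = n, {subset s <= m} & regular_seq M s].

End Modules.

Definition minimal_prime (A : comNzRingType) (p : prime_idealr A) : Prop :=
  forall q : prime_idealr A, {subset (q : {pred A}) <= (p : {pred A})} ->
    {subset (p : {pred A}) <= (q : {pred A})}.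

(* For Noetherian local rings. *)
Definition gorenstein_local (A : comNzRingType) : Prop :=
  finite_inj_dim (A^o : lmodType A).

Definition generically_gorenstein (A : comNzRingType) : Prop :=
  forall p : prime_idealr A, minimal_prime p -> gorenstein_local (loc_ring p).

(* The inequality depth M_p >= ht A_p = dim A_p holds in N with infinity iff
   every n bounded by the right-hand side is bounded by the left-hand side. *)
Definition CM (A : comNzRingType) (M : lmodType A) : Prop :=
  fin_gen M /\
  forall (p : prime_idealr A) (n : nat),
    krull_dim_ge (loc_ring p) n -> depth_ge (loc_max p) (loc p M) n.

Definition CM_ring (A : comNzRingType) : Prop := CM (A^o : lmodType A).

Section Subcategories.
Variable A : comNzRingType.

Definition OmegaCM (M : lmodType A) : Prop :=
  fin_gen M /\
  exists (n : nat) (N : lmodType A)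
    (f : {linear M -> {ffun 'I_n -> A^o}})
    (g : {linear {ffun 'I_n -> A^o} -> N}),
    short_exact f g /\ CM N.

(* add(M), where {ffun 'I_n -> M} is the direct sum of n copies of M. *)
Definition add_closure (M N : lmodType A) : Prop :=
  exists (n : nat) (L : lmodType A), mod_iso (N * L)%type {ffun 'I_n -> M}.

Definition finite_type (X : lmodType A -> Prop) : Prop :=
  exists M : lmodType A, fin_gen M /\ forall N, add_closure M N <-> X N.

End Subcategories.

Section LocalRings.
Variable A : comNzRingType.
Implicit Types (m I : submodClosed A^o).

Definition maximal_ideal m : Prop :=
  (1 : A^o) \notin m /\
  forall I, {subset (m : {pred A^o}) <= (I : {pred A^o})} ->
    (1 : A^o) \notin I -> {subset (I : {pred A^o}) <= (m : {pred A^o})}.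

(* A is local with maximal ideal m. *)
Definition local_ring m : Prop :=
  maximal_ideal m /\
  forall m', maximal_ideal m' -> (m' : {pred A^o}) =i (m : {pred A^o}).

(* The maximal ideal can be generated by dim A elements. *)
Definition regular_local m : Prop :=
  exists d, krull_dim A d /\ generated_by (submod m) d.

Definition residue_field m : lmodType A := quotmod m.

(* V is annihilated by m, and has dimension n over A / m. *)
Definition residue_dim m (V : lmodType A) (n : nat) : Prop :=
  (forall (a : A^o) (x : V), a \in m -> (a : A) *: x = 0) /\
  exists v : 'I_n -> V,
    (forall x, exists c : 'I_n -> A, x = \sum_i c i *: v i) /\
    (forall c : 'I_n -> A,
       \sum_i c i *: v i = 0 -> forall i, (c i : A^o) \in m).

Definition ext_dim m (i : nat) (M : lmodType A) (r : nat) : Prop :=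
  exists V, is_Ext i (residue_field m) M V /\ residue_dim m V r.

(* The Cohen-Macaulay type of a ring A of dimension one. *)
Definition CM_type m (r : nat) : Prop := ext_dim m 1 A^o r.

(* A canonical module of a Cohen-Macaulay local ring of dimension d is a maximal
   Cohen-Macaulay module of finite injective dimension and of type
   dim Ext^d(A / m, C) = 1. *)
Definition canonical_module m (C : lmodType A) : Prop :=
  [/\ CM C, finite_inj_dim C & exists d, krull_dim A d /\ ext_dim m d C 1].

Definition canonical_ideal m I : Prop :=
  (1 : A^o) \notin I /\ exists C, canonical_module m C /\ mod_iso (submod I) C.

End LocalRings.

(* The length of M is l: there is a composition series of length l. *)
Definition has_length (A : comNzRingType) (M : lmodType A) (l : nat) : Prop :=
  exists N : nat -> submodClosed M,
    [/\ forall x, (x \in N 0) = (x == 0),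
        forall x, x \in N l
      & forall i, (i < l)%N ->
          [/\ {subset (N i : {pred M}) <= (N i.+1 : {pred M})},
              ~ {subset (N i.+1 : {pred M}) <= (N i : {pred M})}
            & forall L : submodClosed M,
                {subset (N i : {pred M}) <= (L : {pred M})} ->
                {subset (L : {pred M}) <= (N i.+1 : {pred M})} ->
                (L : {pred M}) =i (N i : {pred M}) \/
                (L : {pred M}) =i (N i.+1 : {pred M})]].

Section IdealPower.
Variables (A : comNzRingType) (I : submodClosed A^o) (n : nat).

(* I^n: linear combinations of products of n elements of I. *)
Definition ideal_pow : {pred A^o} :=
  [pred x | `[< exists (k : nat) (c : nat -> A) (a : nat -> nat -> A),
                  (forall i j, (a i j : A^o) \in I) /\
                  x = \sum_(i < k) c i * \prod_(j < n) a i j >]].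

Lemma ideal_pow_closed : submod_closed ideal_pow.
Proof.
split.
  rewrite inE; apply/asboolP; exists 0%N, (fun=> 0), (fun _ _ => 0).
  by split; [move=> _ _; exact: rpred0 | rewrite big_ord0].
move=> b x y; rewrite !inE => /asboolP[k [c [a [aI ->]]]].
move=> /asboolP[l [d [e [eI ->]]]]; apply/asboolP.
exists (k + l)%N, (fun i => if (i < k)%N then b * c i else d (i - k)%N),
  (fun i => if (i < k)%N then a i else e (i - k)%N).
split; first by move=> i j; case: ifP.
rewrite big_split_ord /=; congr (_ + _).
  rewrite -[_ *: _]/(b * _) mulr_sumr; apply: eq_bigr => i _.
  by rewrite ltn_ord mulrA.
by apply: eq_bigr => i _; rewrite ltnNge leq_addr /= addKn.
Qed.

HB.instance Definition _ :=
  GRing.isSubmodClosed.Build A A^o ideal_pow ideal_pow_closed.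

End IdealPower.

Definition hilbert_coefficients (A : comNzRingType) (I : submodClosed A^o)
    (e0 e1 : int) : Prop :=
  exists n0 : nat, forall n, (n0 <= n)%N ->
    exists l : nat, has_length (quotmod (ideal_pow I n.+1)) l /\
      l%:Z = e0 * n.+1%:Z - e1.

(* For one-dimensional Cohen-Macaulay local rings. *)
Definition almost_gorenstein (A : comNzRingType) (m : submodClosed A^o) : Prop :=
  exists (I : submodClosed A^o) (e0 e1 : int) (r : nat),
    [/\ canonical_ideal m I, hilbert_coefficients I e0 e1, CM_type m r
      & e1 <= r%:Z].

(* Main.v *)
(** Let a be a nonzerodivisor in m. Over R and over E = End(m), the finitely
    generated Cohen-Macaulay modules are those on which a is regular, and N lies
    in OmegaCM(R) iff moreover every x outside a N is sent outside a R by some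
    f : N -> R. If N in OmegaCM(R) has no free summand, all its functionals have
    values in m, which makes N an E-module. Conversely CM(E) lies in OmegaCM(R):
    let I be the canonical ideal of the almost Gorenstein ring. As I has finite
    injective dimension, Ext^1(M, I) = 0 for M Cohen-Macaulay, so I separates
    points of M / a M; a map from an E-module to I has values in (I : E) = m I.
    If I is principal, this is enough. Otherwise E I^n = I^n for n > 1. Some power
    I^d has a principal reduction; take it for a. Comparing lengths in
    a R <= (a R : m) <= I^d <= R, the inequality e_1(I) <= r(R) forces
    I^d = (a R : m) = a E, hence m I^d = a m, and multiplication by I^(d-1) / a
    turns maps M -> m I into maps M -> R that still separate x from a M.
    Both finite type conditions then transfer: OmegaCM(R) = add(R + X) if
    CM(E) = add(X), and CM(E) = add(Hom_R(E, Y)) if OmegaCM(R) = add(Y). *)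

From HB Require Import structures.
From mathcomp Require Import all_boot all_order all_algebra.
From mathcomp Require Import ring_quotient generic_quotient boolp.
From mathcomp Require Import ring zify.
Require Import Defs.

Set Implicit Arguments.
Unset Strict Implicit.
Unset Printing Implicit Defensive.

Import GRing.Theory.
Local Open Scope ring_scope.
Local Open Scope quotient_scope.

(** * Submodules of Noetherian modules *)

(** No total quotient ring is formed: an element of E is kept as its numerator over a, which lies in
    (a R : m), and identities are checked after cancelling a. A power of I is unavoidable, since I
    itself may have no principal reduction when the residue field is finite. The separating property
    of a canonical module W comes from moving a point outside a V and a point outside a W to socle
    elements x, y modulo a; vanishing of Ext^1(x R + a V, W) then lifts the map x |-> y of socles to
    a map V -> W. Ext is handled throughout as the extension of maps from submodules. Applied to
    maps from R, I^2 and m I into I, separation yields in turn End(I) = R, E I^2 = I^2 and (I : E) =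
    m I. *)

Section Submodules.
Variable A : comNzRingType.

(** Bare predicates let images, kernels, colons and products be named by formulas; [submodP] bundles
    one when a module type is required. *)
Definition subm (V : lmodType A) (N : V -> Prop) : Prop :=
  N 0 /\ forall a x y, N x -> N y -> N (a *: x + y).

Section Closure.
Variables (V : lmodType A) (N : V -> Prop).
Hypothesis sN : subm N.

Lemma submD x y : N x -> N y -> N (x + y).
Proof. by move=> Nx Ny; rewrite -[x]scale1r; apply: sN.2. Qed.

Lemma submZ a x : N x -> N (a *: x).
Proof. by move=> Nx; rewrite -[_ *: _]addr0; apply: sN.2 => //; case: sN. Qed.

Lemma submN x : N x -> N (- x).
Proof. by move=> Nx; rewrite -scaleN1r; apply: submZ. Qed.

Lemma submB x y : N x -> N y -> N (x - y).
Proof. by move=> Nx Ny; apply: submD => //; apply: submN. Qed.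

Lemma subm_sum (I : Type) (r : seq I) (P : pred I) (F : I -> V) :
  (forall i, P i -> N (F i)) -> N (\sum_(i <- r | P i) F i).
Proof.
move=> NF; elim/big_rec: _ => [|i x Pi Nx]; first by case: sN.
by apply: submD => //; apply: NF.
Qed.

End Closure.

Definition fgsub (V : lmodType A) (N : V -> Prop) : Prop :=
  exists n (v : 'I_n -> V), (forall i, N (v i)) /\
    forall x, N x -> exists c : 'I_n -> A, x = \sum_i c i *: v i.

Definition noethmod (V : lmodType A) : Prop :=
  forall N : V -> Prop, subm N -> fgsub N.

Lemma subm_of (V : lmodType A) (N : submodClosed V) : subm (fun x => x \in N).
Proof. by split=> [|a x y xN yN]; [exact: rpred0 | rewrite rpredD // rpredZ]. Qed.

Lemma submodP (V : lmodType A) (N : V -> Prop) : subm N ->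
  exists N' : submodClosed V, forall x, x \in N' <-> N x.
Proof.
move=> sN; pose P : {pred V} := fun x => `[< N x >].
have clP : submod_closed P.
  split; first by apply/asboolP; case: sN.
  by move=> a x y /asboolP xN /asboolP yN; apply/asboolP/sN.2.
pose N' : submodClosed V := HB.pack P (GRing.isSubmodClosed.Build A V P clP).
by exists N' => x; split=> /asboolP.
Qed.

(** A family without a maximal member yields, by choice, a strictly increasing sequence. Its union
    is finitely generated, so one stage [K] contains all generators and stage [K.+1] cannot be
    larger. *)
Lemma acc (V : lmodType A) (F : (V -> Prop) -> Prop) : noethmod V ->
  (exists N, F N) -> (forall N, F N -> subm N) ->
  exists N, F N /\ forall N', F N' -> (forall x, N x -> N' x) ->
    forall x, N' x -> N x.
Proof.
move=> nV [N0 FN0] Fsub; apply: contrapT => nomax.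
have step (N : {N | F N}) : exists N' : {N | F N},
    (forall x, sval N x -> sval N' x) /\ exists x, sval N' x /\ ~ sval N x.
  case: N => N FN /=; apply: contrapT => noN'; apply: nomax; exists N; split=> //.
  move=> N' FN' sNN' x N'x; apply: contrapT => nNx.
  by apply: noN'; exists (exist _ N' FN'); split=> //; exists x.
have [f fP] := choice step.
pose g k := sval (iter k f (exist _ N0 FN0)).
have gS k x : g k x -> g k.+1 x by rewrite /g /=; apply: (fP _).1.
have gle k l x : (k <= l)%N -> g k x -> g l x.
  by move=> /subnK <-; elim: (l - k)%N => //= d IH /IH /gS.
have gsub k : subm (g k) by apply: Fsub; rewrite /g; case: (iter _ _ _).
have sU : subm (fun x => exists k, g k x).
  split; first by exists 0%N; case: (gsub 0%N).
  move=> a x y [k gx] [l gy]; exists (maxn k l); apply: (gsub _).2.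
    exact: gle (leq_maxl _ _) gx.
  exact: gle (leq_maxr _ _) gy.
have [n [v [vU vgen]]] := nV _ sU.
have [h hP] := choice vU.
pose K := (\max_i h i)%N.
have [x [gx ngx]] := (fP (iter K f (exist _ N0 FN0))).2.
apply: ngx; have [c ->] := vgen x (ex_intro _ K.+1 gx).
apply: (subm_sum (gsub K)) => i _; apply: (submZ (gsub K)).
by apply: gle (hP i); apply: (leq_bigmax i).
Qed.

Definition lspan (V : lmodType A) n (v : 'I_n -> V) (x : V) : Prop :=
  exists c : 'I_n -> A, x = \sum_i c i *: v i.

Lemma lspan_subm (V : lmodType A) n (v : 'I_n -> V) : subm (lspan v).
Proof.
split; first by exists (fun=> 0); rewrite big1 // => i _; rewrite scale0r.
move=> a x y [c ->] [d ->]; exists (fun i => a * c i + d i).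
rewrite scaler_sumr -big_split /=; apply: eq_bigr => i _.
by rewrite scalerDl scalerA.
Qed.

Lemma lspan_gen (V : lmodType A) n (v : 'I_n -> V) i : lspan v (v i).
Proof.
exists (fun j => (j == i)%:R); rewrite (bigD1 i) //= eqxx scale1r big1 ?addr0 //.
by move=> j /negbTE->; rewrite scale0r.
Qed.

Lemma fg_noeth_lspan (V : lmodType A) : noethmod (A^o : lmodType A) ->
  forall n (v : 'I_n -> V) (N : V -> Prop), subm N ->
  (forall x, N x -> lspan v x) -> fgsub N.
Proof.
move=> nA; elim=> [|n IH] v N sN Nv.
  exists 0%N, v; split=> [[]//|x /Nv [c ->]]; by exists c.
pose v' i := v (lift ord0 i).
have sv' := lspan_subm v'.
(* The ideal of coefficients of [v ord0] in elements of [N], modulo the span of the other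
   generators. Lifts of its generators and generators of [N'] together generate [N]. *)
pose a (r : A^o) := exists s, lspan v' s /\ N ((r : A) *: v ord0 + s).
have sa : subm a.
  split; first by exists 0; split; [case: sv' | rewrite scale0r addr0; case: sN].
  move=> b x y [s [ss Nx]] [u [su Ny]]; exists (b *: s + u); split.
    exact: sv'.2.
  have -> : (b *: x + y : A) *: v ord0 + (b *: s + u) =
      b *: ((x : A) *: v ord0 + s) + ((y : A) *: v ord0 + u).
    by rewrite scalerDl scalerDr scalerA addrACA.
  exact: sN.2.
have [p [r [ra rgen]]] := nA _ sa.
have [s sP] := choice ra.
pose N' x := N x /\ lspan v' x.
have sN' : subm N'.
  split; first by split; [case: sN | case: sv'].
  by move=> b x y [? ?] [? ?]; split; [apply: sN.2 | apply: sv'.2].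
have [q [u [uN' ugen]]] := IH v' N' sN' (fun x => @proj2 _ _).
pose w (i : 'I_(p + q)) := match split i with
  | inl j => (r j : A) *: v ord0 + s j | inr k => u k end.
exists (p + q)%N, w; split.
  by move=> i; rewrite /w; case: (split i) => j; [case: (sP j) | case: (uN' j)].
move=> x Nx; have [c xE] := Nv x Nx.
have /rgen [d dE] : a (c ord0).
  exists (\sum_i c (lift ord0 i) *: v' i); split.
    by exists (fun i => c (lift ord0 i)).
  by move: Nx; rewrite xE big_ord_recl.
pose y := \sum_j d j *: ((r j : A) *: v ord0 + s j).
have /ugen [e eE] : N' (x - y).
  split.
    apply: (submB sN) => //; apply: (subm_sum sN) => j _; apply: (submZ sN).
    by case: (sP j).
  rewrite xE big_ord_recl /y dE scaler_suml.
  under [X in _ - X]eq_bigr => j _ do rewrite scalerDr scalerA.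
  rewrite big_split /= opprD addrACA subrr add0r.
  apply: (submB sv'); first by exists (fun i => c (lift ord0 i)).
  by apply: (subm_sum sv') => j _; apply: (submZ sv'); case: (sP j).
exists (fun i => match split i with inl j => d j | inr k => e k end).
have spl i : split (lshift q i) = inl i := unsplitK (inl i).
have spr i : split (rshift p i) = inr i := unsplitK (inr i).
have -> : x = y + \sum_i e i *: u i by rewrite -eE addrC subrK.
rewrite big_split_ord; congr (_ + _); apply: eq_bigr => i _.
  by rewrite /w spl.
by rewrite /w spr.
Qed.

Lemma fg_noeth (V : lmodType A) :
  noethmod (A^o : lmodType A) -> fin_gen V -> noethmod V.
Proof.
move=> nA [n [v vgen]] N sN; apply: (fg_noeth_lspan nA (v := v) sN) => x _.
exact: vgen.
Qed.

Lemma noethmod_fin_gen (V : lmodType A) : noethmod V -> fin_gen V.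
Proof.
move=> nV; have sT : subm (fun _ : V => True) by [].
by have [n [v [_ vgen]]] := nV _ sT; exists n, v => x; apply: vgen.
Qed.

Lemma noetherianP : noetherian A <-> noethmod (A^o : lmodType A).
Proof.
split=> [nA N sN|nA I].
  have [I IE] := submodP sN; have [n [v vgen]] := nA I.
  exists n, (fun i => submod_val (v i)); split.
    by move=> i; apply/IE; case: (v i).
  move=> x /IE xI; have [c cE] := vgen (Submod xI); exists c.
  by rewrite -[x]/(val (Submod xI)) cE linear_sum.
have [n [v [vI vgen]]] := nA _ (subm_of I).
exists n, (fun i => Submod (vI i)) => x.
have [c cE] := vgen (val x) (valP x); exists c; apply: val_inj.
by rewrite cE linear_sum.
Qed.

(** Elimination: as [1 - c0 ord0] is invertible, the first congruence expresses [v ord0] through the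
    other vectors modulo [N], and substituting it keeps the coefficients of the remaining
    congruences in [J]. *)
Lemma nakayama (V : lmodType A) (J : A^o -> Prop) (N : V -> Prop) :
  subm J -> (forall a, J a -> exists b, b * (1 - a) = 1) -> subm N ->
  forall n (v : 'I_n -> V),
  (forall i, exists c, (forall j, J (c j)) /\ N (v i - \sum_j c j *: v j)) ->
  forall i, N (v i).
Proof.
move=> sJ invJ sN; elim=> [|n IH] v H; first by case.
have [c0 [Jc0 Nc0]] := H ord0.
have [b bE] := invJ _ (Jc0 ord0).
pose v' i := v (lift ord0 i).
have Nv0 : N (v ord0 - \sum_j (b * c0 (lift ord0 j)) *: v' j).
  move: (submZ sN b Nc0); rewrite big_ord_recl opprD addrA.
  have -> : v ord0 - c0 ord0 *: v ord0 = (1 - c0 ord0) *: v ord0.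
    by rewrite scalerBl scale1r.
  rewrite scalerBr scalerA bE scale1r scaler_sumr.
  by under eq_bigr => j _ do rewrite scalerA.
have Nv' : forall i, N (v' i).
  apply: IH => i; have [c [Jc Nc]] := H (lift ord0 i).
  exists (fun j => c (lift ord0 j) + c ord0 * b * c0 (lift ord0 j)); split.
    by move=> j; apply: (submD sJ) => //; apply: (submZ sJ _ (Jc0 _)).
  move: (submD sN Nc (submZ sN (c ord0) Nv0)).
  rewrite big_ord_recl scalerBr scaler_sumr addrA opprD addrA.
  rewrite [v (lift _ _) - _ - _]addrAC subrK -addrA -opprD -big_split /=.
  by under eq_bigr => j _ do rewrite scalerA -scalerDl mulrA.
have Nv00 : N (v ord0).
  rewrite -[v ord0](subrK (\sum_j (b * c0 (lift ord0 j)) *: v' j)).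
  by apply: (submD sN) => //; apply: (subm_sum sN) => j _; apply: (submZ sN).
by move=> i; case: (unliftP ord0 i) => [j ->|->]; [apply: Nv' | ].
Qed.

Definition treg (V : lmodType A) (t : A) : Prop :=
  forall x : V, t *: x = 0 -> x = 0.

Definition tmul (V : lmodType A) (t : A) (x : V) : Prop := exists y, x = t *: y.

Lemma tmul_subm (V : lmodType A) (t : A) : subm (@tmul V t).
Proof.
split; first by exists 0; rewrite scaler0.
move=> a x y [x' ->] [y' ->]; exists (a *: x' + y').
by rewrite scalerDr !scalerA mulrC.
Qed.

Lemma tregI (V : lmodType A) (t : A) (x y : V) :
  treg V t -> t *: x = t *: y -> x = y.
Proof.
move=> tV e; apply/eqP; rewrite -subr_eq0; apply/eqP/tV.
by rewrite scalerBr e subrr.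
Qed.

Lemma linear_exists (V W : lmodType A) (f : V -> W) : linear f ->
  exists F : {linear V -> W}, forall x, F x = f x.
Proof.
move=> lf.
pose F : {linear V -> W} := HB.pack f (GRing.isLinear.Build A V W *:%R f lf).
by exists F.
Qed.

End Submodules.

(** * Vanishing of Ext into modules of finite injective dimension *)

Section PartialLinear.
Variable A : comNzRingType.
Implicit Types V W J C : lmodType A.

(** The map is total with arbitrary values outside [N], so that maps on submodules of one module can
    be extended and compared without changing types. *)
Definition lin_on V W (N : V -> Prop) (h : V -> W) : Prop :=
  forall a x y, N x -> N y -> h (a *: x + y) = a *: h x + h y.

Lemma lin_on0 V W (N : V -> Prop) (h : V -> W) : subm N -> lin_on N h -> h 0 = 0.
Proof.
move=> [N0 _] lh; have := lh (-1) 0 0 N0 N0.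
by rewrite scaler0 add0r scaleN1r addNr.
Qed.

Lemma lin_onZ V W (N : V -> Prop) (h : V -> W) a x :
  subm N -> lin_on N h -> N x -> h (a *: x) = a *: h x.
Proof.
move=> sN lh Nx; rewrite -[a *: x]addr0 lh ?(lin_on0 sN lh) ?addr0 //.
by case: sN.
Qed.

Lemma lin_on_sum V W (N : V -> Prop) (h : V -> W) n (c : 'I_n -> A) v :
  subm N -> lin_on N h -> (forall i, N (v i)) ->
  h (\sum_i c i *: v i) = \sum_i c i *: h (v i).
Proof.
move=> sN lh Nv.
have [] : h (\sum_i c i *: v i) = \sum_i c i *: h (v i) /\ N (\sum_i c i *: v i);
  last by [].
elim/big_rec2: _ => [|i y1 y2 _ [<- N1]].
  by rewrite (lin_on0 sN lh); split=> //; case: sN.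
by split; [rewrite lh | apply: sN.2].
Qed.

(** A map prescribed on combinations of generators is a relation closed under linear combinations;
    it is single-valued as soon as [0] is related to [0] only. *)
Lemma graph_fun V W (G : V -> W -> Prop) :
  (forall a x y u v, G x u -> G y v -> G (a *: x + y) (a *: u + v)) ->
  (forall u, G 0 u -> u = 0) ->
  exists f : V -> W, forall x u, G x u -> f x = u.
Proof.
move=> Glin G0.
have H x : exists u, (exists u', G x u') -> G x u.
  by case: (EM (exists u', G x u')) => [[u Gu]|nG]; [exists u | exists 0].
have [f fP] := choice H; exists f => x u Gu.
have Gf := fP x (ex_intro _ u Gu).
apply/eqP; rewrite -subr_eq0; apply/eqP/G0.
have := Glin (-1) x x u (f x) Gu Gf.
by rewrite !scaleN1r addNr addrC.
Qed.

Lemma inj_ext V J (N : V -> Prop) (h : V -> J) : injective_module J ->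
  subm N -> lin_on N h -> exists H : {linear V -> J}, forall x, N x -> H x = h x.
Proof.
move=> iJ sN lh; have [N' N'E] := submodP sN.
have lv : linear (fun x : submod N' => submod_val x).
  by move=> a x y; exact: (linearP (val : submod N' -> V)).
have [v vE] := linear_exists lv.
have lg : linear (fun x : submod N' => h (submod_val x)).
  move=> a x y; rewrite -lh; [|apply/N'E; exact: (valP x)|apply/N'E; exact: (valP y)].
  by congr h; exact: (linearP (val : submod N' -> V)).
have [g gE] := linear_exists lg.
have [|H HE] := iJ _ _ v g.
  by move=> x y; rewrite !vE => /val_inj.
exists H => x /N'E Nx; have := HE (Submod Nx).
by rewrite vE gE.
Qed.

Lemma inj_div J t : injective_module J -> treg (A^o : lmodType A) t ->
  forall y : J, exists z, t *: z = y.
Proof.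
move=> iJ rt y.
have l1 : linear (fun x : A^o => t *: x) by move=> a x z; rewrite scalerDr !scalerA mulrC.
have [f fE] := linear_exists l1.
have l2 : linear (fun x : A^o => (x : A) *: y).
  by move=> a x z; rewrite scalerDl scalerA.
have [h hE] := linear_exists l2.
have [|H HE] := iJ _ _ f h; first by move=> x z; rewrite !fE => /(tregI rt).
exists (H 1); rewrite -linearZ_LR.
by rewrite -[_ *: 1]fE HE hE scale1r.
Qed.

Lemma fin_gen_fin V (T : finType) (v : T -> V) :
  (forall x, exists c : T -> A, x = \sum_i c i *: v i) -> fin_gen V.
Proof.
move=> vgen; exists #|T|, (fun i => v (enum_val i)) => x.
have [c ->] := vgen x; exists (fun i => c (enum_val i)).
by rewrite (reindex (@enum_val T T)) //=; apply: onW_bij; apply: enum_val_bij.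
Qed.

Lemma fin_gen_ffun V q : fin_gen V -> fin_gen {ffun 'I_q -> V}.
Proof.
move=> [n [v vgen]].
apply: (@fin_gen_fin _ ('I_q * 'I_n)%type
  (fun p => [ffun j => if j == p.1 then v p.2 else 0])) => x.
have [c cE] := choice (fun j => vgen (x j)).
exists (fun p => c p.1 p.2); apply/ffunP => j.
rewrite sum_ffunE.
transitivity (\sum_i \sum_k c i k *: (if j == i then v k else 0)); last first.
  by rewrite pair_bigA; apply: eq_bigr => p _; rewrite !ffunE.
rewrite (bigD1 j) //= eqxx -cE [X in _ + X]big1 ?addr0 // => i /negbTE ij.
by apply: big1 => k _; rewrite eq_sym ij scaler0.
Qed.

Definition delta q (i : 'I_q) : {ffun 'I_q -> A^o} := [ffun j => (j == i)%:R].

Lemma ffun_delta q (c : {ffun 'I_q -> A^o}) : c = \sum_i (c i : A) *: delta i.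
Proof.
apply/ffunP => j; rewrite sum_ffunE (bigD1 j) //= big1 ?addr0.
  by rewrite !ffunE eqxx [RHS]mulr1.
by move=> i /negbTE ij; rewrite !ffunE eq_sym ij [LHS]mulr0.
Qed.

Lemma fin_gen_self : fin_gen (A^o : lmodType A).
Proof.
by exists 1%N, (fun=> 1) => x; exists (fun=> x); rewrite big_ord1 [RHS]mulr1.
Qed.

End PartialLinear.

Section Duality.
Variables (A : comNzRingType) (M : A^o -> Prop) (t : A).
Hypotheses (nA : noethmod (A^o : lmodType A)) (sM : subm M) (M1 : ~ M 1).
Hypothesis unitM : forall a : A, ~ M a -> exists b, b * a = 1.
Hypotheses (Mt : M t) (rt : treg (A^o : lmodType A) t).
Hypothesis radt : forall a, M a -> exists k b, a ^+ k = t * b.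

Lemma jacM (a : A) : M a -> exists b, b * (1 - a) = 1.
Proof.
move=> Ma; apply: unitM => H; apply: M1.
by rewrite -(subrK a 1); apply: (submD sM).
Qed.

(** Some power of each element of [M] is a multiple of [t], so it sends [x] into [N]. For each
    generator of [M] in turn, [x] is multiplied by the last power that leaves it outside [N]; the
    result spans a copy of A / M in V / N. *)
Lemma socle (V : lmodType A) (N : V -> Prop) (x : V) : subm N -> ~ N x ->
  (forall b, N ((t * b) *: x)) ->
  exists a, ~ N (a *: x) /\ forall b, M b -> N (b *: (a *: x)).
Proof.
move=> sN nNx Ntx.
have [n [r [Mr rgen]]] := nA sM.
have [a [nNa Na]] : exists a, ~ N (a *: x) /\
    forall b, b \in [seq r i | i <- enum 'I_n] -> N ((b : A) *: (a *: x)).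
  have : forall b, b \in [seq r i | i <- enum 'I_n] -> M b by move=> b /mapP[i _ ->].
  elim: [seq r i | i <- enum 'I_n] => [_|b s IH sM']; first by exists 1; rewrite scale1r.
  have [a [nNa Na]] := IH (fun c cs => sM' c (mem_behead (s := b :: s) cs)).
  have [k [d kE]] := radt (sM' b (mem_head _ _)).
  have ex : exists k, `[< N (((b : A) ^+ k) *: (a *: x)) >].
    exists k; apply/asboolP; rewrite kE scalerA.
    by have := Ntx (d * a); rewrite mulrA.
  have [[|j] /asboolP Nj jmin] := ex_minnP ex; first by move: Nj; rewrite expr0 scale1r.
  exists (b ^+ j * a); split.
    by rewrite -scalerA => /asboolP /jmin; rewrite ltnn.
  move=> c; rewrite in_cons => /orP[/eqP->|cs].
    by rewrite scalerA mulrA -exprS -scalerA.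
  by rewrite scalerA mulrCA -scalerA; apply: (submZ sN); rewrite -scalerA; apply: Na.
exists a; split=> // b /rgen [c ->].
rewrite scaler_suml; apply: (subm_sum sN) => i _.
rewrite -[(c i *: r i)]/(c i * (r i : A)) -scalerA; apply: (submZ sN); apply: Na.
by apply: map_f; rewrite mem_enum.
Qed.

(* Ext^1(A / M, C) = 0 *)
Definition ext_vanish (C : lmodType A) : Prop :=
  forall g : A^o -> C, lin_on M g -> exists c, forall a, M a -> g a = (a : A) *: c.

(** A maximal extension is defined on all of [N']: otherwise [socle] yields [z1] outside its domain
    [L] with [M z1] inside [L]; the map [b |-> h' (b z1)] on [M] is multiplication by some [c], and
    [z1 |-> c] extends it further. *)
Lemma ext_vanish_extend (C V : lmodType A) (N N' : V -> Prop) (h : V -> C) :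
  ext_vanish C -> noethmod V -> subm N -> subm N' ->
  (forall x, N x -> N' x) -> (forall x, N' x -> N (t *: x)) -> lin_on N h ->
  exists h', lin_on N' h' /\ forall x, N x -> h' x = h x.
Proof.
move=> PC nV sN sN' NN' tN' lh.
pose F (L : V -> Prop) := [/\ subm L, forall x, N x -> L x, forall x, L x -> N' x
  & exists h', lin_on L h' /\ forall x, N x -> h' x = h x].
have [||L [[sL NL LN' [h' [lh' h'E]]] Lmax]] := @acc A V F nV.
- by exists N; split=> //; exists h.
- by move=> L [].
have N'L z : N' z -> L z.
  move=> N'z; apply: contrapT => nLz.
  have [z1 [N'z1 nLa La]] : exists z1, [/\ N' z1, ~ L z1 & forall b, M b -> L (b *: z1)].
    have [|a [nLa La]] := @socle V L z sL nLz.
      by move=> b; apply: NL; rewrite -scalerA; apply: tN'; apply: (submZ sN').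
    by exists (a *: z); split=> //; apply: (submZ sN').
  have [|c cE] := PC (fun b => h' ((b : A) *: z1)).
    move=> b b1 b2 Mb1 Mb2; rewrite -(lh' b _ _ (La _ Mb1) (La _ Mb2)).
    by rewrite scalerDl scalerA.
  pose G x w := exists u b, [/\ L u, x = u + b *: z1 & w = h' u + b *: c].
  have Glin e x1 x2 w1 w2 : G x1 w1 -> G x2 w2 -> G (e *: x1 + x2) (e *: w1 + w2).
    move=> [u1 [b1 [Lu1 -> ->]]] [u2 [b2 [Lu2 -> ->]]].
    exists (e *: u1 + u2), (e * b1 + b2); rewrite lh' //; split.
    - exact: sL.2.
    - by rewrite scalerDl scalerDr scalerA addrACA.
    - by rewrite scalerDl scalerDr scalerA addrACA.
  have G0 w : G 0 w -> w = 0.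
    move=> [u [b [Lu uE ->]]].
    have {}uE : u = - (b *: z1) by apply/eqP; rewrite -addr_eq0 -uE.
    have Mb : M b.
      apply: contrapT => /unitM [b' b'E]; apply: nLa.
      rewrite -[z1]scale1r -b'E -scalerA; apply: (submZ sL).
      by rewrite -[b *: z1]opprK -uE; apply: (submN sL).
    rewrite uE -scaleN1r (lin_onZ _ sL lh' (La _ Mb)) scaleN1r.
    by rewrite (cE b Mb : h' (b *: z1) = b *: c) addNr.
  have [h1 h1E] := graph_fun Glin G0.
  pose L1 x := exists w, G x w.
  have GL x : L x -> G x (h' x).
    by move=> Lx; exists x, 0; rewrite !scale0r !addr0.
  apply: nLa; apply: (Lmax L1).
  - split.
    + split; first by exists (h' 0); apply: GL; case: sL.
      by move=> e x1 x2 [w1 G1] [w2 G2]; exists (e *: w1 + w2); apply: Glin.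
    + by move=> x /NL /GL Gx; exists (h' x).
    + move=> x [w [u [b [/LN' N'u -> _]]]]; apply: (submD sN') => //.
      exact: (submZ sN').
    + exists h1; split.
        move=> e x1 x2 [w1 G1] [w2 G2].
        by rewrite (h1E _ _ G1) (h1E _ _ G2); apply/h1E/Glin.
      by move=> x Nx; rewrite -h'E //; apply/h1E/GL/NL.
  - by move=> x /GL Gx; exists (h' x).
  - exists (h' 0 + 1 *: c), 0, 1; rewrite add0r scale1r; split=> //.
    by case: sL.
exists h'; split=> // a x y /N'L Lx /N'L Ly; exact: lh'.
Qed.

Lemma ext_vanish_inj (J : lmodType A) : injective_module J -> ext_vanish J.
Proof.
move=> iJ g lg; have [H HE] := inj_ext iJ sM lg.
by exists (H 1) => a Ma; rewrite -HE // -linearZ_LR /=; congr (H _); rewrite [RHS]mulr1.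
Qed.

(* Dimension shifting: Ext^2(A / M, C) = Ext^1(A / M, C') = 0 gives
   Ext^1(A / M, C) = 0, since A / M embeds in A / t and Ext^1(A / t, C) = C / t C. *)
Lemma ext_vanish_shift (C J C' : lmodType A) (f : {linear C -> J})
    (g : {linear J -> C'}) :
  injective_module J -> short_exact f g -> (forall y : C, exists z, t *: z = y) ->
  ext_vanish C' -> ext_vanish C.
Proof.
move=> iJ [finj exact gsurj] divC PC' g0 lg0.
(* [s] spans a copy of A / M in A / t. *)
have [||s [ns Ms]] := @socle A^o (@tmul A A^o t) 1 (@tmul_subm A A^o t).
- move=> [y yE]; apply: M1; rewrite yE -[t *: y]/(t * (y : A)) mulrC.
  exact: (submZ sM).
- by move=> b; exists b; rewrite -[LHS]/(t * b * 1) mulr1.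
have sE : s *: (1 : A^o) = s by rewrite -[LHS]/(s * 1) mulr1.
rewrite {}sE in ns Ms.
have [H HE] := @inj_ext A _ _ _ (fun a => f (g0 a)) iJ sM
  (fun a x y Mx My => etrans (congr1 f (lg0 a x y Mx My)) (linearP f a _ _)).
pose j := H 1; have {}HE a : M a -> f (g0 a) = a *: j.
  by move=> Ma; rewrite -HE // -linearZ_LR; congr (H _); rewrite [RHS]mulr1.
pose z := g j; have Mz b : M b -> b *: z = 0.
  by move=> Mb; rewrite -linearZ_LR -HE //; apply/exact; exists (g0 b).
(* The map on the ideal (s, t) with [s |-> z] and [t |-> 0]. It is well defined because [M] kills
   [z] and [s] is not in t A. *)
pose G (x : A^o) w := exists al be : A, x = al * s + be * t /\ w = al *: z.
have Glin e x1 x2 w1 w2 : G x1 w1 -> G x2 w2 -> G (e *: x1 + x2) (e *: w1 + w2).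
  move=> [a1 [b1 [-> ->]]] [a2 [b2 [-> ->]]].
  exists (e * a1 + a2), (e * b1 + b2); rewrite scalerDl scalerA; split=> //.
  by rewrite -[LHS]/(e * (a1 * s + b1 * t) + (a2 * s + b2 * t)); ring.
have G0 w : G 0 w -> w = 0.
  move=> [al [be [E ->]]]; apply: Mz; apply: contrapT => /unitM [b bE].
  apply: ns; exists (- (b * be)); rewrite -[RHS]/(t * - (b * be)).
  have -> : s = b * (al * s + be * t) - b * be * t by rewrite -[s in LHS]mul1r -bE; ring.
  by rewrite -E; ring.
have [h0 h0E] := graph_fun Glin G0.
pose N x := exists w, G x w.
have sN : subm N.
  split; first by exists (0 *: z), 0, 0; rewrite !mul0r addr0.
  by move=> e x1 x2 [w1 G1] [w2 G2]; exists (e *: w1 + w2); apply: Glin.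
have [||||h' [lh' h'E]] := ext_vanish_extend (N' := fun=> True) (h := h0) PC' nA sN.
- by [].
- by [].
- by move=> x _; exists (0 *: z), 0, x; rewrite mul0r add0r mulrC.
- by move=> e x1 x2 [w1 G1] [w2 G2]; rewrite (h0E _ _ G1) (h0E _ _ G2); apply/h0E/Glin.
pose y := h' 1.
have hZ a : h' a = a *: y.
  rewrite -(lin_onZ (N := fun=> True) (h := h')) //.
  by congr h'; rewrite [RHS]mulr1.
have sy : s *: y = z.
  have Gs : G s z by exists 1, 0; rewrite mul1r mul0r addr0 scale1r.
  by rewrite -hZ h'E ?(h0E _ _ Gs) //; exists z.
have ty : t *: y = 0.
  have Gt : G t 0 by exists 0, 1; rewrite mul1r mul0r add0r scale0r.
  by rewrite -hZ h'E ?(h0E _ _ Gt) //; exists 0.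
have [jt jtE] := gsurj y.
have [c1 c1E] : exists c, f c = t *: jt by apply/exact; rewrite linearZ_LR jtE.
(* Divisibility of [C] corrects the lift of [y] to a lift [jt2] killed by [t]. As M s lies in t A,
   [M] kills [s *: jt2], which can be subtracted from [j] to land in [C]. *)
have [c2 c2E] := divC c1.
pose jt2 := jt - f c2.
have tjt2 : t *: jt2 = 0 by rewrite scalerBr -c1E -c2E linearZ_LR subrr.
have gjt2 : g jt2 = y.
  rewrite linearB jtE /=.
  have -> : g (f c2) = 0 by apply/exact; exists c2.
  by rewrite subr0.
have [c cE] : exists c, f c = j - s *: jt2.
  by apply/exact; rewrite linearB linearZ_LR /= gjt2 sy subrr.
exists c => a Ma; apply: finj; rewrite HE // linearZ_LR /= cE scalerBr.
have [d dE] := Ms _ Ma.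
have dE' : a * s = d * t by rewrite mulrC [d * t]mulrC -[RHS]/(t *: (d : A^o)) -dE [LHS]mulrC.
by rewrite scalerA dE' -scalerA tjt2 scaler0 subr0.
Qed.

(** The divisibility that [ext_vanish_shift] asks for is inherited by cosyzygies, since these are
    quotients of injective modules. *)
Lemma inj_dim_ext_vanish n (C : lmodType A) : inj_dim_le n C ->
  (forall y : C, exists z, t *: z = y) -> ext_vanish C.
Proof.
elim: n C => [|n IH] C /=; first by move=> iC _; apply: ext_vanish_inj.
move=> [J [C' [f [g [iJ ex dC']]]]] divC; apply: (ext_vanish_shift iJ ex divC).
apply: IH => // y; case: ex => _ _ /(_ y) [x <-].
by have [z <-] := inj_div iJ rt x; exists (g z); rewrite linearZ_LR.
Qed.

(** [W] itself is not assumed divisible by [t], but its first cosyzygy is divisible, being a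
    quotient of an injective module. For injective [W] the cosyzygy is the zero module [Z]. *)
Lemma finite_inj_dim_res (W : lmodType A) : finite_inj_dim W ->
  exists (J C : lmodType A) (f : {linear W -> J}) (g : {linear J -> C}),
    [/\ injective_module J, short_exact f g & ext_vanish C].
Proof.
move=> [[|n]] /=.
  move=> iW; pose Z : lmodType A := {ffun 'I_0 -> A^o}.
  have Z0 (x y : Z) : x = y by apply/ffunP; case.
  have [|f fE] := @linear_exists A W W id; first by [].
  have [|g gE] := @linear_exists A W Z (fun=> 0); first by move=> a x y; apply: Z0.
  exists W, Z, f, g; split=> //; last by move=> h _; exists 0 => a _; apply: Z0.
  split=> [x y|y|z]; first by rewrite !fE.
    by split=> _; [exists y; rewrite fE | apply: Z0].
  by exists 0; apply: Z0.
move=> [J [C [f [g [iJ ex dC]]]]]; exists J, C, f, g; split=> //.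
apply: (inj_dim_ext_vanish dC) => y; case: ex => _ _ /(_ y) [x <-].
by have [z <-] := inj_div iJ rt x; exists (g z); rewrite linearZ_LR.
Qed.

Section Relations.
Variables (W V : lmodType A) (q : nat) (v : 'I_q -> V).
Hypotheses (fW : fin_gen W) (dW : finite_inj_dim W).
Hypotheses (nV : noethmod V) (rV : treg V t).

Let ev (c : {ffun 'I_q -> A^o}) : V := \sum_i (c i : A) *: v i.
Definition relation (c : {ffun 'I_q -> A^o}) : Prop := ev c = 0.

Let evP a c d : ev (a *: c + d) = a *: ev c + ev d.
Proof.
rewrite /ev scaler_sumr -big_split /=; apply: eq_bigr => i _.
by rewrite !ffunE scalerDl -scalerA.
Qed.

Lemma relation_subm : subm relation.
Proof.
split; first by rewrite /relation /ev big1 // => i _; rewrite ffunE scale0r.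
by move=> a c d c0 d0; rewrite /relation evP c0 d0 scaler0 addr0.
Qed.

(** Multiplication by [t] is onto Ext^1(lspan v, W). An extension [Phi] of [phi] with values in [J]
    induces a map lspan v -> C, which is [t] times a map [h1] because [ext_vanish C] extends maps
    from t lspan v. Lifting the values of [h1] at the generators to [J] and subtracting [t] times
    the lifts from [Phi] gives [w]. *)
Lemma relation_step (phi : {ffun 'I_q -> A^o} -> W) : lin_on relation phi ->
  exists phi1 (w : 'I_q -> W), lin_on relation phi1 /\
    forall c, relation c -> phi c = t *: phi1 c + \sum_i (c i : A) *: w i.
Proof.
move=> lphi; have [J [C [f [g [iJ [finj exact gsurj] PC]]]]] := finite_inj_dim_res dW.
have [Phi PhiE] := @inj_ext A _ _ _ (fun c => f (phi c)) iJ relation_subm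
  (fun a x y Kx Ky => etrans (congr1 f (lphi a x y Kx Ky)) (linearP f a _ _)).
pose G x u := exists c, x = t *: ev c /\ u = g (Phi c).
have Glin e x1 x2 w1 w2 : G x1 w1 -> G x2 w2 -> G (e *: x1 + x2) (e *: w1 + w2).
  move=> [c1 [-> ->]] [c2 [-> ->]]; exists (e *: c1 + c2).
  by rewrite evP scalerDr !scalerA mulrC !linearP.
have G0 u : G 0 u -> u = 0.
  move=> [c [/esym/rV c0 ->]]; rewrite PhiE //.
  by apply/exact; exists (phi c).
have [h0 h0E] := graph_fun Glin G0.
pose N x := exists u, G x u.
have sN : subm N.
  split; last by move=> e x1 x2 [w1 G1] [w2 G2]; exists (e *: w1 + w2); apply: Glin.
  exists 0, 0; rewrite !linear0; split=> //.
  by have [K0 _] := relation_subm; rewrite [ev 0]K0 scaler0.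
have evin c : lspan v (ev c) by exists c.
have spev x : lspan v x -> exists c, x = ev c.
  by move=> [c ->]; exists [ffun i => c i]; apply: eq_bigr => i _; rewrite ffunE.
have [||||h1 [lh1 h1E]] := ext_vanish_extend (N' := lspan v) (h := h0) PC nV sN.
- exact: lspan_subm.
- by move=> x [u [c [-> _]]]; apply: (submZ (lspan_subm v)).
- by move=> x /spev [c ->]; exists (g (Phi c)), c.
- by move=> e x1 x2 [w1 G1] [w2 G2]; rewrite (h0E _ _ G1) (h0E _ _ G2); apply/h0E/Glin.
have sv := lspan_subm v.
have tev c : t *: h1 (ev c) = g (Phi c).
  have Gc : G (t *: ev c) (g (Phi c)) by exists c.
  by rewrite -(lin_onZ _ sv lh1) // h1E ?(h0E _ _ Gc) //; exists (g (Phi c)).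
have [j jE] := choice (fun i => gsurj (h1 (v i))).
have evd i : ev (delta A i) = v i.
  rewrite /ev (bigD1 i) //= ffunE eqxx scale1r big1 ?addr0 // => k /negbTE ki.
  by rewrite ffunE ki scale0r.
have ex_w i : exists u, f u = Phi (delta A i) - t *: j i.
  apply/exact.
  by rewrite linearB linearZ_LR /= jE -tev evd subrr.
have [w wE] := choice ex_w.
have ex_phi1 c : exists u, relation c -> f u = \sum_i (c i : A) *: j i.
  case: (EM (relation c)) => [Kc|nK]; last by exists 0.
  suff /exact [u uE] : g (\sum_i (c i : A) *: j i) = 0 by exists u.
  rewrite linear_sum; under eq_bigr => i _ do rewrite linearZ_LR /= jE.
  rewrite -(lin_on_sum _ sv lh1); last by move=> i; apply: lspan_gen.
  by rewrite -[X in h1 X]/(ev c) Kc (lin_on0 sv lh1).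
have [phi1 phi1E] := choice ex_phi1.
exists phi1, w; split.
  move=> a c d Kc Kd; apply: finj; rewrite linearP !phi1E //; last first.
    exact: relation_subm.2.
  rewrite scaler_sumr -big_split /=; apply: eq_bigr => i _.
  by rewrite !ffunE scalerDl -scalerA.
move=> c Kc; apply: finj; rewrite linearD linearZ_LR /= phi1E // -PhiE //.
rewrite {1}[c]ffun_delta !linear_sum -big_split /=.
apply: eq_bigr => i _; rewrite [Phi _]linearZ_LR [f _]linearZ_LR /= wE scalerBr !scalerA.
by rewrite [t * _]mulrC addrC subrK.
Qed.

(* Ext^1(lspan v, W) = 0 *)
Lemma relation_extend (phi : {ffun 'I_q -> A^o} -> W) : lin_on relation phi ->
  exists w : 'I_q -> W, forall c, relation c -> phi c = \sum_i (c i : A) *: w i.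
Proof.
move=> lphi.
have [p [k [Kk kgen]]] : fgsub relation.
  by apply: (fg_noeth nA (fin_gen_ffun q (fin_gen_self A))) relation_subm.
have nX : noethmod {ffun 'I_p -> W} by apply: (fg_noeth nA); apply: fin_gen_ffun.
(* [H] collects the values at the generators [k] of all linear maps on the relations, [H0] those of
   maps on A^q. By [relation_step], H is contained in t H + H0, so Nakayama gives H = H0. *)
pose H (x : {ffun 'I_p -> W}) :=
  exists psi, lin_on relation psi /\ forall l, x l = psi (k l).
have sH : subm H.
  split.
    exists (fun=> 0); split; last by move=> l; rewrite ffunE.
    by move=> a x y _ _; rewrite scaler0 addr0.
  move=> a x y [psi1 [l1 E1]] [psi2 [l2 E2]].
  exists (fun c => a *: psi1 c + psi2 c); split; last by move=> l; rewrite !ffunE E1 E2.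
  move=> b c d Kc Kd; rewrite l1 // l2 // !scalerDr !scalerA addrACA.
  by rewrite [a * b]mulrC.
pose H0 (x : {ffun 'I_p -> W}) :=
  exists w : 'I_q -> W, forall l, x l = \sum_i (k l i : A) *: w i.
have sH0 : subm H0.
  split; first by exists (fun=> 0) => l; rewrite ffunE big1 // => i _; rewrite scaler0.
  move=> a x y [w1 E1] [w2 E2]; exists (fun i => a *: w1 i + w2 i) => l.
  rewrite !ffunE E1 E2 scaler_sumr -big_split /=; apply: eq_bigr => i _.
  by rewrite scalerDr !scalerA mulrC.
have [r [x [Hx xgen]]] := nX _ sH.
have H0x : forall i, H0 (x i).
  apply: (nakayama (J := @tmul A A^o t) (@tmul_subm A A^o t) _ sH0).
    move=> a [y ->]; apply: jacM; rewrite -[t *: y]/(t * (y : A)) mulrC.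
    exact: (submZ sM).
  move=> i; have [psi [lpsi psiE]] := Hx i.
  have [psi1 [w [lpsi1 wE]]] := relation_step lpsi.
  have [|d dE] := xgen [ffun l => psi1 (k l)].
    by exists psi1; split=> // l; rewrite ffunE.
  exists (fun j => t * d j); split; first by move=> j; exists (d j).
  exists w => l; rewrite ffunE psiE wE //.
  have -> : \sum_j (t * d j) *: x j = t *: [ffun l => psi1 (k l)].
    by rewrite dE scaler_sumr; apply: eq_bigr => j _; rewrite scalerA.
  by rewrite !ffunE addrC addKr.
have [|e eE] := xgen [ffun l => phi (k l)].
  by exists phi; split=> // l; rewrite ffunE.
have [w wE] : H0 [ffun l => phi (k l)].
  by rewrite eE; apply: (subm_sum sH0) => i _; apply: (submZ sH0).
exists w => c /kgen [d ->].
rewrite (lin_on_sum _ relation_subm lphi) //.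
under eq_bigr => l _.
  have -> : phi (k l) = \sum_i (k l i : A) *: w i by rewrite -wE ffunE.
  over.
under eq_bigr => l _ do rewrite scaler_sumr.
rewrite exchange_big /=; apply: eq_bigr => i _.
rewrite sum_ffunE scaler_suml; apply: eq_bigr => l _.
by rewrite !ffunE scalerA.
Qed.

End Relations.

(* The canonical module cogenerates the modules on which t is regular, because
   W / t W is an injective cogenerator over A / t. *)
Lemma separation (W V : lmodType A) (y : W) (x : V) :
  fin_gen W -> finite_inj_dim W -> treg W t -> ~ tmul t y ->
  fin_gen V -> treg V t -> ~ tmul t x ->
  exists f : {linear V -> W}, ~ tmul t (f x).
Proof.
move=> fW dW rW ny fV rV nx; apply: contrapT => nof.
have allf (f : {linear V -> W}) : tmul t (f x).
  by apply: contrapT => nf; apply: nof; exists f.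
have tmb (U : lmodType A) (u : U) b : tmul t ((t * b) *: u).
  by exists (b *: u); rewrite scalerA.
have [a [ny1 My1]] := @socle W (tmul t) y (tmul_subm W t) ny (tmb _ _).
move: (a *: y) ny1 My1 => {a ny}y ny My.
have [a [nx1 Mx1]] := @socle V (tmul t) x (tmul_subm V t) nx (tmb _ _).
have {nof}allf (f : {linear V -> W}) : tmul t (f (a *: x)).
  by rewrite linearZ_LR; apply: (submZ (tmul_subm W t)).
move: (a *: x) nx1 Mx1 allf => {a nx}x nx Mx allf.
have [n [g ggen]] := fV.
(* These generate x A + t V. A relation among them has its first coefficient r in [M], and [gam]
   assigns to it r y / t. Extending this assignment to A^(n+1) gives values [w]; the map
   [g i |-> - w i] then sends [x] to [y - t *: w ord0], outside t W. *)
pose v (i : 'I_n.+1) := if unlift ord0 i is Some k then t *: g k else x.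
have v0 : v ord0 = x by rewrite /v unlift_none.
have vS i : v (lift ord0 i) = t *: g i by rewrite /v liftK.
have ex_gam (r : A^o) : exists u, M r -> (r : A) *: y = t *: u.
  case: (EM (M r)) => [/My [u uE]|nM]; first by exists u.
  by exists 0.
have [gam gamE] := choice ex_gam.
have relE c : relation v c ->
    (c ord0 : A) *: x + t *: \sum_i (c (lift ord0 i) : A) *: g i = 0.
  rewrite /relation big_ord_recl v0 scaler_sumr => {2}<-; congr (_ + _).
  by apply: eq_bigr => i _; rewrite vS !scalerA mulrC.
have Mc c : relation v c -> M (c ord0).
  move=> /relE /eqP; rewrite addr_eq0 -scalerN => /eqP E.
  apply: contrapT => /unitM [b bE]; apply: nx.
  by rewrite -[x]scale1r -bE -scalerA E scalerA mulrC -scalerA; eexists.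
have [|w wE] := @relation_extend W V n.+1 v fW dW (fg_noeth nA fV) rV
    (fun c => gam (c ord0)).
  move=> e c d Kc Kd; apply: (tregI rW).
  rewrite -gamE; last by apply: Mc; apply: (relation_subm v).2.
  rewrite !ffunE scalerDr [t *: (e *: _)]scalerA [t * e]mulrC -scalerA.
  by rewrite -!gamE; try exact: Mc; rewrite scalerDl -scalerA.
pose G z u := exists c : 'I_n -> A, z = \sum_i c i *: g i /\
  u = - \sum_i c i *: w (lift ord0 i).
have Glin e x1 x2 w1 w2 : G x1 w1 -> G x2 w2 -> G (e *: x1 + x2) (e *: w1 + w2).
  move=> [c1 [-> ->]] [c2 [-> ->]]; exists (fun i => e * c1 i + c2 i); split.
    rewrite scaler_sumr -big_split /=; apply: eq_bigr => i _.
    by rewrite scalerDl scalerA.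
  rewrite scalerN -opprD scaler_sumr -big_split /=; congr (- _).
  by apply: eq_bigr => i _; rewrite scalerDl scalerA.
have mkc (b : A) (c : 'I_n -> A) : exists c' : {ffun 'I_n.+1 -> A^o},
    c' ord0 = b /\ forall i, c' (lift ord0 i) = c i.
  exists [ffun i => if unlift ord0 i is Some k then c k else b].
  by split=> [|i]; rewrite ffunE ?unlift_none ?liftK.
have G0 u : G 0 u -> u = 0.
  move=> [c [cE ->]]; have [c' [c'0 c'S]] := mkc 0 c.
  have Kc' : relation v c'.
    rewrite /relation big_ord_recl c'0 scale0r add0r.
    under eq_bigr => i _ do rewrite vS c'S scalerA mulrC -scalerA.
    by rewrite -scaler_sumr -cE scaler0.
  have := wE _ Kc'; rewrite big_ord_recl c'0 scale0r add0r.
  under eq_bigr => i _ do rewrite c'S.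
  move=> <-; have /rW -> : t *: gam 0 = 0; last by rewrite oppr0.
  by rewrite -gamE ?scale0r //; case: sM.
have [f0 f0E] := graph_fun Glin G0.
have Gall z : exists u, G z u.
  by have [c cE] := ggen z; exists (- \sum_i c i *: w (lift ord0 i)), c.
have [|f fE] := @linear_exists A V W f0.
  move=> e x1 x2; have [u1 G1] := Gall x1; have [u2 G2] := Gall x2.
  by rewrite (f0E _ _ G1) (f0E _ _ G2); apply/f0E/Glin.
have [u uE] := allf f; have [d dE] := ggen x.
have [c [c0 cS]] := mkc t (fun i => - d i).
have Kc : relation v c.
  rewrite /relation big_ord_recl c0 v0.
  under eq_bigr => i _ do rewrite vS cS scalerA mulrC -scalerA scaleNr.
  by rewrite -scaler_sumr sumrN -dE scalerN subrr.
have := wE _ Kc; rewrite big_ord_recl c0.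
have -> : gam t = y by apply: (tregI rW); rewrite -gamE.
have -> : \sum_i (c (lift ord0 i) : A) *: w (lift ord0 i) = f x.
  rewrite fE; symmetry; apply: f0E; exists d; split=> //.
  by rewrite -sumrN; apply: eq_bigr => i _; rewrite cS scaleNr.
by rewrite uE -scalerDr => E; apply: ny; exists (w ord0 + u).
Qed.

End Duality.

(** * Lengths *)

Section Length.
Variables (A : comNzRingType) (V : lmodType A).
Implicit Types X Y Z : V -> Prop.

(* There is a chain Y <= Z_0 < ... < Z_k = X, i.e. the length of X / Y is at
   least k. *)
Fixpoint lenge k Y X : Prop :=
  if k is k'.+1 then
    exists Z, [/\ subm Z, lenge k' Y Z, forall x, Z x -> X x & exists x, X x /\ ~ Z x]
  else forall x, Y x -> X x.

Definition lenle l Y X : Prop := forall k, lenge k Y X -> (k <= l)%N.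

Lemma lenge_mono k Y Y' X X' : (forall x, Y' x -> Y x) -> (forall x, X x -> X' x) ->
  lenge k Y X -> lenge k Y' X'.
Proof.
elim: k X X' => [|k IH] X X' YY XX /=; first by move=> YX x /YY /YX /XX.
move=> [Z [sZ lZ ZX [x [Xx nZx]]]]; exists Z; split=> //.
- exact: (IH Z Z).
- by move=> z /ZX /XX.
- by exists x; split=> //; apply: XX.
Qed.

Lemma lenge_leq j k Y X : (j <= k)%N -> lenge k Y X -> lenge j Y X.
Proof.
move=> /subnK <-; elim: (k - j)%N => //= d IH [Z [_ lZ ZX _]].
by apply: IH; apply: lenge_mono ZX lZ.
Qed.

Lemma lenge_cat a b Y Z X : lenge a Y Z -> lenge b Z X -> lenge (a + b) Y X.
Proof.
move=> lYZ; elim: b X => [|b IH] X /=; first by rewrite addn0 => ZX; apply: lenge_mono ZX lYZ.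
by rewrite addnS => -[Z' [sZ' lZ' Z'X sX]]; exists Z'; split=> //; apply: IH.
Qed.

Definition sumsub X Z (x : V) : Prop := exists u w, [/\ X u, Z w & x = u + w].

Lemma sumsub_subm X Z : subm X -> subm Z -> subm (sumsub X Z).
Proof.
move=> sX sZ; split.
  by exists 0, 0; rewrite addr0; split=> //; [case: sX | case: sZ].
move=> a x y [u [w [Xu Zw ->]]] [u' [w' [Xu' Zw' ->]]].
exists (a *: u + u'), (a *: w + w'); split; [exact: sX.2 | exact: sZ.2 | ].
by rewrite scalerDr addrACA.
Qed.

(** By the modular law, a strict inclusion stays strict after intersecting with [Z] or after adding
    [Z], so each step of the chain is counted on one side. *)
Lemma lenge_split k Y Z X : subm Z -> subm X -> (forall x, Y x -> Z x) ->
  lenge k Y X -> exists a b, [/\ (a + b)%N = k,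
    lenge a Y (fun x => X x /\ Z x) & lenge b Z (sumsub X Z)].
Proof.
move=> sZ + YZ; elim: k X => [|k IH] X sX /=.
  move=> YX; exists 0%N, 0%N; split=> // [x Yx|x Zx]; first by split; [apply: YX | apply: YZ].
  by exists 0, x; rewrite add0r; split=> //; case: sX.
move=> [X' [sX' lX' X'X [x [Xx nX'x]]]].
have [a [b [<- la lb]]] := IH _ sX' lX'.
have [[y [[Xy Zy] nX'y]]|none] := EM (exists y, (X y /\ Z y) /\ ~ X' y).
  exists a.+1, b; split=> //.
    exists (fun y => X' y /\ Z y); split=> //.
    - split; first by split; [case: sX' | case: sZ].
      by move=> c u v [? ?] [? ?]; split; [apply: sX'.2 | apply: sZ.2].
    - by move=> z [? ?]; split=> //; apply: X'X.
    - by exists y; split=> // -[].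
  apply: lenge_mono lb => // z [u [w [X'u Zw ->]]].
  by exists u, w; split=> //; apply: X'X.
have sub y : X y -> Z y -> X' y.
  by move=> Xy Zy; apply: contrapT => nX'; apply: none; exists y.
exists a, b.+1; split; first by rewrite addnS.
  by apply: lenge_mono la => // z [/X'X].
exists (sumsub X' Z); split=> //.
- exact: sumsub_subm.
- by move=> z [u [w [/X'X Xu Zw ->]]]; exists u, w.
exists x; split; first by exists x, 0; rewrite addr0; split=> //; case: sZ.
move=> [u [w [X'u Zw xE]]]; apply: nX'x; rewrite xE; apply: (submD sX') => //.
have wE : w = x - u by rewrite xE addrC addKr.
by apply: sub => //; rewrite wE; apply: (submB sX) => //; apply: X'X.
Qed.

Lemma lenle_cat a b Y Z X : subm Z -> subm X ->
  (forall x, Y x -> Z x) -> (forall x, Z x -> X x) ->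
  lenle a Y Z -> lenle b Z X -> lenle (a + b) Y X.
Proof.
move=> sZ sX YZ ZX la lb k /(lenge_split sZ sX YZ) [a' [b' [<- la' lb']]].
apply: leq_add; first by apply/la; apply: lenge_mono la' => // x [].
apply/lb; apply: lenge_mono lb' => // x [u [w [Xu /ZX Xw ->]]].
exact: (submD sX).
Qed.

Lemma simple_lenle Y X :
  (forall L, subm L -> (forall x, Y x -> L x) -> (forall x, L x -> X x) ->
     (forall x, L x -> Y x) \/ (forall x, X x -> L x)) -> lenle 1 Y X.
Proof.
move=> simp [|[|k]] //= [Z [sZ [Z' [sZ' lZ' Z'Z [y [Zy nZ'y]]]] ZX [x [Xx nZx]]]].
have YZ' : forall x, Y x -> Z' x by exact: (lenge_leq (leq0n k) lZ').
have [ZY|/(_ _ Xx)//] := simp Z sZ (fun x Yx => Z'Z _ (YZ' _ Yx)) ZX.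
by case: nZ'y; apply/YZ'/ZY.
Qed.

Lemma indep_lenge_lspan (P : A -> Prop) r (w : 'I_r -> V) Y : ~ P 1 -> subm Y ->
  (forall c : 'I_r -> A, Y (\sum_i c i *: w i) -> forall i, P (c i)) ->
  lenge r Y (sumsub Y (lspan w)).
Proof.
move=> P1 sY; elim: r w => [|r IH] w indep.
  move=> x Yx; exists x, 0; rewrite addr0; split=> //.
  by case: (lspan_subm w).
pose w' i := w (lift ord0 i); have sw := lspan_subm w.
exists (sumsub Y (lspan w')); split.
- exact: sumsub_subm (lspan_subm _).
- apply: IH => c Yc i.
  pose d k := if unlift ord0 k is Some j then c j else 0.
  have -> : c i = d (lift ord0 i) by rewrite /d liftK.
  apply: indep; rewrite big_ord_recl /d unlift_none scale0r add0r.
  by under eq_bigr => j _ do rewrite liftK.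
- move=> x [u [v [Yu [c ->] ->]]]; exists u, (\sum_i c i *: w' i); split=> //.
  by apply: (subm_sum sw) => i _; apply: (submZ sw); apply: lspan_gen.
- exists (w ord0); split.
    by exists 0, (w ord0); rewrite add0r; split=> //; [case: sY | apply: lspan_gen].
  move=> [u [v [Yu [c ->] wE]]].
  pose d k := if unlift ord0 k is Some j then - c j else 1.
  have dS j : d (lift ord0 j) = - c j by rewrite /d liftK.
  apply: P1; have <- : d ord0 = 1 by rewrite /d unlift_none.
  apply: indep; rewrite big_ord_recl {1}/d unlift_none scale1r wE.
  under [X in _ + X]eq_bigr => j _ do rewrite dS scaleNr.
  by rewrite sumrN addrK.
Qed.

Lemma indep_lenge (P : A -> Prop) r (w : 'I_r -> V) Y X :
  ~ P 1 -> subm Y -> subm X -> (forall x, Y x -> X x) -> (forall i, X (w i)) ->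
  (forall c : 'I_r -> A, Y (\sum_i c i *: w i) -> forall i, P (c i)) ->
  lenge r Y X.
Proof.
move=> P1 sY sX YX Xw indep.
apply: lenge_mono (indep_lenge_lspan P1 sY indep) => //.
move=> x [u [v [/YX Xu [c ->] ->]]]; apply: (submD sX) => //.
by apply: (subm_sum sX) => i _; apply: (submZ sX).
Qed.

End Length.

Section HasLength.
Variables (A : comNzRingType) (M : lmodType A) (J : submodClosed M).

Let p (x : M) : quotmod J := \pi_(quotmod J) x.

Let pP a x y : p (a *: x + y) = a *: p x + p y.
Proof. by rewrite /p quotmod_piD -quotmod_scaleE. Qed.

Let p0 : p 0 = 0.
Proof. by have := pP (-1) 0 0; rewrite scaler0 add0r scaleN1r addNr. Qed.

(** Pulling the series back to [M] lets the lengths of quotients by different submodules be compared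
    inside one module. *)
Lemma has_length_chain l : has_length (quotmod J) l -> exists P : nat -> M -> Prop,
  [/\ forall i, subm (P i), forall x, P 0%N x <-> x \in J, forall x, P l x
    & forall i, (i < l)%N -> [/\ forall x, P i x -> P i.+1 x,
        exists x, P i.+1 x /\ ~ P i x &
        forall L, subm L -> (forall x, P i x -> L x) -> (forall x, L x -> P i.+1 x) ->
          (forall x, L x -> P i x) \/ (forall x, P i.+1 x -> L x)]].
Proof.
move=> [N [N0 Nl Nstep]].
have sP i : subm (fun x : M => p x \in N i).
  have [sN0 sN1] := subm_of (N i); split; first by rewrite p0.
  by move=> a x y Nx Ny; rewrite pP; apply: sN1.
have P0 x : p x \in N 0 <-> x \in J.
  rewrite N0 -p0; split=> [/eqP/quotmod_piP|xJ]; first by rewrite subr0.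
  by apply/eqP/quotmod_piP; rewrite subr0.
exists (fun i x => p x \in N i); split=> // i il; have [Nsub Nstrict Nsimp] := Nstep i il.
split; first by move=> x /Nsub.
  apply: contrapT => none; apply: Nstrict => z; elim/quotW: z => x xN.
  by apply: contrapT => nx; apply: none; exists x.
move=> L sL PL LP.
have JL x : x \in J -> L x.
  move=> /P0 x0; apply: PL; move: x0.
  by elim: (i) (ltnW il) => // k IH kl /(IH (ltnW kl)); case: (Nstep k kl) => S _ _ /S.
(* As [J] is contained in [L], membership in [L] depends only on the class, so [L] descends to the
   quotient. *)
have Lrep x : L x <-> L (repr (p x)).
  have d : L (repr (p x) - x) by apply/JL/quotmod_piP; rewrite reprK.
  split=> Lx; first by rewrite -(subrK x (repr _)); apply: (submD sL).
  by rewrite -(subKr (repr (p x)) x); apply: (submB sL).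
have {}Lrep1 x : L x -> L (repr (p x)) by case: (Lrep x).
have {Lrep}Lrep2 x : L (repr (p x)) -> L x by case: (Lrep x).
have sL' : subm (fun z : quotmod J => L (repr z)).
  split.
    by have := Lrep1 0 sL.1; rewrite p0.
  move=> a z1 z2; elim/quotW: z1 => x; elim/quotW: z2 => y.
  rewrite -[\pi x]/(p x) -[\pi y]/(p y) -pP => /Lrep2 Lx /Lrep2 Ly.
  by apply: Lrep1; apply: sL.2.
have [L' L'E] := submodP sL'.
have [||E|E] := Nsimp L'.
- move=> z; elim/quotW: z => x xN; apply/L'E/Lrep1; exact: PL.
- by move=> z; elim/quotW: z => x /L'E /Lrep2 /LP.
- by left=> x /Lrep1 /L'E; rewrite E.
- by right=> x; rewrite -E => /L'E /Lrep2.
Qed.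

Lemma has_length_lenge l : has_length (quotmod J) l ->
  lenge l (fun x => x \in J) (fun=> True) /\ lenle l (fun x => x \in J) (fun=> True).
Proof.
move=> /has_length_chain [P [sP P0 Pl Pstep]].
have H i : (i <= l)%N -> lenge i (fun x => x \in J) (P i) /\
    lenle i (fun x => x \in J) (P i) /\ (forall x, x \in J -> P i x).
  elim: i => [|i IH] il.
    split; [|split]; try by move=> x /P0.
    move=> [|k] //= [Z [sZ lZ ZP [x [/P0 xJ []]]]].
    exact: (lenge_leq (leq0n k) lZ).
  have [lg [ll JP]] := IH (ltnW il); have [P1 P2 P3] := Pstep i il.
  split; first by exists (P i); split.
  split; last by move=> x /JP /P1.
  by rewrite -[X in lenle X]addn1; exact: lenle_cat (sP i) (sP i.+1) JP P1 ll (simple_lenle P3).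
have [lg [ll _]] := H l (leqnn l); split; first exact: lenge_mono lg.
by move=> k lk; apply: ll; apply: lenge_mono lk.
Qed.

(** The first hypothesis puts [t] in the Jacobson radical, so [t] kills each of the [l] simple
    factors. *)
Lemma has_length_ann l t : (forall r, exists b : A, b * (1 - r * t) = 1) ->
  has_length (quotmod J) l -> forall x, t ^+ l *: x \in J.
Proof.
move=> jt /has_length_chain [P [sP P0 Pl Pstep]] x; apply/P0.
suff H i : (i <= l)%N -> P (l - i)%N (t ^+ i *: x) by have := H l (leqnn l); rewrite subnn.
elim: i => [|i IH] il; first by rewrite expr0 scale1r subn0.
have {}IH := IH (ltnW il); have [|P1 _ P3] := Pstep (l - i.+1)%N; first by lia.
have E : (l - i.+1).+1 = (l - i)%N by lia.
rewrite E in P1 P3; rewrite exprS -scalerA; set y := t ^+ i *: x in IH *.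
have [|||L|L] := P3 (sumsub (P (l - i.+1)%N) (lspan (fun _ : 'I_1 => t *: y))).
- exact: sumsub_subm (lspan_subm _).
- move=> z Pz; exists z, 0; rewrite addr0; split=> //.
  by case: (lspan_subm (fun _ : 'I_1 => t *: y)).
- move=> z [u [w [/P1 Pu [c ->] ->]]]; apply: (submD (sP _)) => //.
  by rewrite big_ord1; do 2!apply: (submZ (sP _)).
- apply: L; exists 0, (t *: y); rewrite add0r; split=> //; first by case: (sP (l - i.+1)%N).
  exact: (lspan_gen (fun _ : 'I_1 => t *: y) ord0).
- have [u [w [Pu [c ->]]]] := L y IH; rewrite big_ord1 => yE.
  have [b bE] := jt (c ord0).
  apply: (submZ (sP _)); rewrite -[y]scale1r -bE -scalerA; apply: (submZ (sP _)).
  by rewrite scalerBl scale1r -scalerA {1}yE addrK.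
Qed.

End HasLength.

(** * Principal reductions of powers of an ideal *)

Section IdealPowers.
Variables (A : comNzRingType) (I : submodClosed A^o).

Lemma ideal_pow_subm n : subm (fun x : A^o => x \in ideal_pow I n).
Proof. exact: (subm_of (ideal_pow I n)). Qed.

Lemma subm_mull (N : A^o -> Prop) (a x : A) : subm N -> N x -> N (a * x).
Proof. by move=> sN Nx; apply: (submZ sN a Nx). Qed.

Lemma ideal_pow_prod n (a : nat -> A) : (forall j, (a j : A^o) \in I) ->
  (\prod_(j < n) a j : A^o) \in ideal_pow I n.
Proof.
move=> aI; rewrite inE; apply/asboolP; exists 1%N, (fun=> 1), (fun=> a).
by split=> //; rewrite big_ord1 mul1r.
Qed.

Lemma ideal_pow_ind n (N : A^o -> Prop) : subm N ->
  (forall a : nat -> A, (forall j, (a j : A^o) \in I) -> N (\prod_(j < n) a j)) ->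
  forall x, x \in ideal_pow I n -> N x.
Proof.
move=> sN Np x; rewrite inE => /asboolP[k [c [a [aI ->]]]].
by apply: (subm_sum sN) => i _; apply: subm_mull => //; apply: Np.
Qed.

Lemma ideal_pow0 (x : A^o) : x \in ideal_pow I 0.
Proof.
rewrite -[x]mulr1; apply: subm_mull (ideal_pow_subm 0) _.
have -> : (1 : A) = \prod_(j < 0) (fun=> 0 : A) j by rewrite big_ord0.
by apply: (@ideal_pow_prod 0 (fun=> 0)) => _; apply: rpred0.
Qed.

Lemma ideal_pow1 (x : A^o) : x \in I -> x \in ideal_pow I 1.
Proof. by move=> xI; have := @ideal_pow_prod 1 (fun=> x) (fun=> xI); rewrite big_ord1. Qed.

Lemma ideal_powM m n (x y : A) : (x : A^o) \in ideal_pow I m ->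
  (y : A^o) \in ideal_pow I n -> (x * y : A^o) \in ideal_pow I (m + n).
Proof.
move=> xm; move: y; apply: ideal_pow_ind.
  split; first by rewrite mulr0; apply: rpred0.
  move=> a y z Hy Hz; rewrite mulrDr [x * (a *: y)]mulrCA.
  exact: (ideal_pow_subm _).2.
move=> b bI; move: x xm; apply: ideal_pow_ind.
  split; first by rewrite mul0r; apply: rpred0.
  move=> a y z Hy Hz; rewrite mulrDl -[a *: y * _]mulrA.
  exact: (ideal_pow_subm _).2.
move=> a aI; pose d j := if (j < m)%N then a j else b (j - m)%N.
have -> : (\prod_(j < m) a j) * (\prod_(j < n) b j) = \prod_(j < m + n) d j.
  rewrite big_split_ord; congr (_ * _); apply: eq_bigr => j _; rewrite /d /=.
    by rewrite ltn_ord.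
  by rewrite ltnNge leq_addr /= addKn.
by apply: ideal_pow_prod => j; rewrite /d; case: ifP.
Qed.

Lemma ideal_powM_ind m n (N : A^o -> Prop) : subm N ->
  (forall x y : A, (x : A^o) \in ideal_pow I m -> (y : A^o) \in ideal_pow I n -> N (x * y)) ->
  forall x, x \in ideal_pow I (m + n) -> N x.
Proof.
move=> sN NM; apply: ideal_pow_ind => // a aI.
by rewrite big_split_ord; apply: NM; [| apply: (ideal_pow_prod n (a := fun j => a (m + j)%N))];
  first exact: ideal_pow_prod.
Qed.

Lemma ideal_pow_sub m n x : (m <= n)%N -> x \in ideal_pow I n -> x \in ideal_pow I m.
Proof.
move=> /subnKC <-; apply: (ideal_powM_ind (ideal_pow_subm m)) => y z ym _.
by rewrite mulrC; apply: subm_mull (ideal_pow_subm m) ym.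
Qed.

Lemma ideal_pow1E x : x \in ideal_pow I 1 -> x \in I.
Proof.
apply: (ideal_pow_ind (n := 1)) (subm_of I) _ x => a aI.
by rewrite big_ord1.
Qed.

Lemma ideal_powX d k (x : A) : (x : A^o) \in ideal_pow I d ->
  (x ^+ k : A^o) \in ideal_pow I (d * k).
Proof.
move=> xd; elim: k => [|k IH]; first by rewrite muln0; apply: ideal_pow0.
by rewrite exprS mulnS; apply: ideal_powM.
Qed.

Lemma ideal_pow_big_prod (T : finType) (P : pred T) (f : T -> A) (D : T -> nat) :
  (forall i, P i -> (f i : A^o) \in ideal_pow I (D i)) ->
  (\prod_(i | P i) f i : A^o) \in ideal_pow I (\sum_(i | P i) D i).
Proof.
move=> fD; elim/big_ind2: _ => //; [exact: ideal_pow0 | by move=> *; apply: ideal_powM].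
Qed.

End IdealPowers.

Section Product.
Variables (A : comNzRingType).

Definition idprod (M N : A^o -> Prop) (x : A^o) : Prop :=
  exists k (b y : 'I_k -> A), [/\ forall i, M (b i), forall i, N (y i)
    & x = \sum_i b i * y i].

Lemma idprod_subm (M N : A^o -> Prop) : subm M -> subm (idprod M N).
Proof.
move=> sM; split.
  by exists 0%N, (fun=> 0), (fun=> 0); split; try case; rewrite ?big_ord0.
move=> a x x' [k [b [y [Mb Ny ->]]]] [k' [b' [y' [Mb' Ny' ->]]]].
exists (k + k')%N, (fun i => match split i with inl j => a * b j | inr j => b' j end),
  (fun i => match split i with inl j => y j | inr j => y' j end); split.
- by move=> i; case: (split i) => j //; apply: subm_mull.
- by move=> i; case: (split i).
have spl i : split (lshift k' i) = inl i := unsplitK (inl i).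
have spr i : split (rshift k i) = inr i := unsplitK (inr i).
rewrite big_split_ord scaler_sumr; congr (_ + _); apply: eq_bigr => i _.
  by rewrite spl -[LHS]/(a * _) mulrA.
by rewrite spr.
Qed.

Lemma idprod_in (M N : A^o -> Prop) (b y : A) : M b -> N y -> idprod M N (b * y).
Proof.
by move=> Mb Ny; exists 1%N, (fun=> b), (fun=> y); rewrite big_ord1.
Qed.

Lemma idprod_ind (M N P : A^o -> Prop) : subm P ->
  (forall b y : A, M b -> N y -> P (b * y)) -> forall x, idprod M N x -> P x.
Proof.
by move=> sP H x [k [b [y [Mb Ny ->]]]]; apply: (subm_sum sP) => i _; apply: H.
Qed.

End Product.

(* Powers of I have principal reductions although the residue field may be finite.
   The fibre cone of I has bounded Hilbert function, so two forms u, v of equal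
   degree satisfy a homogeneous equation u^i q = 0 with v integral over k[u, q];
   then u and q, hence v, are nilpotent modulo w = u^(nl) + q^l for l > i. *)
Section Reduction.
Variables (A : comNzRingType) (M : A^o -> Prop) (I : submodClosed A^o).
Hypotheses (nA : noethmod (A^o : lmodType A)) (sM : subm M) (M1 : ~ M 1).
Hypothesis unitM : forall a : A, ~ M a -> exists b, b * a = 1.
Hypothesis IM : forall x, x \in I -> M x.

Let pow n (x : A^o) : Prop := x \in ideal_pow I n.
(** [pow n] modulo [MI n] is the degree [n] part of the fibre cone. *)
Let MI n : A^o -> Prop := idprod M (pow n).

Let MI_subm n : subm (MI n).
Proof. exact: idprod_subm. Qed.

Let MI_pow n x : MI n x -> pow n x.
Proof.
apply: (idprod_ind (ideal_pow_subm I n)) => b y _.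
exact: subm_mull (ideal_pow_subm I n).
Qed.

Let MI_mul n k (x y : A) : MI n x -> pow k y -> MI (n + k) (x * y).
Proof.
move=> + yk; move: x; apply: idprod_ind; last first.
  by move=> b x Mb xn; rewrite -mulrA; apply: idprod_in => //; apply: ideal_powM.
split; first by rewrite mul0r; case: (MI_subm (n + k)).
by move=> a u v Hu Hv; rewrite mulrDl -[a *: u * _]mulrA; apply: (MI_subm (n + k)).2.
Qed.

Let pow_MI n x : pow n.+1 x -> MI n x.
Proof.
apply: (ideal_powM_ind (m := 1) (MI_subm n)) => y z /ideal_pow1E /IM My zn.
exact: idprod_in.
Qed.

Section Nil.
Variables (w : A) (dw : nat).

(** In the fibre cone, the class of [x] in degree k + dw is a multiple of the class of [w], a form
    of degree [dw]. *)
Definition near_mul k (x : A^o) : Prop :=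
  exists y z : A, [/\ pow k y, MI (k + dw) z & x = w * y + z].

Lemma near_mul_subm k : subm (near_mul k).
Proof.
split.
  exists 0, 0; split; [exact: rpred0 | by case: (MI_subm (k + dw)) | by rewrite mulr0 addr0].
move=> a x x' [y [z [yk zk ->]]] [y' [z' [yk' zk' ->]]].
exists (a * y + y'), (a * z + z'); split.
- exact: (ideal_pow_subm I k).2.
- exact: (MI_subm (k + dw)).2.
- by rewrite -[LHS]/(a * (w * y + z) + (w * y' + z')); ring.
Qed.

Lemma near_mulM k j (x y : A) : near_mul k x -> pow j y -> near_mul (k + j) (x * y).
Proof.
move=> [u [z [uk zk ->]]] yj; exists (u * y), (z * y); split.
- exact: ideal_powM.
- by rewrite addnAC; apply: MI_mul.
- by ring.
Qed.

(** The form [x] of degree [D] is nilpotent in the fibre cone modulo [w]; [k] is the degree of the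
    cofactor of [w]. *)
Definition nilp (x : A) (D : nat) : Prop :=
  exists N k, (N * D = k + dw)%N /\ near_mul k (x ^+ N).

Lemma nilpD x y D : pow D x -> pow D y -> nilp x D -> nilp y D -> nilp (x + y) D.
Proof.
move=> xD yD [N1 [k1 [E1 H1]]] [N2 [k2 [E2 H2]]].
exists (N1 + N2)%N, (k1 + N2 * D)%N; split; first by rewrite mulnDl E1 addnAC.
rewrite exprDn; apply: (subm_sum (near_mul_subm _)) => -[i /= iN] _.
rewrite -mulr_natl; apply: subm_mull (near_mul_subm _) _.
have [N2i|iN2] := leqP N2 i.
  have -> : (k1 + N2 * D = k2 + (D * (i - N2) + D * (N1 + N2 - i)))%N.
    have : (N1 * D + N2 * D = D * N2 + (D * (i - N2) + D * (N1 + N2 - i)))%N.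
      rewrite -!mulnDr -mulnDl mulnC; congr (_ * _)%N; lia.
    by move: E1 E2; lia.
  rewrite mulrC -(subnKC N2i) exprD addKn -mulrA; apply: near_mulM => //.
  by rewrite subnKC //; apply: ideal_powM; apply: ideal_powX.
have -> : (k1 + N2 * D = k1 + (D * (N2 - i) + D * i))%N.
  by rewrite -mulnDr subnK 1?mulnC // ltnW.
have -> : (N1 + N2 - i = N1 + (N2 - i))%N by lia.
by rewrite exprD -mulrA; apply: near_mulM => //; apply: ideal_powM; apply: ideal_powX.
Qed.

Lemma nilpM x y D j : nilp x D -> pow j y -> nilp (x * y) (D + j).
Proof.
move=> [N [k [E H]]] yj; exists N, (k + j * N)%N; split.
  by rewrite mulnDr E addnAC [(N * j)%N]mulnC.
by rewrite exprMn; apply: near_mulM => //; apply: ideal_powX.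
Qed.

Lemma nilpX x D j : nilp (x ^+ j) (D * j) -> nilp x D.
Proof.
move=> [N [k [E H]]]; exists (j * N)%N, k; split; last by rewrite exprM.
by rewrite -E; lia.
Qed.

End Nil.

(** Write [x ^+ N = w * y + z] with [z] zero in the fibre cone. The [N']-th powers of [x ^+ N] and
    [w * y] differ by a multiple of [z], and the latter is a multiple of [w'] there. *)
Lemma nilp_trans w dw w' dw' x D : pow D x -> pow dw w ->
  nilp w dw x D -> nilp w' dw' w dw -> nilp w' dw' x D.
Proof.
move=> xD wd [N [k [E [y [z [yk zk xE]]]]]] [N' [k' [E' H']]].
have EN : (N * N' * D = k' + k * N' + dw')%N.
  by rewrite mulnAC E mulnDl addnAC -E' addnC [(dw * N')%N]mulnC.
exists (N * N')%N, (k' + k * N')%N; split=> //.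
rewrite exprM -(subrK ((w * y) ^+ N') ((x ^+ N) ^+ N')).
apply: (submD (near_mul_subm w' dw' _)); last first.
  by rewrite exprMn; apply: near_mulM => //; apply: ideal_powX.
exists 0, ((x ^+ N) ^+ N' - (w * y) ^+ N'); rewrite mulr0 add0r; split=> //.
  exact: rpred0.
rewrite -EN subrXX xE addrAC subrr add0r -xE.
rewrite mulr_sumr; apply: (subm_sum (MI_subm _)) => -[i /= iN'] _.
have -> : (N * N' * D = k + dw + (D * N * (N'.-1 - i) + D * N * i))%N.
  rewrite -E -mulnDr subnK; last by lia.
  by rewrite [(D * N)%N]mulnC -mulnS prednK 1?mulnAC //; lia.
apply: MI_mul => //; apply: ideal_powM; rewrite ?subn1.
  by apply: ideal_powX; apply: ideal_powX.
by apply: ideal_powX; rewrite [(D * N)%N]mulnC E addnC; apply: ideal_powM.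
Qed.

Section Bounded.
Variables (e n0 : nat).
Hypothesis bounded : forall n, (n0 <= n)%N -> lenle e (pow n.+1) (pow n).

Lemma nilp_pair d (u v : A) : (0 < d)%N -> pow d u -> pow d v ->
  exists dw w, [/\ (0 < dw)%N, pow dw w, nilp w dw u d & nilp w dw v d].
Proof.
(* The [N.+1] monomials of degree [N] in [u] and [v] outnumber the dimension of the fibre cone in
   degree d N, which is at most [e] because d N >= n0. Hence they are dependent. *)
move=> d0 ud vd; pose N := (maxn e n0).+1.
have monE j : (j <= N)%N -> pow (d * N) (u ^+ j * v ^+ (N - j)).
  by move=> jN; rewrite -{1}(subnKC jN) mulnDr; apply: ideal_powM; apply: ideal_powX.
have [c [i0 [nMi0 Mc]]] : exists (c : 'I_N.+1 -> A) i, ~ M (c i) /\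
    MI (d * N) (\sum_(j < N.+1) c j * (u ^+ j * v ^+ (N - j))).
  apply: contrapT => nc.
  have : lenge N.+1 (MI (d * N)) (pow (d * N)).
    apply: (@indep_lenge A A^o M N.+1 (fun j => u ^+ j * v ^+ (N - j))) => //.
    - exact: ideal_pow_subm.
    - exact: MI_pow.
    - by move=> j; apply: monE; rewrite -ltnS.
    - by move=> c Hc i; apply: contrapT => nM; apply: nc; exists c, i.
  move=> /(lenge_mono (@pow_MI _) (fun x xP => xP)) /bounded.
  have : (N <= d * N)%N by rewrite leq_pmull.
  by rewrite /N; lia.
have Pi0 : `[< ~ M (c i0) >] by apply/asboolP.
(* With [i] the least index of a unit coefficient, the dependence reads [u ^+ i * q = 0] in the
   fibre cone. *)
have [i /asboolP nMi imin] := arg_minnP (P := fun i => `[< ~ M (c i) >]) (@nat_of_ord _) Pi0.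
have iN : (i <= N)%N by rewrite -ltnS.
pose q := \sum_(j < N.+1 | (i <= j)%N) c j * (u ^+ (j - i) * v ^+ (N - j)).
have uq : MI (d * N) (u ^+ i * q).
  have -> : u ^+ i * q = \sum_(j < N.+1) c j * (u ^+ j * v ^+ (N - j)) -
      \sum_(j < N.+1 | ~~ (i <= j)%N) c j * (u ^+ j * v ^+ (N - j)).
    rewrite (bigID (fun j : 'I_N.+1 => (i <= j)%N)) /= addrK mulr_sumr.
    by apply: eq_bigr => j ij; rewrite mulrCA [u ^+ i * _]mulrA -exprD subnKC.
  apply: (submB (MI_subm _)) => //; apply: (subm_sum (MI_subm _)) => j ji.
  apply: idprod_in; last by apply: monE; rewrite -ltnS.
  by apply: contrapT => nMj; move: ji; rewrite (imin j) //; apply/asboolP.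
have [b bE] := unitM nMi.
(* If [i = N], then [q] is a unit and [u] is nilpotent, so [v] alone serves as [w]. *)
have [iltN|] := ltnP i N; last first.
  move=> Ni; have iEN : i = N :> nat by apply/eqP; rewrite eqn_leq iN.
  have qE : q = c i.
    rewrite /q (big_pred1 i) => [|j]; first by rewrite subnn iEN subnn !mulr1.
    apply/idP/eqP => [ij|->//]; apply/ord_inj/eqP.
    by rewrite eqn_leq ij iEN -ltnS ltn_ord.
  exists d, v; split=> //.
    exists N, (d * N.-1)%N; split; first by rewrite mulnC -mulnSr.
    exists 0, (u ^+ N); rewrite mulr0 add0r -mulnSr; split=> //; first exact: rpred0.
    rewrite -[u ^+ N]mul1r -bE -mulrA; apply: subm_mull (MI_subm _) _.
    by move: uq; rewrite qE iEN mulrC.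
  exists 1%N, 0%N; split; first by rewrite mul1n.
  exists 1, 0; rewrite mulr1 addr0; split=> //; first exact: ideal_pow0.
  by case: (MI_subm (0 + d)).
pose g := \sum_(j < N.+1 | (i < j)%N) c j * (u ^+ (j - i.+1) * v ^+ (N - j)).
pose n := (N - i)%N; have n0' : (0 < n)%N by rewrite subn_gt0.
have qE : c i * v ^+ n = q + u * - g.
  rewrite /q (bigD1 i) //= subnn mul1r mulrN mulr_sumr.
  rewrite [X in _ + X - _](eq_bigl (fun j : 'I_N.+1 => (i < j)%N)); last first.
    by move=> j; rewrite [RHS]ltn_neqAle andbC eq_sym.
  rewrite [X in _ + X - _](eq_bigr
    (fun j : 'I_N.+1 => u * (c j * (u ^+ (j - i.+1) * v ^+ (N - j))))).
    by rewrite addrK.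
  by move=> j ij; rewrite [RHS]mulrCA [u * (_ * _)]mulrA -exprS subnSK.
have qD : pow (d * n) q.
  apply: (subm_sum (ideal_pow_subm I _)) => j ij; apply: subm_mull (ideal_pow_subm I _) _.
  have -> : (d * n = d * (j - i) + d * (N - j))%N.
    by rewrite -mulnDr; congr (_ * _)%N; have := ltn_ord j; rewrite /n; lia.
  by apply: ideal_powM; apply: ideal_powX.
have gD : pow (d * n.-1) (- g).
  apply: (submN (ideal_pow_subm I _)); apply: (subm_sum (ideal_pow_subm I _)) => j ij.
  apply: subm_mull (ideal_pow_subm I _) _.
  have -> : (d * n.-1 = d * (j - i.+1) + d * (N - j))%N.
    by rewrite -mulnDr; congr (_ * _)%N; have := ltn_ord j; rewrite /n; lia.
  by apply: ideal_powM; apply: ideal_powX.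
have dn : (d + d * n.-1 = d * n)%N by rewrite -mulnS prednK.
pose l := (i.+1)%N; pose w := u ^+ (n * l) + q ^+ l; pose dw := (d * n * l)%N.
have nilu : nilp w dw u d.
  exists (i + n * l)%N, (d * i)%N; split.
    by rewrite mulnDl mulnC [(n * l * d)%N]mulnC mulnA.
  exists (u ^+ i), (- (u ^+ i * q * q ^+ i)); split; first exact: ideal_powX.
    apply: (submN (MI_subm _)).
    have -> : (d * i + dw = d * N + d * n * i)%N.
      by rewrite /dw /l mulnS addnA -mulnDr [(i + n)%N]subnKC.
    by apply: MI_mul => //; apply: ideal_powX.
  by rewrite /w exprD /l [q ^+ i.+1]exprS; ring.
have nilq : nilp w dw q (d * n).
  exists l.+1, (d * n)%N; split; first by rewrite mulSn [(l * _)%N]mulnC.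
  exists q, (- (u ^+ i * q * u ^+ (n * l - i))); split=> //.
    apply: (submN (MI_subm _)).
    have il : (i <= n * l)%N.
      by apply: leq_trans (leqnSn i) _; rewrite leq_pmull.
    have -> : (d * n + dw = d * N + d * (n * l - i))%N.
      rewrite /dw -mulnA -!mulnDr; congr (_ * _)%N.
      by move: il (subnKC iN); rewrite -/n; lia.
    by apply: MI_mul => //; apply: ideal_powX.
  have -> : u ^+ i * q * u ^+ (n * l - i) = q * u ^+ (n * l).
    rewrite mulrAC -exprD subnKC 1?mulrC //.
    by apply: leq_trans (leqnSn i) _; rewrite leq_pmull.
  by rewrite /w exprS; ring.
exists dw, w; split=> //.
- by rewrite !muln_gt0 d0 n0'.
- apply: (submD (ideal_pow_subm I _)); last exact: ideal_powX.
  by rewrite /dw -mulnA; apply: ideal_powX.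
apply: (@nilpX w dw v d n).
have -> : v ^+ n = (q + u * - g) * b by rewrite -qE mulrC mulrA bE mul1r.
rewrite -[(d * n)%N]addn0; apply: nilpM; last exact: ideal_pow0.
apply: nilpD => //; first by rewrite -dn; apply: ideal_powM.
by rewrite -dn; apply: nilpM.
Qed.

(** Elements are absorbed one at a time; [x] is raised to the power [dw] because [nilp_pair] takes
    two forms of equal degree. *)
Lemma nilp_seq (s : seq A) : (forall x, x \in s -> (x : A^o) \in I) ->
  exists dw w, [/\ (0 < dw)%N, pow dw w & forall x, x \in s -> nilp w dw x 1].
Proof.
elim: s => [_|x s IH sI].
  by exists 1%N, 0; split=> //; apply: rpred0.
have [|dw [w [dw0 wd wnil]]] := IH; first by move=> y ys; apply: sI; rewrite in_cons ys orbT.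
have xI : pow 1 x by apply/ideal_pow1/sI; rewrite mem_head.
have xd : pow dw (x ^+ dw) by rewrite -[dw in pow dw _]mul1n; apply: ideal_powX.
have [dw' [w' [dw'0 wd' nilw nilx]]] := nilp_pair dw0 wd xd.
exists dw', w'; split=> // y; rewrite in_cons => /orP[/eqP->|ys].
  by apply: (@nilpX _ _ x 1 dw); rewrite mul1n.
apply: (nilp_trans _ wd (wnil _ ys) nilw).
by apply/ideal_pow1/sI; rewrite in_cons ys orbT.
Qed.

(** By pigeonhole, a monomial of large degree in the generators contains some [x i] at least [N i]
    times, which makes it a multiple of [w] in the fibre cone. *)
Lemma near_mul_pow : exists dw w n1, [/\ (0 < dw)%N, pow dw w &
  forall n, (n1 <= n)%N -> (dw <= n)%N /\ forall x, pow n x -> near_mul w dw (n - dw) x].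
Proof.
have [s [x [xI xgen]]] := nA (subm_of I).
have [|dw [w [dw0 wd wnil]]] := @nilp_seq [seq x i | i <- enum 'I_s].
  by move=> _ /mapP[i _ ->].
have {}wnil i : nilp w dw (x i) 1 by apply: wnil; apply: map_f; rewrite mem_enum.
have [N NP] := choice wnil; have [k kP] := choice NP.
exists dw, w, (\sum_i N i + dw).+1; split=> // n nn1; split; first by lia.
apply: ideal_pow_ind; first exact: near_mul_subm.
move=> a aI; have ex j : exists c : 'I_s -> A, a j = \sum_i c i * x i.
  by have [c cE] := xgen (a j) (aI j); exists c.
have [c cE] := choice ex.
under eq_bigr => j _ do rewrite cE.
rewrite bigA_distr_bigA /=; apply: (subm_sum (near_mul_subm _ _ _)) => f _.
rewrite big_split; apply: subm_mull (near_mul_subm _ _ _) _.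
rewrite (partition_big f predT) //=.
under eq_bigr => i _.
  rewrite (eq_bigr (fun=> x i)); last by move=> j /eqP->.
  rewrite prodr_const; over.
have cardE : (\sum_i #|[pred j | f j == i]| = n)%N.
  rewrite -[RHS]card_ord -sum1_card (partition_big f predT) //=.
  by apply: eq_bigr => i _; rewrite sum1_card.
have [i iN] : exists i, (N i <= #|[pred j | f j == i]|)%N.
  apply: contrapT => none; have : (n <= \sum_i N i)%N.
    rewrite -{1}cardE; apply: leq_sum => i _; rewrite leqNgt; apply/negP => /ltnW iN.
    by apply: none; exists i.
  by lia.
have [kE Hk] := kP i; rewrite muln1 in kE.
rewrite (bigD1 i) //= -(subnKC iN) exprD -mulrA.
have xX j l : (x j ^+ l : A^o) \in ideal_pow I l.
  by have := ideal_powX l (ideal_pow1 (xI j)); rewrite mul1n.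
pose h j := #|[pred k | f k == j]|.
have hE : (h i + \sum_(j | j != i) h j = n)%N by rewrite -cardE [RHS](bigD1 i).
have -> : (n - dw = k i + ((h i - N i) + \sum_(j | j != i) h j))%N.
  by move: iN hE; rewrite -/(h i) kE; lia.
apply: near_mulM => //; apply: ideal_powM.
  exact: xX.
by apply: ideal_pow_big_prod => j _; apply: xX.
Qed.

(** Nakayama turns the statement on the fibre cone into I^n = w I^(n - dw) for large n. Replacing
    [w] by its power [w ^+ D] makes [d] as large as wanted. *)
Lemma reduction D : exists d a n, [/\ (D <= d)%N, pow d a &
  forall x, pow (n + d) x -> exists y, pow n y /\ x = a * y].
Proof.
have [dw [w [n1 [dw0 wd wT]]]] := near_mul_pow.
have step n : (n1 <= n)%N -> forall x, pow n x -> exists y, pow (n - dw) y /\ x = w * y.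
  move=> nn1 x xn; have [dwn {}wT] := wT n nn1.
  pose P (x : A^o) := exists y, pow (n - dw) y /\ x = w * y.
  have sP : subm P.
    split; first by exists 0; rewrite mulr0; split=> //; apply: rpred0.
    move=> a y z [y' [yn ->]] [z' [zn ->]]; exists (a * y' + z'); split.
      exact: (ideal_pow_subm I _).2.
    by rewrite -[LHS]/(a * (w * y') + w * z'); ring.
  have [r [v [vn vgen]]] := nA (ideal_pow_subm I n).
  have Pv : forall i, P (v i).
    apply: (nakayama sM _ sP) => [a Ma|i]; first exact: (jacM sM M1 unitM).
    have [y [z [yn zn ->]]] := wT _ (vn i).
    have : MI n z by rewrite -(subnK dwn).
    move=> [k [b [u [Mb un zE]]]].
    have [e' eE] := choice (fun l => vgen _ (un l)).
    exists (fun j => \sum_l b l * e' l j); split.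
      by move=> j; apply: (subm_sum sM) => l _; rewrite mulrC; apply: subm_mull.
    have -> : \sum_j (\sum_l b l * e' l j) *: v j = z.
      rewrite zE; under eq_bigr => j _ do rewrite scaler_suml.
      rewrite exchange_big; apply: eq_bigr => l _; rewrite [u l]eE mulr_sumr.
      by apply: eq_bigr => j _; rewrite -scalerA.
    by rewrite addrK; exists y.
  by have [c ->] := vgen x xn; apply: (subm_sum sP) => i _; apply: (submZ sP).
exists (dw * D)%N, (w ^+ D), n1; split; [by rewrite leq_pmull | exact: ideal_powX |].
elim: D => [|D IH] x; first by rewrite muln0 addn0 => xn; exists x; rewrite mul1r.
move=> xn; have [|y [yn ->]] := step _ _ _ xn; first exact: leq_addr.
have [|z [zn ->]] := IH y; last by exists z; rewrite exprS mulrA.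
by move: yn; rewrite mulnS addnCA addKn.
Qed.

End Bounded.
End Reduction.

(** * Canonical ideals *)

(* colon M a = (aA : M), which is a End(M) when M is not principal. *)
Definition colon (A : comNzRingType) (M : A^o -> Prop) (a : A) (x : A^o) : Prop :=
  forall b : A, M b -> exists y, x * b = a * y.

Lemma colon_subm (A : comNzRingType) (M : A^o -> Prop) (a : A) : subm (colon M a).
Proof.
split; first by move=> b _; exists 0; rewrite mul0r mulr0.
move=> c x y cx cy b Mb; have [x' xE] := cx b Mb; have [y' yE] := cy b Mb.
by exists (c * x' + y'); rewrite mulrDl -[c *: x * b]mulrA xE yE; ring.
Qed.

Lemma lenge_mul (A : comNzRingType) (a : A) k (Y X : A^o -> Prop) :
  treg (A^o : lmodType A) a -> lenge k Y X ->
  lenge k (fun x : A^o => exists y : A, Y y /\ x = a * y)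
    (fun x : A^o => exists y : A, X y /\ x = a * y).
Proof.
move=> ra; elim: k X => [|k IH] X /=; first by move=> YX x [y [/YX Xy ->]]; exists y.
move=> [Z [sZ lZ ZX [x [Xx nZx]]]]; exists (fun x : A^o => exists y : A, Z y /\ x = a * y).
split; [|exact: IH|by move=> _ [y [/ZX Xy ->]]; exists y|].
  split; first by exists 0; rewrite mulr0; split=> //; case: sZ.
  move=> c _ _ [y [Zy ->]] [z [Zz ->]]; exists (c * y + z); split; first exact: sZ.2.
  by rewrite -[LHS]/(c * (a * y) + a * z); ring.
exists (a * x); split; first by exists x.
by move=> [y [Zy /(tregI ra) E]]; apply: nZx; rewrite E.
Qed.

Lemma hom_exists (A : comNzRingType) (V W : lmodType A) (f : V -> W) : linear f ->
  exists F : hom V W, forall x, F x = f x.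
Proof.
move=> lf; have Hf : f \in @linear_pred A V W by rewrite inE; apply/asboolP.
by exists (Hom Hf).
Qed.

(** * The type as a length between a A and (a A : M) *)

Section CMType.
Variables (A : comNzRingType) (m : submodClosed A^o) (a : A).
Let M (x : A^o) : Prop := x \in m.
Hypotheses (M1 : ~ M 1) (Ma : M a) (ra : treg (A^o : lmodType A) a).

(** Ext^1(A / M, A) embeds in (a A : M) / a A. Let [p0] in [P] lie over 1 and let [ka b] in [K]
    correspond to [b *: p0] for b in [M]. A map h : K -> A is sent to [h (ka a)], and it extends to
    [P] when this value is a multiple of [a]. *)
Lemma CM_type_lenge r : CM_type m r -> lenge r (tmul a) (colon M a).
Proof.
have sM : subm M := subm_of m.
move=> [V [[K [P [f [g [q [prP [finj exact gsurj] qE qsurj]]]]]] [_ [v [_ vind]]]]].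
pose pim (x : A^o) : quotmod m := \pi_(quotmod m) x.
have lpi : linear pim.
  by move=> c x y; rewrite /pim quotmod_piD -quotmod_scaleE.
have [pi piE] := linear_exists lpi.
have pi0 x : pi x = 0 <-> M x.
  have p0 : pim 0 = 0 by rewrite -piE linear0.
  rewrite piE -{1}p0; split=> [/quotmod_piP|Mx]; first by rewrite subr0.
  by apply/quotmod_piP; rewrite subr0.
have [|th thE] := prP _ _ pi g.
  by elim/quotW => x; exists x; rewrite piE.
have [p0 p0E] := gsurj (pi 1).
have piZ x : pi x = (x : A) *: pi 1.
  by rewrite -linearZ_LR; congr (pi _); rewrite [RHS]mulr1.
have Mp0 (b : A^o) : M b -> exists k, f k = (b : A) *: p0.
  by move=> Mb; apply/exact; rewrite linearZ_LR /= p0E -piZ; apply/pi0.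
have ex_ka (b : A^o) : exists k, M b -> f k = (b : A) *: p0.
  by case: (EM (M b)) => [/Mp0 [k kE]|nM]; [exists k | exists 0].
have [ka kaE] := choice ex_ka.
have ex_s p : exists k, f k = p - (th p : A) *: p0.
  by apply/exact; rewrite linearB linearZ_LR /= p0E -piZ thE subrr.
have [s sE] := choice ex_s.
have [phi phiE] := choice (fun i => qsurj (v i)).
have swap (h : hom K A^o) b : M b -> h (ka a) * b = a * h (ka b).
  move=> Mb; have E : b *: ka a = a *: ka b.
    by apply: finj; rewrite !linearZ_LR /= !kaE // !scalerA mulrC.
  rewrite mulrC -[LHS]/(b *: h (ka a)) -[RHS]/(a *: h (ka b)).
  have hZ c x : h (c *: x) = c *: h x by exact: linearZ_LR.
  by rewrite -!hZ E.
apply: (@indep_lenge A A^o M r (fun i => phi i (ka a))) => //.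
- exact: tmul_subm.
- exact: colon_subm.
- by move=> _ [y ->] b Mb; exists (y * b); rewrite mulrA.
- by move=> i b Mb; exists (phi i (ka b)); apply: swap.
move=> c [c0 c0E]; apply: vind.
have [|h hE] := @hom_exists A K A^o (fun k => \sum_i c i * phi i k).
  move=> b x y; rewrite scaler_sumr -big_split; apply: eq_bigr => i _ /=.
  by rewrite linearP mulrDr; congr (_ + _); exact: mulrCA.
have -> : \sum_i c i *: v i = q h.
  have -> : h = \sum_i c i *: phi i.
    apply/val_inj/funext => k; rewrite -[LHS]/(h k) hE.
    have ev0 (n : nat) (F : 'I_n -> hom K A^o) : val (\sum_i F i) k = \sum_i val (F i) k.
      by elim/big_rec2: _ => // i y1 y2 _ <-.
    by rewrite ev0.
  by rewrite linear_sum; apply: eq_bigr => i _; rewrite linearZ_LR phiE.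
have hka b : M b -> h (ka b) = b * c0.
  move=> Mb; apply: (tregI ra); rewrite -[LHS]/(a * h (ka b)) -(swap h) //.
  by rewrite hE c0E -[RHS]/(a * (b * c0)) -[LHS]/(a * c0 * b) -mulrA [b * _]mulrC.
(* [th] lifts P -> A / m to A, and [s p] is p - th(p) p0 in [K]. On [K] the two summands add up to
   [h], because [h (ka b) = b * c0]. *)
apply/qE; have [|H HE] := @hom_exists A P A^o (fun p => h (s p) + c0 * th p).
  move=> b x y; have -> : s (b *: x + y) = b *: s x + s y.
    apply: finj; rewrite linearP !sE linearP scalerDl -scalerA scalerBr.
    by rewrite opprD addrACA.
  have -> : h (b *: s x + s y) = b * h (s x) + h (s y) by exact: linearP.
  have -> : th (b *: x + y) = b * th x + th y by exact: linearP.
  by rewrite -[b *: _]/(b * (h (s x) + c0 * th x)); ring.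
exists H => x; rewrite HE.
have Mth : M (th (f x)) by apply/pi0; rewrite thE; apply/exact; exists x.
have -> : s (f x) = x - ka (th (f x)) by apply: finj; rewrite sE linearB kaE.
have -> : h (x - ka (th (f x))) = h x - h (ka (th (f x))) by exact: linearB.
by rewrite hka // [c0 * _]mulrC subrK.
Qed.

End CMType.

Section CanonicalIdeal.
Variables (A : comNzRingType) (M : A^o -> Prop) (I : submodClosed A^o) (a : A) (d : nat).
Hypotheses (nA : noethmod (A^o : lmodType A)) (sM : subm M) (M1 : ~ M 1).
Hypothesis unitM : forall a : A, ~ M a -> exists b, b * a = 1.
Hypotheses (Ma : M a) (ra : treg (A^o : lmodType A) a).
Hypotheses (d2 : (1 < d)%N) (ad : (a : A^o) \in ideal_pow I d).

Hypothesis sepI : forall (V : lmodType A) (x : V), fin_gen V -> treg V a ->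
  ~ tmul a x -> exists f : {linear V -> A^o},
    (forall z, f z \in I) /\ forall y : A, (y : A^o) \in I -> f x <> a * y.

Let sI : subm (fun x => x \in I) := subm_of I.

Let aI : (a : A^o) \in I.
Proof. by apply: ideal_pow1E; apply: ideal_pow_sub ad; apply: ltnW. Qed.

Lemma canonical_sep_ideal (N : A^o -> Prop) (x : A) : subm N -> N x ->
  (forall y : A, N y -> x <> a * y) -> exists f : A^o -> A^o,
    [/\ lin_on N f, forall z, N z -> f z \in I &
        forall y : A, (y : A^o) \in I -> f x <> a * y].
Proof.
move=> sN Nx nx; have [N' N'E] := submodP sN; have /N'E xN' := Nx.
have fgN : fin_gen (submod N') by move/noetherianP: nA; apply.
have [||f [fI fx]] := @sepI (submod N') (Submod xN') fgN.
- move=> z az; apply: val_inj; apply: ra.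
  by rewrite -[LHS]/(val (a *: z)) az.
- move=> [y /(congr1 val)] /= xE; apply: (nx (val y)) => //.
  by apply/N'E; apply: valP.
have ex_h z : exists u, forall Nz : z \in N', u = f (Submod Nz).
  have [Nz|nNz] := EM (z \in N'); last by exists 0.
  by exists (f (Submod Nz)) => Nz'; congr (f _); apply: val_inj.
have [h hE] := choice ex_h; exists h; split.
- move=> c z1 z2 /N'E N1 /N'E N2.
  have N3 : c *: z1 + z2 \in N' by rewrite rpredD // rpredZ.
  rewrite (hE _ N1) (hE _ N2) (hE _ N3) -linearP; congr (f _).
  exact: val_inj.
- by move=> z /N'E Nz; rewrite (hE _ Nz).
- by move=> y yI; rewrite (hE _ xN'); apply: fx.
Qed.

(* End(I) = A *)
Lemma end_canonical (g : A^o -> A^o) : lin_on (fun x => x \in I) g ->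
  (forall x, x \in I -> g x \in I) -> exists rho : A, forall x, x \in I -> g x = rho * x.
Proof.
move=> lg gI.
have gswap (x y : A) : (x : A^o) \in I -> (y : A^o) \in I -> x * g y = y * g x.
  move=> xI yI; rewrite -[LHS]/(x *: g y) -[RHS]/(y *: g x).
  by rewrite -!(lin_onZ _ sI lg) //; congr g; apply: mulrC.
have [[rho rhoE]|nv] := EM (tmul a (g a)).
  exists rho => x xI; apply: (tregI ra); rewrite -[LHS]/(a * g x) gswap // rhoE.
  by rewrite -[LHS]/(x * (a * rho)) -[RHS]/(a * (rho * x)); ring.
(* [g] acts as the fraction g(a) / a. If this were not in A, some f : A -> I would send g(a) outside
   a I, yet f(g(a)) = g(a) f(1) = a g(f(1)). *)
have [f [fI fx]] := sepI (fin_gen_self A) ra nv.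
case: (fx (g (f 1))); first by apply: gI.
rewrite -gswap // mulrC -[RHS]/((g a : A) *: f 1) -linearZ_LR.
by congr (f _); rewrite [RHS]mulr1.
Qed.

Definition principal_ideal : Prop :=
  exists y0 : A, (y0 : A^o) \in I /\ forall x : A, (x : A^o) \in I -> exists c, x = c * y0.

(** Otherwise some f : I^2 -> I sends [th * z] outside a I. By [end_canonical], f(y0 x) = rho(y0) x
    on [I]. If all [rho y0] lie in [M], then f(z) is in M I and th f(z) in a I. If some [rho y0] is
    a unit, the symmetry rho(x) y0 = rho(y0) x shows that [y0] generates [I]. *)
Lemma colon_pow2 (th z : A) : ~ principal_ideal -> colon M a th ->
  (z : A^o) \in ideal_pow I 2 ->
  exists y : A, (y : A^o) \in ideal_pow I 2 /\ th * z = a * y.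
Proof.
move=> npr cth z2; apply: contrapT => nz.
have s2 := ideal_pow_subm I 2.
have [||f [lf fI fz]] := @canonical_sep_ideal _ (th * z) s2; first exact: (subm_mull th s2 z2).
  by move=> y y2 E; apply: nz; exists y.
have I2 (x y : A) : (x : A^o) \in I -> (y : A^o) \in I -> (x * y : A^o) \in ideal_pow I 2.
  by move=> xI yI; apply: (@ideal_powM _ _ 1 1); apply: ideal_pow1.
have ex_rho (y0 : A^o) : exists rho : A, y0 \in I ->
    forall x : A, (x : A^o) \in I -> f (y0 * x) = rho * x.
  have [yI|nyI] := EM (y0 \in I); last by exists 0.
  have [||rho rhoE] := @end_canonical (fun x => f (y0 * x)); last by exists rho => _.
    move=> c x y xI y'I; rewrite mulrDr [y0 * (c *: x)]mulrCA.
    by apply: lf; apply: I2.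
  by move=> x xI; apply/fI/I2.
have [rho rhoE] := choice ex_rho.
have [Mrho|] := EM (forall y0, y0 \in I -> M (rho y0)).
  have [_ [k [b [y [Mb yI fzE]]]]] : (z : A^o) \in ideal_pow I 2 /\
      idprod M (fun x => x \in I) (f z).
    move: (z) z2; apply: (@ideal_powM_ind A I 1 1 (fun z => _ /\ _)).
      split.
        split; first by case: s2.
        by rewrite (lin_on0 s2 lf); case: (idprod_subm (fun x => x \in I) sM).
      move=> c x y [x2 fx] [y2 fy]; split; first exact: s2.2.
      by rewrite lf //; apply: (idprod_subm _ sM).2.
    move=> x y /ideal_pow1E xI /ideal_pow1E yI; split; first exact: I2.
    by rewrite rhoE //; apply: idprod_in => //; apply: Mrho.
  have [u uE] := choice (fun i => cth _ (Mb i)).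
  case: (fz (\sum_i u i * y i)).
    by apply: (subm_sum sI) => i _; apply: (subm_mull _ sI (yI i)).
  rewrite -[th * z]/(th *: (z : A^o)) (lin_onZ _ s2 lf) // fzE -[LHS]/(th * _).
  by rewrite !mulr_sumr; apply: eq_bigr => i _; rewrite !mulrA uE.
move=> nM; apply: npr.
have [y0 [y0I nMy0]] : exists y0, y0 \in I /\ ~ M (rho y0).
  apply: contrapT => none; apply: nM => y0 y0I; apply: contrapT => nM0.
  by apply: none; exists y0.
have [b bE] := unitM nMy0; exists y0; split=> // x xI; exists (b * rho x).
rewrite -mulrA -(rhoE x) // mulrC [x * y0]mulrC rhoE //.
by rewrite mulrC mulrA bE mul1r.
Qed.

(** The fraction th / a maps I^d = I^2 I^(d-2) into itself by [colon_pow2]; it is applied to [a], an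
    element of I^d. *)
Lemma colon_sub_pow (th : A) : ~ principal_ideal -> colon M a th ->
  (th : A^o) \in ideal_pow I d.
Proof.
move=> npr cth.
have H (x : A) : (x : A^o) \in ideal_pow I d ->
    exists y : A, (y : A^o) \in ideal_pow I d /\ th * x = a * y.
  rewrite -(subnKC d2); move: x; apply: ideal_powM_ind.
    split; first by exists 0; rewrite !mulr0; split=> //; apply: rpred0.
    move=> c x1 x2 [y1 [I1 E1]] [y2 [I2 E2]]; exists (c * y1 + y2); split.
      exact: (ideal_pow_subm I _).2.
    by rewrite mulrDr [th * (c *: x1)]mulrCA E1 E2; ring.
  move=> x y /(colon_pow2 npr cth) [x' [x2 E]] yd.
  by exists (x' * y); split; [exact: ideal_powM | rewrite !mulrA E].
by have [y [yd]] := H a ad; rewrite mulrC => /(tregI ra) ->.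
Qed.

(* (I :_I End(M)) = M I *)
Lemma colon_ann_canonical (y : A) : (y : A^o) \in I ->
  (forall th, colon M a th -> exists y' : A, (y' : A^o) \in I /\ th * y = a * y') ->
  idprod M (fun x => x \in I) y.
Proof.
move=> yI Hy; apply: contrapT => ny.
have sN := idprod_subm (fun x => x \in I) sM.
have inN (b x : A) : M b -> (x : A^o) \in I -> idprod M (fun x => x \in I) (b * x).
  by move=> Mb xI; apply: idprod_in.
have [||f [lf fI fy]] := @canonical_sep_ideal _ (a * y) sN; first exact: inN.
  by move=> y' Ny' /(tregI ra) E; apply: ny; rewrite E.
have ex_rho (b : A^o) : exists rho : A, M b ->
    forall x : A, (x : A^o) \in I -> f (b * x) = rho * x.
  have [Mb|nMb] := EM (M b); last by exists 0.
  have [||rho rhoE] := @end_canonical (fun x => f (b * x)); last by exists rho => _.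
    move=> c x x' xI xI'; rewrite mulrDr [b * (c *: x)]mulrCA.
    by apply: lf; apply: inN.
  by move=> x xI; apply/fI/inN.
have [rho rhoE] := choice ex_rho.
(* [f] is multiplication by rho(a) / a, which maps [M] into A; the assumption on [y] then puts f(a
   y) in a I. *)
have [|y' [y'I E]] := Hy (rho a).
  move=> b Mb; exists (rho b).
  have := rhoE a Ma (b * a) (subm_mull b sI aI).
  rewrite mulrCA (rhoE b) //; last exact: (subm_mull a sI aI).
  move=> E; apply: (tregI ra).
  rewrite -[LHS]/(a * (rho a * b)) -[RHS]/(a * (a * rho b)).
  by transitivity (rho a * (b * a)); [ring | rewrite -E; ring].
by apply: (fy y' y'I); rewrite rhoE.
Qed.

(** If (a A : M) were strictly smaller than I^d, the chain I^(n+d) <= a I^n <= a A <= (a A : M) <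
    I^d <= A would give l(n+d) >= l(n) + r + 1 + l(d), that is, e1 > r. *)
Lemma colon_eq_pow (l : nat -> nat) (e0 e1 : int) (r n0 n : nat) :
  ~ principal_ideal ->
  (forall n, (n0 < n)%N -> [/\ lenge (l n) (fun x => x \in ideal_pow I n) (fun=> True),
     lenle (l n) (fun x => x \in ideal_pow I n) (fun=> True) & (l n)%:Z = e0 * n%:Z - e1]) ->
  (n0 < d)%N -> (n0 < n)%N -> e1 <= r%:Z ->
  (forall x, x \in ideal_pow I (n + d) -> exists y, y \in ideal_pow I n /\ x = a * y) ->
  lenge r (tmul a) (colon M a) ->
  forall x, x \in ideal_pow I d -> colon M a x.
Proof.
move=> npr lE n0d n0n e1r red lr x xd; apply: contrapT => nx.
have [ld _ ldE] := lE _ n0d; have [ln _ lnE] := lE _ n0n.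
have [_ lnd lndE] : [/\ lenge (l (n + d)%N) (fun x => x \in ideal_pow I (n + d)) (fun=> True),
     lenle (l (n + d)%N) (fun x => x \in ideal_pow I (n + d)) (fun=> True) &
     (l (n + d)%N)%:Z = e0 * (n + d)%N%:Z - e1] by apply: lE; lia.
have L1 : lenge r.+1 (tmul a) (fun x => x \in ideal_pow I d).
  exists (colon M a); split=> //; first exact: colon_subm.
    by move=> y; apply: colon_sub_pow.
  by exists x.
have L2 : lenge (l n) (fun x => x \in ideal_pow I (n + d)) (tmul a).
  apply: lenge_mono (lenge_mul ra ln) => [y /red [z [zn ->]]|y [z [_ ->]]].
    by exists z.
  by exists z.
have := lnd _ (lenge_cat (lenge_cat L2 L1) ld).
by move: ldE lnE lndE e1r; rewrite PoszD mulrDr; lia.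
Qed.

(* A module V over End(M) maps to M I under every g : V -> I, so that s g / a has
   values in A for s in I^(d-1), as a M = M I^d. *)
Lemma sep_colon (V : lmodType A) (x : V) :
  principal_ideal \/ (forall y, y \in ideal_pow I d -> colon M a y) ->
  fin_gen V -> treg V a -> (forall th, colon M a th -> forall z : V, tmul a ((th : A) *: z)) ->
  ~ tmul a x -> exists f : {linear V -> A^o}, ~ tmul a (f x).
Proof.
move=> prI fV rV cV nx; have [g [gI gx]] := sepI fV rV nx.
case: prI => [[y0 [y0I y0gen]]|Icol].
  have ry0 : treg (A^o : lmodType A) y0.
    move=> z y0z; apply: ra; have [c ->] := y0gen _ aI.
    by rewrite -scalerA y0z scaler0.
  have [h hE] := choice (fun z => y0gen _ (gI z)).
  have [|f fE] := @linear_exists A V A^o h.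
    move=> c z1 z2; apply: (tregI ry0); rewrite -[LHS]/(y0 * h _) mulrC -hE linearP.
    rewrite [g z1]hE [g z2]hE -[LHS]/(c * (h z1 * y0) + h z2 * y0).
    by rewrite -[RHS]/(y0 * (c * h z1 + h z2)); ring.
  exists f => -[u uE]; apply: (gx (u * y0)); first exact: (subm_mull u sI y0I).
  by rewrite hE -fE uE mulrA.
have gMI z : idprod M (fun x => x \in I) (g z).
  apply: colon_ann_canonical => // th cth; have [z' zE] := cV th cth z.
  exists (g z'); split=> //.
  by rewrite -[LHS]/(th *: g z) -[RHS]/(a *: g z') -!linearZ_LR zE.
apply: contrapT => nof.
have allf (f : {linear V -> A^o}) : tmul a (f x).
  by apply: contrapT => nf; apply: nof; exists f.
have sg (s : A) : (s : A^o) \in ideal_pow I d.-1 -> exists rho : A, s * g x = a * (a * rho).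
  move=> sd.
  have ex_h z : exists u : A, s * g z = a * u.
    have [k [b [y [Mb yI ->]]]] := gMI z.
    have ys i : exists u : A, y i * s * b i = a * u.
      apply: (Icol (y i * s)) (Mb i).
      have -> : d = (1 + d.-1)%N by lia.
      by apply: ideal_powM => //; apply: ideal_pow1.
    have [u uE] := choice ys; exists (\sum_i u i).
    by rewrite !mulr_sumr; apply: eq_bigr => i _; rewrite -uE; ring.
  have [h hE] := choice ex_h.
  have [|f fE] := @linear_exists A V A^o h.
    move=> c z1 z2; apply: (tregI ra); rewrite -[LHS]/(a * h _) -hE linearP.
    rewrite -[LHS]/(s * (c * g z1 + g z2)) -[RHS]/(a * (c * h z1 + h z2)).
    by rewrite !mulrDr mulrCA hE hE; ring.
  have [rho rhoE] := allf f; exists rho.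
  by rewrite hE -fE rhoE.
(* If every s g / a with [s] in I^(d-1) sends [x] into a A, then I^d g(x) lies in a^2 I. Taking z =
   a and cancelling [a] puts g(x) in a I, against the choice of [g]. *)
have H (z : A) : (z : A^o) \in ideal_pow I (1 + d.-1) ->
    exists y : A, (y : A^o) \in I /\ z * g x = a * (a * y).
  move: z; apply: ideal_powM_ind.
    split; first by exists 0; rewrite !mulr0 mul0r; split=> //; apply: rpred0.
    move=> c x1 x2 [y1 [I1 E1]] [y2 [I2 E2]]; exists (c * y1 + y2); split.
      exact: sI.2.
    by rewrite mulrDl -[c *: x1 * g x]mulrA E1 E2; ring.
  move=> y s /ideal_pow1E yI /sg [rho E]; exists (rho * y).
  split; first exact: (subm_mull rho sI yI).
  by rewrite -mulrA E; ring.
have [|y [yI yE]] := H a; first by rewrite add1n prednK // ltnW.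
by apply: (gx y yI); apply: (tregI ra).
Qed.

End CanonicalIdeal.

(** * Cohen-Macaulay modules and regular elements *)

Section Primes.
Variable A : comNzRingType.
Implicit Types p q : prime_idealr A.

Lemma primeP (N : A^o -> Prop) : subm N -> ~ N 1 ->
  (forall a b : A, N (a * b) -> N a \/ N b) ->
  exists p, forall x : A, x \in (p : {pred A}) <-> N x.
Proof.
move=> sN N1 NM; pose P : {pred A} := fun x => `[< N x >].
have cP : idealr_closed P.
  split; first by apply/asboolP; case: sN.
    by apply/asboolP.
  by move=> a x y /asboolP Nx /asboolP Ny; apply/asboolP/sN.2.
have pP : prime_idealr_closed P.
  move=> a b /asboolP /NM [Na|Nb]; apply/orP; [left|right]; exact/asboolP.
pose p : prime_idealr A := HB.pack P (isIdealr.Build A P cP)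
  (isPrimeIdealrClosed.Build A P pP).
by exists p => x; split=> /asboolP.
Qed.

Definition psub p q : Prop :=
  {subset (p : {pred A}) <= (q : {pred A})} /\
  ~ {subset (q : {pred A}) <= (p : {pred A})}.

Lemma psubE p q (x : A) : {subset (p : {pred A}) <= (q : {pred A})} ->
  x \in (q : {pred A}) -> x \notin (p : {pred A}) -> psub p q.
Proof. by move=> pq xq xp; split=> // /(_ x xq); rewrite (negbTE xp). Qed.

Lemma prime_avoid (N0 : A^o -> Prop) (S : A -> Prop) : noethmod (A^o : lmodType A) ->
  subm N0 -> S 1 -> (forall a b, S a -> S b -> S (a * b)) -> (forall a, S a -> ~ N0 a) ->
  exists p, (forall x : A, N0 x -> x \in (p : {pred A})) /\
            (forall x : A, S x -> x \notin (p : {pred A})).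
Proof.
move=> nA sN0 S1 SM SN0.
pose F (N : A^o -> Prop) := [/\ subm N, forall x, N0 x -> N x & forall a, S a -> ~ N a].
have [||N [[sN N0N SN] Nmax]] := @acc A A^o F nA; first by exists N0.
  by move=> N [].
have meets a : ~ N a -> exists u r, N u /\ S (u + r * a).
  move=> nNa; apply: contrapT => none; apply: nNa.
  pose N' x := exists u r, N u /\ x = u + r * a.
  apply: (Nmax N'); last by exists 0, 1; rewrite mul1r add0r; split=> //; case: sN.
    split; last by move=> b Sb [u [r [Nu E]]]; apply: none; exists u, r; rewrite -E.
      split; first by exists 0, 0; rewrite mul0r addr0; split=> //; case: sN.
      move=> c x y [u [r [Nu ->]]] [v [s [Nv ->]]]; exists (c * u + v), (c * r + s).
      split; first exact: sN.2.
      by rewrite -[LHS]/(c * (u + r * a) + (v + s * a)); ring.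
    by move=> x /N0N Nx; exists x, 0; rewrite mul0r addr0.
  by move=> x Nx; exists x, 0; rewrite mul0r addr0.
have [||p pE] := primeP sN; first exact: SN.
  move=> a b Nab; apply: contrapT => nab.
  have [u [r [Nu Su]]] : exists u r, N u /\ S (u + r * a).
    by apply: meets => Na; apply: nab; left.
  have [v [s [Nv Sv]]] : exists u r, N u /\ S (u + r * b).
    by apply: meets => Nb; apply: nab; right.
  apply: (SN _ (SM _ _ Su Sv)).
  have -> : (u + r * a) * (v + s * b) = (v + s * b) * u + (r * a * v + r * s * (a * b)).
    by ring.
  apply: (submD sN); first exact: (subm_mull _ sN).
  by apply: (submD sN); apply: (subm_mull _ sN).
exists p; split=> [x /N0N /pE //|x Sx].
by apply/negP => /pE; apply: SN.
Qed.

(** Products of a power of [t] and an element outside [p] are nonzero because [t] is regular; a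
    prime disjoint from them lies in [p] and avoids [t]. *)
Lemma prime_below p (t : A) : noethmod (A^o : lmodType A) ->
  treg (A^o : lmodType A) t -> t \in (p : {pred A}) ->
  exists q, psub q p /\ t \notin (q : {pred A}).
Proof.
move=> nA rt tp; have rtn n : treg (A^o : lmodType A) (t ^+ n).
  elim: n => [|n IH] x; first by rewrite expr0 scale1r.
  by rewrite exprS -scalerA => /rt /IH.
pose S x := exists s n, s \notin (p : {pred A}) /\ x = s * t ^+ n.
have [||||q [_ Sq]] := @prime_avoid (fun x => x = 0) S nA.
- by split=> // a x y -> ->; rewrite scaler0 addr0.
- by exists 1, 0%N; rewrite mulr1 idealr1.
- move=> _ _ [s [n [sp ->]]] [s' [n' [s'p ->]]]; exists (s * s'), (n + n')%N.
  by rewrite prime_idealrM negb_or sp s'p exprD; split=> //; ring.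
- move=> _ [s [n [sp ->]]] /eqP; rewrite mulrC => /eqP /rtn s0.
  by move: sp; rewrite s0 idealr0.
have tq : t \notin (q : {pred A}).
  by apply: Sq; exists 1, 1%N; rewrite mul1r idealr1.
exists q; split=> //; apply: psubE tp tq => x xq; apply/negP => /negP xp.
by move: xq; apply/negP/Sq; exists x, 0%N; rewrite mulr1.
Qed.

End Primes.

(** * Primes of a localization *)

Section LocalPrimes.
Variables (A : comNzRingType) (p : prime_idealr A).

Lemma loc_ring_scaleE (a : A) s b u :
  (ringfrac a s : loc_ring p) * ringfrac b u = ringfrac (a * b) (denomM s u).
Proof. exact: loc_mulE. Qed.

Lemma ringfrac1 (s : denom p) : ringfrac (dval s) s = 1 :> loc_ring p.
Proof. by apply: ringfrac_eq; rewrite mulrC. Qed.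

Lemma loc_prime (q : prime_idealr A) : {subset (q : {pred A}) <= (p : {pred A})} ->
  exists Q : prime_idealr (loc_ring p), forall (a : A) s,
    (ringfrac a s \in (Q : {pred loc_ring p})) = (a \in (q : {pred A})).
Proof.
move=> qp.
pose N (z : (loc_ring p)^o) := exists (a : A) s, a \in (q : {pred A}) /\ z = ringfrac a s.
have NE (a : A) s : N (ringfrac a s) <-> a \in (q : {pred A}).
  split; last by exists a, s.
  move=> [b [u [bq /fracP [v]]]]; rewrite -[_ *: _]/(dval v * dval u * a) => E.
  have : dval v * dval u * a \in (q : {pred A}).
    by rewrite E -[_ *: _]/(dval v * dval s * b) prime_idealrM bq orbT.
  rewrite !prime_idealrM -orbA => /or3P[/qp|/qp|//].
    by rewrite (negbTE (valP v)).
  by rewrite (negbTE (valP u)).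
have [|||Q QE] := @primeP _ N.
- split; first by exists 0, (denom1 p); rewrite idealr0.
  move=> c x y [a [s [aq ->]]] [b [u [bq ->]]].
  have [e [v ->]] := loc_ringP c.
  rewrite -[_ *: _]/(ringfrac e v * ringfrac a s) loc_ring_scaleE ringfracD.
  by apply/NE; rewrite rpredD // !prime_idealrM ?aq ?bq !orbT.
- by move=> /NE; rewrite idealr1.
- move=> x y; have [a [s ->]] := loc_ringP x; have [b [u ->]] := loc_ringP y.
  rewrite loc_ring_scaleE => /NE; rewrite prime_idealrM => /orP[H|H]; [left|right]; exact/NE.
by exists Q => a s; apply/idP/idP => [/QE/NE|/NE/QE].
Qed.

Lemma contract_prime (Q : prime_idealr (loc_ring p)) :
  exists q : prime_idealr A, {subset (q : {pred A}) <= (p : {pred A})} /\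
    forall (a : A) s, (ringfrac a s \in (Q : {pred loc_ring p})) = (a \in (q : {pred A})).
Proof.
pose N (a : A^o) : Prop := ringfrac (a : A) (denom1 p) \in (Q : {pred loc_ring p}).
have N1 : ~ N 1 by rewrite /N -[ringfrac _ _]/(1 : loc_ring p) idealr1.
have [|||q qE] := @primeP _ N => //.
- split; first by rewrite /N -[ringfrac _ _]/(0 : loc_ring p) idealr0.
  move=> c x y Nx Ny; rewrite /N.
  have -> : ringfrac (c * (x : A) + (y : A)) (denom1 p) =
      ringfrac c (denom1 p) * ringfrac (x : A) (denom1 p) +
      ringfrac (y : A) (denom1 p) :> loc_ring p.
    rewrite loc_ring_scaleE ringfracD; apply: ringfrac_eq => /=.
    by rewrite !mul1r.
  by rewrite rpredD // prime_idealrM; apply/orP; right.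
- move=> a b; rewrite /N.
  have -> : ringfrac (a * b) (denom1 p) =
      ringfrac a (denom1 p) * ringfrac b (denom1 p) :> loc_ring p.
    by rewrite loc_ring_scaleE; apply: ringfrac_eq; rewrite /= !mul1r.
  by rewrite prime_idealrM => /orP[|]; [left|right].
exists q; split.
  move=> x /qE xN; apply/negP => /negP xp; apply: N1; rewrite /N.
  have -> : ringfrac 1 (denom1 p) =
      ringfrac 1 (Denom xp) * ringfrac (x : A) (denom1 p) :> loc_ring p.
    by rewrite loc_ring_scaleE; apply: ringfrac_eq; rewrite /= !mulr1 !mul1r.
  by rewrite prime_idealrM; apply/orP; right.
move=> a s; apply/idP/idP => [aQ|/qE aN].
  apply/qE; rewrite /N.
  have -> : ringfrac a (denom1 p) = ringfrac (dval s) (denom1 p) * ringfrac a s :> loc_ring p.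
    by rewrite loc_ring_scaleE; apply: ringfrac_eq; rewrite /= !mul1r.
  by rewrite prime_idealrM aQ orbT.
have -> : ringfrac a s = ringfrac 1 s * ringfrac a (denom1 p) :> loc_ring p.
  by rewrite loc_ring_scaleE; apply: ringfrac_eq; rewrite /= mulr1 !mul1r.
by rewrite prime_idealrM; apply/orP; right.
Qed.

Lemma loc_dim_ge1 (q : prime_idealr A) : psub q p -> krull_dim_ge (loc_ring p) 1.
Proof.
move=> [qp nqp]; have [Q QE] := loc_prime qp.
have [P PE] := loc_prime (fun x (xp : x \in (p : {pred A})) => xp).
exists (fun i => if i is 0%N then Q else P) => -[|//] _; split.
  by move=> x; have [a [s ->]] := loc_ringP x; rewrite QE PE; apply: qp.
by move=> H; apply: nqp => x xp; have := H (ringfrac x (denom1 p)); rewrite QE PE; apply.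
Qed.

Lemma loc_dim_chain n : krull_dim_ge (loc_ring p) n -> exists Q : nat -> prime_idealr A,
  (forall i, {subset (Q i : {pred A}) <= (p : {pred A})}) /\
  forall i, (i < n)%N -> psub (Q i) (Q i.+1).
Proof.
move=> [P Pstep]; have [Q QE] := choice (fun i => contract_prime (P i)).
exists Q; split=> [i|i il]; first by case: (QE i).
have [_ E1] := QE i; have [_ E2] := QE i.+1; have [S nS] := Pstep i il.
split; first by move=> x; rewrite -(E1 _ (denom1 p)) -(E2 _ (denom1 p)); apply: S.
move=> H; apply: nS => x; have [a [s ->]] := loc_ringP x.
by rewrite E1 E2; apply: H.
Qed.

End LocalPrimes.

(* An associated prime p of M containing t is not minimal, so that M_p has depth at
   least one, which is absurd. *)
Lemma CM_treg (A : comNzRingType) (t : A) (V : lmodType A) :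
  noethmod (A^o : lmodType A) -> treg (A^o : lmodType A) t -> CM V -> treg V t.
Proof.
move=> nA rt [fV CMV] x0 tx0; apply: contrapT => nx0.
pose ann (y : V) (a : A^o) := (a : A) *: y = 0.
have sann y : subm (ann y).
  split; first exact: scale0r.
  by move=> c a b; rewrite /ann => a0 b0; rewrite scalerDl -scalerA a0 b0 scaler0 addr0.
(* Among the annihilators of nonzero elements killed by [t], a maximal one is prime; it contains
   [t]. *)
pose F N := exists y, [/\ y <> 0, t *: y = 0 & N = ann y].
have [||_ [[y [ny ty ->]] ymax]] := @acc A A^o F nA.
- by exists (ann x0), x0.
- by move=> _ [y [_ _ ->]].
have [||p pE] := primeP (sann y).
- by rewrite /ann scale1r.
- move=> a b; rewrite /ann => aby; have [by0|nby] := EM (b *: y = 0); [by right | left].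
  apply: (ymax (ann (b *: y))).
  + by exists (b *: y); rewrite scalerA mulrC -scalerA ty scaler0.
  + by move=> c cy; rewrite /ann scalerA mulrC -scalerA cy scaler0.
  + by rewrite /ann scalerA.
have [q [qp _]] := prime_below nA rt ((pE t).2 ty).
have [all0|[s [size_s sm [_ sreg]]]] := CMV p 1%N (loc_dim_ge1 qp).
  have := all0 (frac y (denom1 p)); move=> /fracP [u].
  rewrite scaler0 /= mulr1 => uy; have := (pE (dval u)).2 uy.
  by rewrite (negbTE (valP u)).
case: s size_s sm sreg => [|s [|//]] // _ sm sreg.
have /asboolP [a [u [/pE ay sE]]] := sm s (mem_head _ _).
have : seq_image (take 0 [:: s]) (frac y (denom1 p)).
  apply: (sreg 0%N) => //=; exists (fun=> 0); rewrite big_ord0 sE.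
  rewrite -[LHS]/(loc_scale _ _) loc_scaleE ay.
  by apply: frac_eq; rewrite !scaler0.
move=> [z]; rewrite /= big_ord0 => /fracP [v].
rewrite scaler0 /= mulr1 => vy; have := (pE (dval v)).2 vy.
by rewrite (negbTE (valP v)).
Qed.

(** By [nochain], heights are at most one. A prime of height one contains [t], and [t] alone is then
    a regular sequence on V_p: if V_p = t V_p, Nakayama gives V_p = 0. *)
Lemma treg_CM (A : comNzRingType) (t : A) (V : lmodType A) :
  (forall p q : prime_idealr A, psub q p -> t \in (p : {pred A})) ->
  (forall p q r : prime_idealr A, psub p q -> ~ psub q r) ->
  fin_gen V -> treg V t -> CM V.
Proof.
move=> tprime nochain fV rV; split=> // p n /loc_dim_chain [Q [Qp Qstep]].
have n1 : (n <= 1)%N.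
  rewrite leqNgt; apply/negP => n2.
  by apply: (nochain _ _ _ (Qstep 0%N (ltnW n2)) (Qstep 1%N n2)).
case: (EM (forall x : loc p V, x = 0)) => [|n0]; [by left | right].
case: n n1 Qstep => [|[|//]] _ Qstep.
  exists [::]; split=> //; split=> //.
  apply: contrapT => none; apply: n0 => x; apply: contrapT => nx; apply: none.
  by exists x => -[z]; rewrite big_ord0.
have tp : t \in (p : {pred A}) by apply: (Qp 1%N); apply: (tprime _ (Q 0%N)); apply: Qstep.
pose t1 : loc_ring p := ringfrac t (denom1 p).
exists [:: t1]; split=> //.
  move=> x; rewrite inE => /eqP->; apply/asboolP.
  by exists t, (denom1 p).
have sE (a : A) s (x : V) u : (ringfrac a s : loc_ring p) *: frac x u = frac (a *: x) (denomM s u).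
  exact: loc_scaleE.
split; last first.
  move=> i; case: i => [|i] // _ x /= [z]; rewrite big_ord0; have [y [s ->]] := locP x.
  rewrite sE => /fracP [u]; rewrite scaler0 scalerA /= mulr1 mulrC -scalerA => /rV uy.
  exists (fun=> 0); rewrite big_ord0; apply/fracP; exists u.
  by rewrite scaler0 /= mulr1.
apply: contrapT => none; apply: n0.
have [k [v vgen]] := fV.
have t1all (x : loc p V) : exists y, x = t1 *: y.
  apply: contrapT => nx; apply: none; exists x => -[z]; rewrite big_ord1 => xE.
  by apply: nx; exists (z 0).
pose w i := frac (v i) (denom1 p).
have wgen (x : loc p V) : exists c : 'I_k -> loc_ring p, x = \sum_i c i *: w i.
  have [y [s ->]] := locP x; have [c ->] := vgen y.
  exists (fun i => ringfrac (c i) s).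
  have -> : frac (\sum_i c i *: v i) s = \sum_i frac (c i *: v i) s.
    elim/big_rec2: _ => [|i y1 y2 _ <-]; first by apply: frac_eq; rewrite !scaler0.
    by rewrite fracD; apply: frac_eq; rewrite -scalerDr scalerA.
  apply: eq_bigr => i _; rewrite sE; apply: frac_eq => /=.
  by rewrite mulr1.
suff w0 i : w i = 0 by move=> x; have [c ->] := wgen x; rewrite big1 // => i _; rewrite w0 scaler0.
move: i; apply: (nakayama (J := @tmul _ (loc_ring p)^o t1) (N := fun x => x = 0)).
- exact: tmul_subm.
- move=> _ [y ->]; have [a [s ->]] := loc_ringP y.
  have up : dval s - t * a \notin (p : {pred A}).
    apply/negP => H; have := valP s; rewrite -[val s]/(dval s) -(subrK (t * a) (dval s)).
    by rewrite rpredD // prime_idealrM tp.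
  exists (ringfrac (dval s) (Denom up)).
  have -> : 1 - t1 *: (ringfrac a s : (loc_ring p)^o) = ringfrac (dval s - t * a) s.
    apply/eqP; rewrite subr_eq; apply/eqP.
    rewrite -[t1 *: _]/(t1 * ringfrac a s) loc_ring_scaleE ringfracD.
    rewrite -[LHS](ringfrac1 (denom1 p)); apply: ringfrac_eq => /=.
    by ring.
  rewrite loc_ring_scaleE -[RHS](ringfrac1 (denom1 p)); apply: ringfrac_eq => /=.
  by ring.
- by split=> // a x y -> ->; rewrite scaler0 addr0.
move=> i; have [y yE] := t1all (w i); have [c cE] := wgen y.
exists (fun j => t1 * c j); split; first by move=> j; exists (c j).
rewrite yE cE scaler_sumr; apply/eqP; rewrite subr_eq0; apply/eqP.
by apply: eq_bigr => j _; rewrite scalerA.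
Qed.

(** * One-dimensional local rings *)

Section LocalRing.
Variables (R : comNzRingType) (m : submodClosed R^o).
Hypotheses (nR : noethmod (R^o : lmodType R)) (locR : local_ring m).

Let M (x : R^o) : Prop := x \in m.

Lemma local_not1 : ~ M 1.
Proof. by apply/negP; case: locR => -[]. Qed.

Lemma local_unit (a : R) : ~ M a -> exists b, b * a = 1.
Proof.
move=> nMa; apply: contrapT => nu.
pose N (x : R^o) := exists b : R, x = b * a.
have sN : subm N.
  split; first by exists 0; rewrite mul0r.
  by move=> c x y [b ->] [b' ->]; exists (c * b + b'); rewrite mulrDl -mulrA.
have [||N' [[sN' NN' N'1] Nmax]] :=
    @acc R R^o (fun N' => [/\ subm N', forall x, N x -> N' x & ~ N' 1]) nR.
- by exists N; split=> // -[b bE]; apply: nu; exists b.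
- by move=> N' [].
have [J JE] := submodP sN'.
have maxJ : maximal_ideal J.
  split; first by apply/negP => /JE.
  move=> I JI I1 x xI; apply/JE; apply: (Nmax (fun x => x \in I)) xI.
    split; [exact: (subm_of I) | by move=> y /NN' /JE /JI | exact/negP].
  by move=> y /JE /JI.
apply: nMa; rewrite /M -(locR.2 _ maxJ); apply/JE/NN'.
by exists 1; rewrite mul1r.
Qed.

Lemma local_prime : exists p : prime_idealr R, forall x, x \in (p : {pred R}) <-> M x.
Proof.
apply: (primeP (subm_of m)); first exact: local_not1.
move=> a b abm; have [Ma|/local_unit [u uE]] := EM (M a); [by left | right].
have -> : b = u * (a * b) by rewrite mulrA uE mul1r.
exact: (subm_mull u (subm_of m)).
Qed.

Lemma prime_local (p : prime_idealr R) x : x \in (p : {pred R}) -> M x.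
Proof.
move=> xp; apply: contrapT => /local_unit [b bE].
have := idealr1 p; rewrite -bE prime_idealrM => /negbT; rewrite negb_or.
by move=> /andP[_]; rewrite xp.
Qed.

Hypothesis dimR : krull_dim R 1.

Lemma dim1_chain (p q r : prime_idealr R) : psub p q -> ~ psub q r.
Proof.
move=> pq qr; apply: dimR.2.
by exists (fun i => if i is i'.+1 then if i' is 0%N then q else r else p) => -[|[|//]] _.
Qed.

Lemma dim1_prime (t : R) (p q : prime_idealr R) : M t -> psub q p -> t \in (p : {pred R}).
Proof.
move=> Mt qp; apply: contrapT => /negP tp; have [pm pmE] := local_prime.
apply: (dim1_chain qp (r := pm)); apply: psubE tp; last exact/pmE.
by move=> x /prime_local /pmE.
Qed.

(** [R] has depth at least one at [m]. Elements outside [m] are units, so [R] embeds in its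
    localization and the numerator of the regular element serves. *)
Lemma local_regular : CM_ring R -> exists t, M t /\ treg (R^o : lmodType R) t.
Proof.
move=> CMR; have [pm pmE] := local_prime; have [P Pstep] := dimR.1.
have [P01 nP10] := Pstep 0%N isT.
have P0m : psub (P 0%N) pm.
  split; first by move=> x /prime_local /pmE.
  by move=> H; apply: nP10 => x /prime_local /pmE /H.
have fracu (x : R^o) : frac x (denom1 pm) = 0 -> x = 0.
  move=> /fracP [u]; rewrite scaler0 /= mulr1 => ux.
  have /local_unit [b bE] : ~ M (dval u) by move=> /pmE; apply/negP/(valP u).
  by rewrite -[x]scale1r -bE -scalerA ux scaler0.
have [all0|[s [size_s sm [_ sreg]]]] := CMR.2 pm 1%N (loc_dim_ge1 P0m).
  by have /fracu/eqP := all0 (frac 1 (denom1 pm)); rewrite oner_eq0.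
case: s size_s sm sreg => [|s [|//]] // _ sm sreg.
have /asboolP [t [u [/pmE Mt sE]]] := sm s (mem_head _ _).
exists t; split=> // x tx; apply: fracu.
have : seq_image (take 0 [:: s]) (frac x (denom1 pm)).
  apply: (sreg 0%N) => //=; exists (fun=> 0); rewrite big_ord0 sE.
  rewrite -[LHS]/(loc_scale _ _) loc_scaleE tx.
  by apply: frac_eq; rewrite !scaler0.
by move=> [z]; rewrite /= big_ord0.
Qed.

(** Otherwise some prime contains [t] but not [b]. It is strictly below [m] and, by [prime_below],
    strictly above another prime, against dimension one. *)
Lemma local_radical (t b : R) : M t -> treg (R^o : lmodType R) t -> M b ->
  exists k c, b ^+ k = t * c.
Proof.
move=> Mt rt Mb; apply: contrapT => none; have [pm pmE] := local_prime.
have [||||p [tp bp]] := @prime_avoid R (tmul t) (fun x => exists k, x = b ^+ k) nR.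
- exact: (@tmul_subm R R^o).
- by exists 0%N.
- by move=> _ _ [k ->] [l ->]; exists (k + l)%N; rewrite exprD.
- by move=> _ [k ->] [c E]; apply: none; exists k, c.
have [|q [qp _]] := @prime_below R p t nR rt.
  by apply: tp; exists 1; rewrite -[RHS]/(t * 1) mulr1.
apply: (dim1_chain qp (r := pm)).
apply: (@psubE _ _ _ b); [by move=> x /prime_local /pmE | exact/pmE | ].
by apply: bp; exists 1%N.
Qed.

End LocalRing.

Section AlmostGorenstein.
Variables (R : comNzRingType) (m : submodClosed R^o).
Let M (x : R^o) : Prop := x \in m.

(** The condition on [colon M a] says that the fractions th / a act on [V]; it stands for an
    E-module structure without mentioning [E]. *)
Lemma almost_gorenstein_sep : noethmod (R^o : lmodType R) -> local_ring m ->
  CM_ring R -> krull_dim R 1 -> almost_gorenstein m ->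
  exists a : R, [/\ M a, treg (R^o : lmodType R) a &
    forall (V : lmodType R) (x : V), fin_gen V -> treg V a ->
      (forall th, colon M a th -> forall z : V, tmul a ((th : R) *: z)) ->
      ~ tmul a x -> exists f : {linear V -> R^o}, ~ tmul a (f x)].
Proof.
move=> nR locR CMR dimR [I [e0 [e1 [r [canI [n0 hilb] type_r e1r]]]]].
have [I1 [C [[CMC dC _] [psi psi_bij]]]] := canI.
have M1 := local_not1 locR; have unitM := local_unit nR locR.
have sM := subm_of m; have sI := subm_of I.
have [t [Mt rt]] := local_regular nR locR dimR CMR.
have IM x : x \in I -> M x.
  move=> xI; apply: contrapT => /unitM [b bE]; move/negP: I1; apply.
  by rewrite -bE; apply: (subm_mull b sI xI).
(* [hilb] concerns I^(n+1) for n >= n0, hence the strict bound on the exponent here; [0] is a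
   default below it. *)
have ex_l n : exists l, (n0 < n)%N -> has_length (quotmod (ideal_pow I n)) l /\
    l%:Z = e0 * n%:Z - e1.
  case: n => [|n]; first by exists 0%N.
  have [/hilb [l lE]|] := leqP n0 n; first by exists l.
  by move=> nn0; exists 0%N; rewrite ltnS leqNgt nn0.
have [l lE] := choice ex_l.
have lens n : (n0 < n)%N -> [/\ lenge (l n) (fun x => x \in ideal_pow I n) (fun=> True),
    lenle (l n) (fun x => x \in ideal_pow I n) (fun=> True) & (l n)%:Z = e0 * n%:Z - e1].
  by move=> /lE [/(@has_length_lenge R R^o (ideal_pow I n))[? ?] ?].
(* Consecutive values of the Hilbert polynomial differ by [e0]. *)
have bnd n : (n0.+1 <= n)%N ->
    lenle `|e0|%N (fun x => x \in ideal_pow I n.+1) (fun x => x \in ideal_pow I n).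
  move=> nn0 k lk; have [lg _ E1] := lens n nn0.
  have [_ ll E2] := lens n.+1 (leqW nn0).
  have := ll _ (lenge_cat lk lg).
  by move: E1 E2; rewrite -addn1 PoszD mulrDr mulr1; lia.
(* The bound n0 + 3 ensures both n0 < d and 1 < d. *)
have [d [a [n1 [Dd ad red1]]]] := reduction nR sM M1 unitM IM bnd (n0 + 3).
pose n := (n1 + n0.+1)%N.
have red x : x \in ideal_pow I (n + d) -> exists y, y \in ideal_pow I n /\ x = a * y.
  rewrite /n addnAC; move: x; apply: ideal_powM_ind.
    split; first by exists 0; rewrite mulr0; split=> //; apply: rpred0.
    move=> c x y [x' [xn ->]] [y' [yn ->]]; exists (c * x' + y'); split.
      exact: (ideal_pow_subm I _).2.
    by rewrite -[LHS]/(c * (a * x') + a * y'); ring.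
  move=> x y /red1 [x' [xn ->]] yn; exists (x' * y); split; first exact: ideal_powM.
  by rewrite mulrA.
have aI : (a : R^o) \in I.
  by apply: ideal_pow1E; apply: ideal_pow_sub ad; lia.
have Ma := IM _ aI.
(* A power of the nonzerodivisor [t] lies in I^(n+d), hence in a R, so [a] is a nonzerodivisor
   too. *)
have ra : treg (R^o : lmodType R) a.
  have [|hl _] := lE (n + d)%N; first by rewrite /n; lia.
  have jt b : exists c, c * (1 - b * t) = 1.
    by apply: (jacM sM M1 unitM); apply: (subm_mull b sM Mt).
  have /red [y [_ tE]] := @has_length_ann R R^o _ _ t jt hl 1.
  move=> x ax; have : t ^+ l (n + d)%N *: x = 0.
    have E : t ^+ l (n + d)%N = a * y by rewrite -tE [RHS]mulr1.
    by rewrite E mulrC -scalerA ax scaler0.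
  elim: (l _) => [|k IH]; first by rewrite expr0 scale1r.
  by rewrite exprS -scalerA => /rt /IH.
have rada := local_radical nR locR dimR Ma ra.
have psiI x y : psi x = psi y -> x = y by apply: (bij_inj psi_bij).
have psiS c : exists x, psi x = c by case: psi_bij => g _ gK; exists (g c).
have rC : treg C a.
  move=> c; have [x <-] := psiS c; rewrite -linearZ_LR -(linear0 psi) => /psiI ax.
  have -> : x = 0; last by rewrite linear0.
  apply: val_inj; apply: ra; rewrite -[LHS]/(val (a *: x)) ax.
  by [].
(* As [I] is proper, [a] is not in a I; this provides the point outside a W for [separation]. *)
have nC : ~ tmul a (psi (Submod aI)).
  move=> [c]; have [x <-] := psiS c; rewrite -linearZ_LR => /psiI /(congr1 val) E.
  move/negP: I1; apply; have -> : 1 = val x; last exact: (valP x).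
  by apply: (tregI ra); rewrite -[RHS]E -[LHS]/(a * 1) mulr1.
have sepI (V : lmodType R) (x : V) : fin_gen V -> treg V a -> ~ tmul a x ->
    exists f : {linear V -> R^o},
    (forall z, f z \in I) /\ forall y : R, (y : R^o) \in I -> f x <> a * y.
  move=> fV rV nx.
  have [f fx] := separation nR sM M1 unitM Ma ra rada CMC.1 dC rC nC fV rV nx.
  have [h hE] := choice (fun z => psiS (f z)).
  have [|F FE] := @linear_exists R V R^o (fun z => val (h z)).
    move=> c z1 z2; rewrite -(linearP (val : submod I -> R^o)); congr val; apply: psiI.
    by rewrite linearP !hE linearP.
  exists F; split=> [z|y yI E]; first by rewrite FE; apply: valP.
  apply: fx; exists (psi (Submod yI)); rewrite -linearZ_LR -hE; congr (psi _).
  by apply: val_inj; rewrite -FE E.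
have d2 : (1 < d)%N by lia.
exists a; split=> // V x fV rV cV nx.
apply: (sep_colon nR sM Ma ra d2 ad sepI _ fV rV cV nx).
have [|npr] := EM (principal_ideal I); [by left | right].
apply: (colon_eq_pow nR sM unitM ra d2 ad sepI npr lens _ _ e1r red); try by rewrite /n; lia.
exact: CM_type_lenge.
Qed.

End AlmostGorenstein.

(** * Direct summands and syzygies *)

Section AddClosure.
Variable A : comNzRingType.
Implicit Types M N L : lmodType A.

(** Components of the inclusion and projection of a summand of M^n. No complement is named, so the
    data carry over when the base ring changes. *)
Definition retract M N : Prop :=
  exists n (i : 'I_n -> {linear N -> M}) (p : 'I_n -> {linear M -> N}),
    forall x, x = \sum_j p j (i j x).

Lemma add_closureP M N : add_closure M N <-> retract M N.
Proof.
split=> [[n [L [f [g fK gK]]]]|[n [i [p ip]]]].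
  have g_lin : linear g.
    by move=> c x y; rewrite -[RHS]fK linearP !gK.
  have [|i iE] := choice (fun j => @linear_exists A N M (fun x => f (x, 0) j) _).
    move=> j c x y; have -> : (c *: x + y, 0) = c *: (x, 0) + (y, 0) :> (N * L)%type.
      by congr pair; rewrite /= scaler0 addr0.
    by rewrite linearP !ffunE.
  pose single j (y : M) : {ffun 'I_n -> M} := [ffun k => if k == j then y else 0].
  have [|p pE] := choice (fun j => @linear_exists A M N (fun y => (g (single j y)).1) _).
    move=> j c x y; have -> : single j (c *: x + y) = c *: single j x + single j y.
      apply/ffunP => k; rewrite !ffunE; case: eqP => //.
      by rewrite scaler0 addr0.
    by rewrite g_lin.
  exists n, i, p => x.
  have E : f (x, 0) = \sum_j single j (f (x, 0) j).
    apply/ffunP => k; rewrite sum_ffunE (bigD1 k) //= ffunE eqxx big1 ?addr0 //.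
    by move=> j /negbTE jk; rewrite ffunE eq_sym jk.
  have -> : x = (g (f (x, 0))).1 by rewrite fK.
  have [g' g'E] := linear_exists g_lin.
  rewrite {1}E -g'E linear_sum.
  have -> : (\sum_j g' (single j (f (x, 0) j))).1 = \sum_j (g' (single j (f (x, 0) j))).1.
    by elim/big_rec2: _ => //= j y1 y2 _ ->.
  by apply: eq_bigr => j _; rewrite pE iE g'E fK.
have [|io ioE] := @linear_exists A N {ffun 'I_n -> M} (fun x => [ffun j => i j x]).
  by move=> c x y; apply/ffunP => j; rewrite !ffunE linearP.
have [|pi piE] := @linear_exists A {ffun 'I_n -> M} N (fun y => \sum_j p j (y j)).
  move=> c x y; rewrite scaler_sumr -big_split; apply: eq_bigr => j _ /=.
  by rewrite !ffunE linearP.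
have piK x : pi (io x) = x.
  by rewrite piE [RHS]ip; apply: eq_bigr => j _; rewrite ioE ffunE.
have [|K KE] := @submodP A _ (fun y => pi y = 0).
  by split=> [|c x y px py]; rewrite ?linear0 // linearP px py scaler0 addr0.
have Kin y : y - io (pi y) \in K by apply/KE; rewrite linearB /= piK subrr.
exists n, (submod K).
have [|F FE] := @linear_exists A (N * submod K)%type {ffun 'I_n -> M} (fun z => io z.1 + val z.2).
  move=> c z1 z2.
  have -> : val (c *: z1 + z2).2 = c *: val z1.2 + val z2.2.
    exact: (linearP (val : submod K -> {ffun 'I_n -> M})).
  by rewrite /= linearP scalerDr addrACA.
exists F; exists (fun y => (pi y, Submod (Kin y))) => [[x k]|y]; last first.
  by rewrite FE /= addrC subrK.
have pk : pi (val k) = 0 by apply/KE; apply: valP.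
have E : pi (F (x, k)) = x by rewrite FE linearD /= piK pk addr0.
by congr pair => //; apply: val_inj; rewrite /= E FE /= addrC addKr.
Qed.

Lemma retract_fin_gen M N : fin_gen M -> retract M N -> fin_gen N.
Proof.
move=> [k [v vgen]] [n [i [p ip]]].
apply: (@fin_gen_fin _ _ ('I_n * 'I_k)%type (fun jl => p jl.1 (v jl.2))) => x.
have [c cE] := choice (fun j => vgen (i j x)).
exists (fun jl => c jl.1 jl.2); rewrite {1}[x]ip.
rewrite -(pair_bigA _ (fun j l => c j l *: p j (v l))).
apply: eq_bigr => j _; rewrite [i j x]cE linear_sum.
by apply: eq_bigr => l _; rewrite linearZ_LR.
Qed.

Lemma retract_treg M N t : treg M t -> retract M N -> treg N t.
Proof.
move=> rM [n [i [p ip]]] x tx; rewrite [x]ip big1 // => j _.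
by rewrite [i j x]rM ?linear0 // -linearZ_LR tx linear0.
Qed.

(** Unlike being a syzygy, this condition visibly passes to direct summands. *)
Definition separated M t : Prop :=
  forall x : M, ~ tmul t x -> exists f : {linear M -> A^o}, ~ tmul t (f x).

Lemma linear_comp_exists (L M N : lmodType A) (g : {linear M -> N}) (f : {linear L -> M}) :
  exists h : {linear L -> N}, forall x, h x = g (f x).
Proof. by apply: linear_exists => c x y; rewrite !linearP. Qed.

Lemma retract_separated M N t : separated M t -> retract M N -> separated N t.
Proof.
move=> sM [n [i [p ip]]] x nx.
have [j nj] : exists j, ~ tmul t (i j x).
  apply: contrapT => none; apply: nx.
  have ex_y j : exists y, i j x = t *: y.
    by apply: contrapT => nj; apply: none; exists j.
  have [y yE] := choice ex_y.
  exists (\sum_j p j (y j)); rewrite [LHS]ip scaler_sumr.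
  by apply: eq_bigr => j _; rewrite yE linearZ_LR.
have [f nf] := sM _ nj; have [h hE] := linear_comp_exists f (i j).
by exists h; rewrite hE.
Qed.

End AddClosure.

Section Syzygies.
Variables (A : comNzRingType) (M : A^o -> Prop) (t : A).
Hypotheses (nA : noethmod (A^o : lmodType A)) (sM : subm M) (M1 : ~ M 1).
Hypothesis unitM : forall a : A, ~ M a -> exists b, b * a = 1.
Hypotheses (Mt : M t) (rt : treg (A^o : lmodType A) t).
Hypothesis CM_iff : forall V : lmodType A, CM V <-> fin_gen V /\ treg V t.

(** For a syzygy, the coordinates of the embedding separate points because [t] is regular on the
    cokernel. Conversely, generators of the module of functionals together embed [N], and separation
    makes [t] regular on the cokernel. *)
Lemma OmegaCM_iff (N : lmodType A) :
  OmegaCM N <-> [/\ fin_gen N, treg N t & separated N t].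
Proof.
split=> [[fN [n [C [f [g [[finj exact gsurj] /CM_iff [_ rC]]]]]]]|[fN rN sN]].
  have rF (y : {ffun 'I_n -> A^o}) : t *: y = 0 -> y = 0.
    move=> ty; apply/ffunP => i; rewrite ffunE; apply: rt.
    by have := congr1 (fun z : {ffun 'I_n -> A^o} => z i) ty; rewrite !ffunE.
  split=> // [x tx|x nx].
    by apply: finj; rewrite linear0; apply: rF; rewrite -linearZ_LR tx linear0.
  have [i ni] : exists i, ~ tmul t (f x i).
    apply: contrapT => none; apply: nx.
    have ex_y i : exists y, f x i = t *: y.
      by apply: contrapT => ni; apply: none; exists i.
    have [y yE] := choice ex_y.
    have fxE : f x = t *: [ffun i => y i] by apply/ffunP => i; rewrite !ffunE.
    have /exact [x' x'E] : g [ffun i => y i] = 0.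
      by apply: rC; rewrite -linearZ_LR -fxE; apply/exact; exists x.
    by exists x'; apply: finj; rewrite linearZ_LR /= x'E.
  have [|h hE] := @linear_exists A N A^o (fun x => f x i).
    by move=> c x1 x2; rewrite linearP !ffunE.
  by exists h; rewrite hE.
split=> //; have [k [v vgen]] := fN.
(* Functionals are recorded by their values at the generators, as a submodule of A^k, which is
   finitely generated. *)
pose H (y : {ffun 'I_k -> A^o}) := exists h : {linear N -> A^o}, forall i, y i = h (v i).
have sH : subm H.
  split.
    have [|h hE] := @linear_exists A N A^o (fun=> 0).
      by move=> c x y; rewrite scaler0 addr0.
    by exists h => i; rewrite hE ffunE.
  move=> c y1 y2 [h1 E1] [h2 E2].
  have [|h hE] := @linear_exists A N A^o (fun x => c *: h1 x + h2 x).
    move=> d x x'; have -> : h1 (d *: x + x') = d * h1 x + h1 x' by exact: linearP.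
    have -> : h2 (d *: x + x') = d * h2 x + h2 x' by exact: linearP.
    rewrite -[LHS]/(c * (d * h1 x + h1 x') + (d * h2 x + h2 x')).
    by rewrite -[RHS]/(d * (c * h1 x + h2 x) + (c * h1 x' + h2 x')); ring.
  by exists h => i; rewrite hE !ffunE E1 E2.
have [n [y [Hy ygen]]] := fg_noeth nA (fin_gen_ffun k (fin_gen_self A)) sH.
have [h hE] := choice Hy.
have hgen (f : {linear N -> A^o}) : exists c : 'I_n -> A, forall x, f x = \sum_j c j * h j x.
  have [|c cE] := ygen [ffun i => f (v i)]; first by exists f => i; rewrite ffunE.
  exists c => x; have [d ->] := vgen x; rewrite linear_sum.
  under [RHS]eq_bigr => j _ do rewrite linear_sum mulr_sumr.
  rewrite exchange_big; apply: eq_bigr => i _; rewrite linearZ_LR /=.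
  have -> : f (v i) = \sum_j c j * h j (v i).
    have := congr1 (fun z : {ffun 'I_k -> A^o} => z i) cE; rewrite ffunE sum_ffunE => ->.
    by apply: eq_bigr => j _; rewrite ffunE hE.
  rewrite -[LHS]/(d i * _) mulr_sumr; apply: eq_bigr => j _; rewrite linearZ_LR.
  exact: mulrCA.
have hdiv x : (forall j, tmul t (h j x)) -> tmul t x.
  move=> hx; apply: contrapT => nx; have [f nf] := sN x nx; apply: nf.
  have [c ->] := hgen f; apply: (subm_sum (@tmul_subm A A^o t)) => j _.
  exact: (subm_mull _ (@tmul_subm A A^o t)).
have [|F FE] := @linear_exists A N {ffun 'I_n -> A^o} (fun x => [ffun j => h j x]).
  by move=> c x x'; apply/ffunP => j; rewrite !ffunE linearP.
(* By separation an element of the kernel is [t] times an element of the kernel, which is therefore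
   zero by Nakayama. *)
have F0 x : F x = 0 -> x = 0.
  pose K x := F x = 0.
  have sK : subm K by split=> [|c x1 x2 K1 K2]; rewrite /K ?linear0 // linearP K1 K2 scaler0 addr0.
  have [l [w [Kw wgen]]] := fg_noeth nA fN sK.
  have Kt x1 : K x1 -> exists x2, K x2 /\ x1 = t *: x2.
    move=> Kx1; have hx0 j : h j x1 = 0.
      by have := congr1 (fun z : {ffun 'I_n -> A^o} => z j) Kx1; rewrite FE !ffunE.
    have [|x2 x2E] := hdiv x1; first by move=> j; exists 0; rewrite hx0 scaler0.
    exists x2; split=> //; rewrite /K FE; apply/ffunP => j; rewrite !ffunE.
    by apply: rt; rewrite -linearZ_LR -x2E hx0.
  move=> /wgen [c ->]; rewrite big1 // => i _.
  suff -> : w i = 0 by rewrite scaler0.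
  move: i; apply: (nakayama (J := @tmul A A^o t) (N := fun x => x = 0)).
  - exact: tmul_subm.
  - move=> b [z ->]; apply: (jacM sM M1 unitM).
    by rewrite -[t *: z]/(t * (z : A)) mulrC; apply: (subm_mull z sM Mt).
  - by split=> // b x1 x2 -> ->; rewrite scaler0 addr0.
  move=> i; have [x2 [/wgen [e eE] wE]] := Kt _ (Kw i).
  exists (fun j => t * e j); split; first by move=> j; exists (e j).
  rewrite wE {1}eE scaler_sumr; apply/eqP; rewrite subr_eq0; apply/eqP.
  by apply: eq_bigr => j _; rewrite scalerA.
have [|B BE] := @submodP A {ffun 'I_n -> A^o} (fun y => exists x, F x = y).
  split; first by exists 0; rewrite linear0.
  by move=> c y1 y2 [x1 <-] [x2 <-]; exists (c *: x1 + x2); rewrite linearP.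
pose p (y : {ffun 'I_n -> A^o}) : quotmod B := \pi_(quotmod B) y.
have [|g gE] := @linear_exists A _ (quotmod B) p.
  by move=> c x x'; rewrite /p quotmod_piD -quotmod_scaleE.
have g0 y1 : g y1 = 0 <-> y1 \in B.
  have p0 : p 0 = 0 by rewrite -gE linear0.
  rewrite gE -{1}p0; split=> [/quotmod_piP|yB]; first by rewrite subr0.
  by apply/quotmod_piP; rewrite subr0.
have gsurj z : exists y1, g y1 = z by elim/quotW: z => y1; exists y1; rewrite gE.
exists n, (quotmod B), F, g; split.
  split=> // [x x' E|y1]; last by rewrite g0; apply: BE.
  by apply/eqP; rewrite -subr_eq0; apply/eqP/F0; rewrite linearB /= E subrr.
apply/CM_iff; split.
  exists n, (fun i => g (delta A i)) => z; have [c <-] := gsurj z.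
  exists c; rewrite {1}[c]ffun_delta linear_sum.
  by apply: eq_bigr => i _; rewrite linearZ_LR.
move=> z; have [y1 <-] := gsurj z; rewrite -linearZ_LR => /g0 /BE [x xE].
apply/g0/BE; have [j|x' x'E] := hdiv x.
  by exists (y1 j); have := congr1 (fun z : {ffun 'I_n -> A^o} => z j) xE; rewrite FE !ffunE.
exists x'; apply/ffunP => j; apply: (tregI rt).
have := congr1 (fun z : {ffun 'I_n -> A^o} => z j) xE.
by rewrite x'E linearZ_LR !ffunE.
Qed.

End Syzygies.

(** * Change of rings through ring actions *)

Record ring_action (B : pzRingType) (V : zmodType) := RingAction {
  act :> B -> V -> V;
  actA : forall a b x, act a (act b x) = act (a * b) x;
  act1 : left_id 1 act;
  actDr : right_distributive act +%R;
  actDl : forall x, {morph act^~ x : a b / a + b} }.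

Section ActionModule.
Variables (B : pzRingType) (V : zmodType) (al : ring_action B V).

(** The action is a phantom parameter, so that one group carries module structures over [R] and over
    [E] side by side. *)
Definition actmod (_ : ring_action B V) : Type := V.

HB.instance Definition _ := GRing.Zmodule.copy (actmod al) V.
HB.instance Definition _ := GRing.Zmodule_isLmodule.Build B (actmod al)
  (actA al) (act1 al) (actDr al) (actDl al).

Lemma actmod_scaleE (b : B) (x : actmod al) : b *: x = al b x.
Proof. by []. Qed.

End ActionModule.

(** * The endomorphism ring of the maximal ideal *)

Lemma noeth_inj (A : comNzRingType) (V W : lmodType A) (f : {linear V -> W}) :
  injective f -> noethmod W -> noethmod V.
Proof.
move=> finj nW N sN.
have [|n [w [wN wgen]]] := nW (fun y => exists x, N x /\ y = f x).
  split; first by exists 0; rewrite linear0; split=> //; case: sN.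
  move=> c _ _ [x [Nx ->]] [y [Ny ->]]; exists (c *: x + y); rewrite linearP.
  by split=> //; apply: sN.2.
have [v vE] := choice wN; exists n, v; split=> [i|x Nx]; first by case: (vE i).
have [|c cE] := wgen (f x); first by exists x.
exists c; apply: finj; rewrite cE linear_sum; apply: eq_bigr => i _.
by rewrite linearZ_LR; case: (vE i) => _ <-.
Qed.

Section ScalarEmbedding.
Variables (R : comNzRingType) (m : submodClosed R^o).
Variables (E : comNzRingType) (phi : {rmorphism E -> endo (submod m)}).
Hypothesis phi_bij : bijective phi.

Lemma endo_ext (f g : endo (submod m)) : (forall x, hom_fun f x = hom_fun g x) -> f = g.
Proof. by move=> fg; apply/val_inj/funext. Qed.

Lemma scalar_embedding : exists iota : {rmorphism R -> E},
  forall r x, hom_fun (phi (iota r)) x = r *: x.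
Proof.
have [sc scE] : exists sc : R -> endo (submod m), forall r x, hom_fun (sc r) x = r *: x.
  have H r : exists f : endo (submod m), forall x, hom_fun f x = r *: x.
    by apply: hom_exists => c x y; rewrite scalerDr !scalerA mulrC.
  by have [sc scE] := choice H; exists sc.
case: phi_bij => psi phiK psiK.
pose f r := psi (sc r).
have fE r x : hom_fun (phi (f r)) x = r *: x by rewrite /f psiK.
have fB : zmod_morphism f.
  move=> r s; apply: (bij_inj phi_bij); apply: endo_ext => x.
  rewrite fE rmorphB scalerBl -(fE r) -(fE s); exact: esym.
have fM : monoid_morphism f.
  split; first by apply: (bij_inj phi_bij); apply: endo_ext => x; rewrite fE rmorph1 scale1r.
  move=> r s; apply: (bij_inj phi_bij); apply: endo_ext => x.
  by rewrite fE rmorphM -scalerA -(fE s) -(fE r).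
pose iota : {rmorphism R -> E} := HB.pack f
  (GRing.isZmodMorphism.Build R E f fB) (GRing.isMonoidMorphism.Build R E f fM).
by exists iota.
Qed.

Variables (iota : {rmorphism R -> E}) (a : R).
Hypothesis iotaE : forall r x, hom_fun (phi (iota r)) x = r *: x.
Hypotheses (Ma : (a : R^o) \in m) (ra : treg (R^o : lmodType R) a).

Let M (x : R^o) : Prop := x \in m.
Let ev (e : E) (x : submod m) : R := submod_val (hom_fun (phi e) x).

(* The fraction theta e / a is the element of the total quotient ring of R by
   which e acts on m. *)
Definition theta (e : E) : R := ev e (Submod Ma).

Lemma ev_swap e (x y : submod m) :
  (submod_val x : R) * ev e y = (submod_val y : R) * ev e x.
Proof.
have vZ (b : R) z : ev e (b *: z) = b * ev e z.
  by rewrite /ev linearZ.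
rewrite -!vZ; congr (ev e _); apply: val_inj.
exact: (mulrC (submod_val x : R) (submod_val y)).
Qed.

Lemma thetaE e (x : submod m) : theta e * (submod_val x : R) = a * ev e x.
Proof. by rewrite (ev_swap e (Submod Ma) x) mulrC. Qed.

Lemma theta_colon e : colon M a (theta e).
Proof. by move=> b Mb; exists (ev e (Submod Mb)); rewrite -thetaE. Qed.

Lemma thetaM e e' : a * theta (e * e') = theta e * theta e'.
Proof.
rewrite /theta -[LHS]/(a * ev (e * e') _) {1}/ev rmorphM.
by rewrite -[LHS]/(a * ev e (hom_fun (phi e') _)) -thetaE.
Qed.

Lemma thetaD e e' : theta (e + e') = theta e + theta e'.
Proof. by rewrite /theta /ev rmorphD. Qed.

Lemma theta0 : theta 0 = 0.
Proof. by rewrite /theta /ev rmorph0. Qed.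

Lemma theta1 : theta 1 = a.
Proof. by rewrite /theta /ev rmorph1. Qed.

Lemma theta_iota r : theta (iota r) = r * a.
Proof. by rewrite /theta /ev iotaE. Qed.

Lemma theta_inj e : theta e = 0 -> e = 0.
Proof.
move=> e0; apply: (bij_inj phi_bij); rewrite rmorph0; apply: endo_ext => x.
apply: val_inj; apply: ra; rewrite -[LHS]/(a * ev e x) -thetaE e0.
exact: mul0r.
Qed.

(** Inside [E] too, [e] is the fraction theta(e) / a: this reduces E-linearity to R-linearity where
    [a] is regular. *)
Lemma iota_theta e : iota a * e = iota (theta e).
Proof.
apply: (bij_inj phi_bij); apply: endo_ext => x; rewrite iotaE rmorphM.
apply: val_inj; rewrite -[RHS]/(theta e * (submod_val x : R)) thetaE.
by rewrite -[LHS]/(submod_val (hom_fun (phi (iota a)) (hom_fun (phi e) x))) iotaE.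
Qed.

Lemma iota_treg : treg (E^o : lmodType E) (iota a).
Proof.
move=> e; rewrite -[LHS]/(iota a * e) iota_theta => th0; apply: theta_inj; apply: ra.
have := theta_iota (theta e); rewrite th0 => th0'.
by rewrite -[LHS]/(a * theta e) mulrC -th0' theta0.
Qed.

(* If theta / a does not map m into m then m is principal. *)
Lemma colon_theta (th : R) : noethmod (R^o : lmodType R) -> local_ring m ->
  krull_dim R 1 -> ~ regular_local m -> colon M a th -> exists e, th = theta e.
Proof.
move=> nR locR dimR nreg cth; have unitM := local_unit nR locR.
have [y yE] := choice (fun x : submod m => cth (submod_val x) (valP x)).
(* [y x] is (th / a) x. If it is a unit at [x0], every [x] is y(x) / y(x0) times [x0], so [m] is
   principal and [R] is regular. *)
have [My|] := EM (forall x, M (y x)); last first.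
  move=> nMy; exfalso; apply: nreg; exists 1%N; split=> //.
  have [x0 /unitM [u uE]] : exists x0, ~ M (y x0).
    apply: contrapT => none; apply: nMy => x; apply: contrapT => nx.
    by apply: none; exists x.
  exists (fun=> x0) => x; exists (fun=> u * y x); rewrite big_ord1; apply: val_inj.
  have rth z : th * z = 0 -> z = 0.
    move=> thz; apply: ra; rewrite -[LHS]/(a * z).
    have -> : a * z = u * (submod_val x0 : R) * (th * z).
      transitivity (u * (a * y x0) * z); first by rewrite mulrCA uE mulr1.
      by rewrite -yE; ring.
    by rewrite thz mulr0.
  apply/eqP; rewrite -subr_eq0; apply/eqP/rth.
  rewrite -[val (_ *: x0)]/(u * y x * (submod_val x0 : R)) mulrBr.
  rewrite yE mulrCA (yE x0) -{1}[y x]mulr1 -uE; ring.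
have lin : linear (fun x => Submod (My x)).
  move=> c x x'; apply: val_inj; apply: (tregI ra).
  rewrite -[LHS]/(a * y _) -yE -[RHS]/(a * (c * y x + y x')).
  rewrite -[submod_val _]/(c * (submod_val x : R) + (submod_val x' : R)).
  by rewrite !mulrDr mulrCA !yE; ring.
have [f fE] := hom_exists lin; case: phi_bij => psi _ psiK; exists (psi f).
apply: (tregI ra); rewrite -[LHS]/(a * th) mulrC -[RHS]/(a * ev _ _).
by rewrite /ev psiK fE /= -yE.
Qed.

Lemma restr_action_exists (X : lmodType E) :
  exists al : ring_action R X, forall r x, al r x = iota r *: x.
Proof.
unshelve eexists (@RingAction R X (fun r x => iota r *: x) _ _ _ _).
- by move=> r s x; rewrite /= scalerA rmorphM.
- by move=> x; rewrite /= rmorph1 scale1r.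
- by move=> r x y; rewrite /= scalerDr.
- by move=> x r s; rewrite /= rmorphD scalerDl.
by [].
Qed.

(** [e] acts by dividing [theta e *: x] by [a]; the module laws hold after multiplication by [a],
    which is regular on [N]. *)
Lemma ext_action_exists (N : lmodType R) : treg N a ->
  (forall e (x : N), tmul a (theta e *: x)) ->
  exists al : ring_action E N, forall e x, a *: al e x = theta e *: x.
Proof.
move=> rN H; have [f fE] := choice (fun ex : E * N => H ex.1 ex.2).
pose g e x := f (e, x); have gE e x : a *: g e x = theta e *: x by rewrite -fE.
unshelve eexists (@RingAction E N g _ _ _ _).
- move=> e e' x; apply: (tregI rN); apply: (tregI rN).
  by rewrite !gE scalerA mulrC -scalerA gE !scalerA thetaM.
- by move=> x; apply: (tregI rN); rewrite gE theta1.
- by move=> e x y; apply: (tregI rN); rewrite scalerDr !gE scalerDr.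
- by move=> x e e'; apply: (tregI rN); rewrite scalerDr !gE thetaD scalerDl.
by move=> e x; rewrite gE.
Qed.

(* E embeds in R by theta. *)
Lemma noeth_restr (al : ring_action R E) : (forall r x, al r x = iota r * x) ->
  noethmod (R^o : lmodType R) -> noethmod (actmod al : lmodType R).
Proof.
move=> alE nR N sN.
have th_lin : linear (fun x : actmod al => theta x : R^o).
  move=> c x y; rewrite thetaD actmod_scaleE alE; congr (_ + _); apply: (tregI ra).
  by rewrite -[LHS]/(a * _) thetaM theta_iota -[RHS]/(a * (c * theta x)); ring.
have [T TE] := linear_exists th_lin; apply: (noeth_inj (f := T)) => // x y /eqP.
by rewrite -subr_eq0 -linearB TE => /eqP /theta_inj /eqP; rewrite subr_eq0 => /eqP.
Qed.

End ScalarEmbedding.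

(** * Finite ring extensions and their primes *)

Section FiniteExtension.
Variables (R E : comNzRingType) (iota : {rmorphism R -> E}) (al : ring_action R E).
Hypothesis alE : forall r x, al r x = iota r * x.
Hypothesis nal : noethmod (actmod al : lmodType R).

Lemma actmod_sum n (c : 'I_n -> R) (v : 'I_n -> actmod al) :
  \sum_i c i *: v i = \sum_i iota (c i) * (v i : E) :> E.
Proof.
elim/big_rec2: _ => // i y1 y2 _ <-.
by rewrite -[LHS]/(al (c i) (v i) + _) alE.
Qed.

Lemma finite_noeth : noethmod (E^o : lmodType E).
Proof.
move=> N sN; have [|n [v [vN vgen]]] := nal (N := N).
  split; first by case: sN.
  move=> r x y Nx Ny; rewrite actmod_scaleE alE; exact: sN.2.
exists n, v; split=> // x /vgen [c cE]; exists (fun i => iota (c i)).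
by rewrite cE actmod_sum.
Qed.

Lemma fin_gen_restr (X : lmodType E) (be : ring_action R X) :
  (forall r x, be r x = iota r *: x) -> fin_gen X -> fin_gen (actmod be : lmodType R).
Proof.
move=> beE [k [v vgen]]; have [n [w wgen]] := noethmod_fin_gen nal.
apply: (@fin_gen_fin R (actmod be) ('I_k * 'I_n)%type
  (fun ij => (w ij.2 : E) *: v ij.1)) => x.
have [d dE] := vgen x; have [c cE] := choice (fun i => wgen (d i)).
exists (fun ij => c ij.1 ij.2).
rewrite -(pair_bigA _ (fun i j => c i j *: ((w j : E) *: v i : actmod be))) /=.
rewrite {1}dE; apply: eq_bigr => i _.
rewrite [d i]cE actmod_sum scaler_suml; apply: eq_bigr => j _.
by rewrite actmod_scaleE beE scalerA.
Qed.

(** The polynomials in [b] are a union of increasing R-submodules of [E]; this union is finitely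
    generated, so the powers below some [N] span it. *)
Lemma integral_power (b : E) : exists N (c : nat -> R),
  b ^+ N + \sum_(i < N) iota (c i) * b ^+ i = 0.
Proof.
pose S n (x : actmod al) := exists c : nat -> R, x = \sum_(i < n) iota (c i) * b ^+ i :> E.
have Sle n n' x : (n <= n')%N -> S n x -> S n' x.
  move=> /subnKC <- [c ->]; exists (fun i => if (i < n)%N then c i else 0).
  rewrite big_split_ord /= [X in _ = _ + X]big1 ?addr0 => [|i _].
    by apply: eq_bigr => i _; rewrite ltn_ord.
  by rewrite ltnNge leq_addr /= rmorph0 mul0r.
have sS n : subm (S n).
  split; first by exists (fun=> 0); rewrite big1 // => i _; rewrite rmorph0 mul0r.
  move=> r x y [c xE] [d yE]; exists (fun i => r * c i + d i).
  rewrite -[LHS]/(al r x + y) alE xE yE mulr_sumr -big_split.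
  by apply: eq_bigr => i _; rewrite /= rmorphD rmorphM; ring.
have sU : subm (fun x => exists n, S n x).
  split; first by exists 0%N; case: (sS 0%N).
  move=> r x y [n Sx] [n' Sy]; exists (maxn n n'); apply: (sS _).2.
    exact: Sle (leq_maxl _ _) Sx.
  exact: Sle (leq_maxr _ _) Sy.
have [k [w [wU wgen]]] := nal sU; have [n nP] := choice wU.
pose N := (\max_i n i)%N.
have [|c cE] := wgen (b ^+ N).
  exists N.+1, (fun i => (i == N)%:R); rewrite (bigD1 ord_max) //= eqxx rmorph1 mul1r.
  rewrite big1 ?addr0 // => i; rewrite -val_eqE /= => /negbTE->.
  by rewrite rmorph0 mul0r.
have [d dE] : S N (b ^+ N).
  rewrite [X in S N X]cE; apply: (subm_sum (sS N)) => i _; apply: (submZ (sS N)).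
  by apply: Sle (nP i); apply: (leq_bigmax i).
exists N, (fun i => - d i); rewrite {1}dE -big_split big1 // => i _.
by rewrite /= rmorphN mulNr subrr.
Qed.

Lemma contraction (p : prime_idealr E) : exists q : prime_idealr R,
  forall r, (r \in (q : {pred R})) = (iota r \in (p : {pred E})).
Proof.
have [|||q qE] := @primeP R (fun r => iota r \in (p : {pred E})).
- split; first by rewrite rmorph0 idealr0.
  move=> c x y xp yp; rewrite -[_ + _]/(c * x + y) rmorphD rmorphM rpredD //.
  by rewrite prime_idealrM xp orbT.
- by rewrite rmorph1 idealr1.
- by move=> x y; rewrite rmorphM prime_idealrM => /orP.
by exists q => r; apply/idP/idP => /qE.
Qed.

(** Take [b] in [p'] outside [p] and a monic equation for [b] modulo [p] of least degree. Its
    constant term lies in [p']; were it in [p], cancelling [b] would lower the degree. *)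
Lemma incomparable (p p' : prime_idealr E) (q q' : prime_idealr R) :
  (forall r, (r \in (q : {pred R})) = (iota r \in (p : {pred E}))) ->
  (forall r, (r \in (q' : {pred R})) = (iota r \in (p' : {pred E}))) ->
  psub p p' -> psub q q'.
Proof.
move=> qE q'E [pp' np'p].
have [b [bp' bp]] : exists b, b \in (p' : {pred E}) /\ b \notin (p : {pred E}).
  apply: contrapT => none; apply: np'p => b bp'; apply: contrapT => /negP bp.
  by apply: none; exists b.
have ex : exists N, `[< exists c : nat -> R,
    b ^+ N + \sum_(i < N) iota (c i) * b ^+ i \in (p : {pred E}) >].
  have [N [c cE]] := integral_power b; exists N; apply/asboolP; exists c.
  by rewrite cE idealr0.
have [N /asboolP [c cp] Nmin] := ex_minnP ex.
case: N cp Nmin => [|N] cp Nmin; first by rewrite big_ord0 addr0 idealr1 in cp.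
pose u := b ^+ N + \sum_(i < N) iota (c i.+1) * b ^+ i.
have cE : b ^+ N.+1 + \sum_(i < N.+1) iota (c i) * b ^+ i = iota (c 0%N) + b * u.
  rewrite big_ord_recl /= mulr1 mulrDr -exprS mulr_sumr addrCA; congr (_ + (_ + _)).
  by apply: eq_bigr => i _; rewrite /= exprS mulrCA.
rewrite cE in cp.
apply: (@psubE _ _ _ (c 0%N)).
- by move=> r; rewrite qE q'E; apply: pp'.
- rewrite q'E -(addrK (b * u) (iota (c 0%N))); apply: rpredB; first exact: pp'.
  by rewrite prime_idealrM bp'.
rewrite qE; apply/negP => c0p.
have : b * u \in (p : {pred E}).
  by rewrite -(addKr (iota (c 0%N)) (b * u)) addrC rpredB.
rewrite prime_idealrM (negbTE bp) /= => up.
suff : (N.+1 <= N)%N by rewrite ltnn.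
by apply: Nmin; apply/asboolP; exists (fun i => c i.+1).
Qed.

End FiniteExtension.

(** * Transfer of finite type *)

Theorem corollary1p4 (R : comNzRingType) (m : submodClosed R^o)
    (E : comNzRingType) (phi : {rmorphism E -> endo (submod m)}) :
  noetherian R ->
  local_ring m ->
  CM_ring R ->
  krull_dim R 1 ->
  ~ regular_local m ->
  generically_gorenstein R ->
  bijective phi ->
  almost_gorenstein m ->
  (finite_type (@OmegaCM R) <-> finite_type (@CM E)).
Proof.
move=> /noetherianP nR locR CMR dimR nreg _ phi_bij agR.
have [a [Ma ra sepE]] := almost_gorenstein_sep nR locR CMR dimR agR.
have M1 := local_not1 locR; have unitM := local_unit nR locR; have sM := subm_of m.
have [iota iotaE] := scalar_embedding phi_bij.
pose th := theta phi Ma.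
have th_iota := iota_theta phi_bij iotaE Ma.
have CM_R (V : lmodType R) : CM V <-> fin_gen V /\ treg V a.
  split=> [CMV|[fV rV]]; first by split; [case: CMV | apply: CM_treg].
  apply: treg_CM fV rV; last exact: (dim1_chain dimR).
  by move=> p q; apply: (dim1_prime nR locR dimR Ma).
have [alE alEE] := restr_action_exists iota (E^o : lmodType E).
have nE : noethmod (actmod alE : lmodType R).
  exact: (noeth_restr phi_bij iotaE Ma ra alEE nR).
have nEE := finite_noeth alEE nE.
have CM_E (X : lmodType E) : CM X <-> fin_gen X /\ treg X (iota a).
  split=> [CMX|[fX rX]].
    split; first by case: CMX.
    exact: (@CM_treg E (iota a) X nEE (iota_treg phi_bij iotaE Ma ra) CMX).
  apply: treg_CM fX rX.
    move=> p q qp; have [p' p'E] := contraction iota p; have [q' q'E] := contraction iota q.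
    rewrite -p'E; apply: (dim1_prime nR locR dimR Ma).
    exact: (incomparable alEE nE q'E p'E qp).
  move=> p q r pq qr; have [p' p'E] := contraction iota p.
  have [q' q'E] := contraction iota q; have [r' r'E] := contraction iota r.
  apply: (dim1_chain dimR (incomparable alEE nE p'E q'E pq)).
  exact: (incomparable alEE nE q'E r'E qr).
have OmR := OmegaCM_iff nR sM M1 unitM Ma ra CM_R.
have restr_Om (X : lmodType E) (be : ring_action R X) :
    (forall r x, be r x = iota r *: x) -> CM X -> OmegaCM (actmod be : lmodType R).
  move=> beE /CM_E [fX rX].
  have fX' := fin_gen_restr alEE nE beE fX.
  have rX' : treg (actmod be : lmodType R) a.
    by move=> x; rewrite actmod_scaleE beE => /rX.
  apply/OmR; split=> // x nx; apply: (sepE _ x fX' rX') => // t ct z.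
  have [e ->] := colon_theta phi_bij Ma ra nR locR dimR nreg ct.
  exists (e *: (z : X)); rewrite !actmod_scaleE !beE scalerA.
  by rewrite th_iota.
split=> [[Y [fY Yadd]]|[X0 [fX0 X0add]]].
  have /OmR [_ rY sY] : OmegaCM Y.
    apply/Yadd/add_closureP; exists 1%N.
    have [|f fE] := @linear_exists R Y Y id; first by [].
    by exists (fun=> f), (fun=> f) => x; rewrite big_ord1 !fE.
  (* The largest E-submodule of [Y], a copy of Hom_R(E, Y) by evaluation at 1: [y] belongs to it
     when each (theta e / a) y exists in [Y]. *)
  pose N (y : Y) := forall e, tmul a (th e *: y).
  have sN : subm N.
    split; first by move=> e; rewrite scaler0; case: (tmul_subm Y a).
    move=> c x y Nx Ny e; rewrite scalerDr scalerA mulrC -scalerA.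
    exact: (tmul_subm Y a).2.
  have [N' N'E] := submodP sN.
  have rN : treg (submod N' : lmodType R) a.
    by move=> z az; apply: val_inj; apply: rY; rewrite -[LHS]/(val (a *: z)) az.
  have HN e (z : submod N') : tmul a (th e *: z).
    have /N'E Nz := valP z; have [y yE] := Nz e.
    have Ny : y \in N'.
      apply/N'E => e'; have [y' y'E] := Nz (e' * e); exists y'.
      apply: (tregI rY); rewrite -y'E scalerA mulrC -scalerA -yE !scalerA.
      by rewrite (thetaM phi Ma e' e).
    by exists (Submod Ny); apply: val_inj.
  have [eps epsE] := ext_action_exists rN HN.
  pose Z : lmodType E := actmod eps.
  have iotaZ r (z : Z) : iota r *: z = r *: (z : submod N').
    apply: (tregI rN); rewrite actmod_scaleE epsE (theta_iota iotaE Ma).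
    by rewrite mulrC scalerA.
  exists Z; have fZ : fin_gen Z.
    have nN : noethmod (submod N' : lmodType R).
      have [|f fE] := @linear_exists R (submod N') Y val.
        by move=> c x y; exact: (linearP (val : submod N' -> Y)).
      apply: (noeth_inj (f := f)) (fg_noeth nR fY).
      by move=> x y; rewrite !fE; apply: val_inj.
    have [n [v vgen]] := noethmod_fin_gen nN.
    exists n, v => z; have [c cE] := vgen z; exists (fun i => iota (c i)).
    by rewrite {1}cE; apply: eq_bigr => i _; rewrite iotaZ.
  have rZ : treg Z (iota a) by move=> z; rewrite iotaZ => /rN.
  split=> // X; rewrite add_closureP; split=> [XZ|CMX].
    by apply/CM_E; split; [apply: retract_fin_gen XZ | apply: retract_treg XZ].
  have [be beE] := restr_action_exists iota X.
  have /Yadd /add_closureP [n [i [p ip]]] := restr_Om X be beE CMX.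
  have /CM_E [_ rX] := CMX.
  have beZ r (x : actmod be) : r *: x = iota r *: (x : X) by rewrite actmod_scaleE beE.
  (* As a e comes from [R], an R-linear map into an E-module on which [a] is regular is E-linear. *)
  have elin (V W : lmodType E) (f : V -> W) : treg W (iota a) ->
      (forall x y, f (x + y) = f x + f y) ->
      (forall r x, f (iota r *: x) = iota r *: f x) -> linear f.
    move=> rW fD fZ' e x y; rewrite fD; congr (_ + _); apply: (tregI rW).
    by rewrite -fZ' !scalerA th_iota fZ'.
  have iN j (x : X) : i j x \in N'.
    apply/N'E => e; rewrite -linearZ_LR.
    exists (i j (e *: x : X)); rewrite -linearZ_LR; congr (i j _).
    by rewrite !beZ scalerA th_iota.
  have [j|I IE] := choice (fun j => @linear_exists E X Z (fun x => Submod (iN j x)) _).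
    apply: elin => // [x y|r x]; apply: val_inj.
      exact: (linearD (i j)).
    rewrite iotaZ -[RHS]/(r *: i j x) -linearZ_LR; congr (i j _).
    by rewrite beZ.
  have [j|P PE] := choice (fun j => @linear_exists E Z X (fun z => p j (val z)) _).
    apply: elin => // [x y|r x].
      exact: (linearD (p j)).
    rewrite iotaZ -[val _]/(r *: val x) linearZ_LR.
    by rewrite beZ.
  exists n, I, P => x; rewrite {1}[x]ip; apply: eq_bigr => j _.
  by rewrite PE IE.
have [be beE] := restr_action_exists iota X0.
pose X := actmod be : lmodType R; pose Y : lmodType R := (R^o * X)%type.
have CMX0 : CM X0.
  apply/X0add/add_closureP; exists 1%N.
  have [|f fE] := @linear_exists E X0 X0 id; first by [].
  by exists (fun=> f), (fun=> f) => x; rewrite big_ord1 !fE.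
have /OmR [fX rX sX] : OmegaCM X by apply: restr_Om.
have [|pr1 pr1E] := @linear_exists R Y R^o fst; first by [].
have [|pr2 pr2E] := @linear_exists R Y X snd; first by [].
have fY : fin_gen Y.
  have [n [v vgen]] := fX; exists n.+1.
  exists (fun i => if unlift ord0 i is Some j then (0, v j) else (1, 0)) => -[r x].
  have [c cE] := vgen x.
  exists (fun i => if unlift ord0 i is Some j then c j else r).
  rewrite big_ord_recl !unlift_none.
  under eq_bigr => j _ do rewrite liftK.
  have -> : \sum_j c j *: ((0, v j) : Y) = (0, x).
    rewrite cE; elim/big_rec2: _ => // j y1 y2 _ ->.
    by congr pair; rewrite /= scaler0 add0r.
  by congr pair; rewrite /= ?scaler0 ?add0r // addr0 [RHS]mulr1.
have rY : treg Y a.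
  by move=> [r x] [/ra -> /rX ->].
have sY : separated Y a.
  move=> [r x] n; have [[s sE]|nr] := EM (tmul a (r : R^o)); last first.
    by exists pr1; rewrite pr1E.
  have [|f nf] := sX x.
    by move=> [y yE]; apply: n; exists (s, y); rewrite sE yE.
  by have [h hE] := linear_comp_exists f pr2; exists h; rewrite hE pr2E.
exists Y; split=> // N; rewrite add_closureP; split=> [NY|/OmR [fN rN sN]].
  apply/OmR; split; [exact: retract_fin_gen NY | exact: retract_treg NY |].
  exact: retract_separated NY.
(* Induction on the number of generators splits off free summands until all functionals have values
   in [m]. *)
have [n gN] := fN; elim: n N gN rN sN {fN} => [|n IH] N [v vgen] rN sN.
  have [|z zE] := @linear_exists R N Y (fun=> 0); first by move=> c x y; rewrite scaler0 addr0.
  have [|z' z'E] := @linear_exists R Y N (fun=> 0); first by move=> c x y; rewrite scaler0 addr0.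
  by exists 0%N, (fun=> z), (fun=> z') => x; have [c ->] := vgen x; rewrite !big_ord0.
have [[pi [x1 nMx1]]|nopi] := EM (exists (pi : {linear N -> R^o}) x, ~ (pi x \in m)).
  have [i nMi] : exists i, ~ (pi (v i) \in m).
    apply: contrapT => none; apply: nMx1; have [c ->] := vgen x1.
    rewrite linear_sum; apply: (subm_sum sM) => i _; rewrite linearZ_LR.
    by apply: (submZ sM); apply: contrapT => ni; apply: none; exists i.
  (* Some generator [v i] already has a unit value. Splitting it off leaves the kernel of [pi],
     generated by the projections of the other generators. *)
  have [u uE] := unitM _ nMi; pose x0 := u *: v i.
  have pix0 : pi x0 = 1 by rewrite linearZ_LR -uE.
  have piZ r : pi (r *: x0) = r by rewrite linearZ_LR pix0 [LHS]mulr1.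
  have [|K KE] := @submodP R _ (fun y => pi y = 0).
    by split=> [|c x y px py]; rewrite ?linear0 // linearP px py scaler0 addr0.
  have Kin x : x - (pi x : R) *: x0 \in K by apply/KE; rewrite linearB /= piZ subrr.
  have [|q qE] := @linear_exists R N (submod K) (fun x => Submod (Kin x)).
    move=> c x y; apply: val_inj; rewrite -[RHS]/(c *: (x - pi x *: x0) + (y - pi y *: x0)).
    by rewrite /= linearP scalerDl -scalerA scalerBr opprD addrACA.
  have [|k kE] := @linear_exists R (submod K) N val.
    by move=> c x y; exact: (linearP (val : submod K -> N)).
  have qk x : x = (pi x : R) *: x0 + k (q x) by rewrite kE qE /= addrC subrK.
  have rK : treg (submod K : lmodType R) a.
    by move=> z az; apply: val_inj; apply: rN; rewrite -[LHS]/(val (a *: z)) az.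
  have [||n' [I [P IP]]] := IH (submod K) _ rK.
  - exists (fun j => q (v (lift i j))) => z.
    have [c cE] := vgen (val z); exists (fun j => c (lift i j)).
    have -> : z = q (val z).
      apply: val_inj; rewrite qE /=.
      have -> : pi (val z) = 0 by apply/KE; apply: valP.
      by rewrite scale0r subr0.
    rewrite {1}cE linear_sum (bigD1_ord i) //=.
    have -> : q (c i *: v i) = 0.
      apply: val_inj; rewrite qE /=.
      have -> : pi (c i *: v i) = c i * pi (v i) by exact: linearZ_LR.
      by rewrite /x0 scalerA -mulrA [pi _ * u]mulrC uE mulr1 subrr.
    by rewrite add0r; apply: eq_bigr => j _; rewrite linearZ_LR.
  - move=> z nz; have [|f nf] := sN (val z).
      move=> [y yE]; apply: nz.
      have yK : y \in K.
        apply/KE; apply: ra; rewrite -linearZ_LR -yE; apply/KE; exact: valP.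
      by exists (Submod yK); apply: val_inj.
    by have [h hE] := linear_comp_exists f k; exists h; rewrite hE kE.
  have [|i0 i0E] := @linear_exists R N Y (fun x => (pi x, 0)).
    by move=> c x y; congr pair => /=; [exact: linearP | by rewrite scaler0 addr0].
  have [|p0 p0E] := @linear_exists R Y N (fun y => (y.1 : R) *: x0).
    move=> c x y; rewrite /= scalerDl; congr (_ + _); symmetry; exact: scalerA.
  have [Iq IqE] := choice (fun j => linear_comp_exists (I j) q).
  have [kP kPE] := choice (fun j => linear_comp_exists k (P j)).
  exists n'.+1, (fun j => if unlift ord0 j is Some l then Iq l else i0),
    (fun j => if unlift ord0 j is Some l then kP l else p0) => x.
  rewrite big_ord_recl !unlift_none p0E i0E /= {1}[x]qk; congr (_ + _).
  rewrite {1}[q x]IP linear_sum; apply: eq_bigr => j _.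
  by rewrite !liftK kPE IqE.
have Mpi (f : {linear N -> R^o}) x : f x \in m.
  by apply: contrapT => nf; apply: nopi; exists f, x.
(* Functionals with values in [m] send [th e *: x] into a R, so by separation it lies in a N and [e]
   acts on [N]. *)
have HN e (x : N) : tmul a (th e *: x).
  apply: contrapT => /sN [f]; apply; rewrite linearZ_LR.
  have [y yE] := theta_colon phi Ma e (Mpi f x).
  by exists y; rewrite -[RHS]/(a * y) -yE.
have [eps epsE] := ext_action_exists rN HN.
pose NE : lmodType E := actmod eps.
have iotaN r (z : NE) : iota r *: z = r *: (z : N).
  apply: (tregI rN); rewrite actmod_scaleE epsE (theta_iota iotaE Ma).
  by rewrite mulrC scalerA.
have /X0add /add_closureP [k [i [p ip]]] : CM NE.
  apply/CM_E; split; last by move=> z; rewrite iotaN => /rN.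
  exists n.+1, v => z; have [c cE] := vgen z; exists (fun i => iota (c i)).
  by rewrite {1}cE; apply: eq_bigr => i _; rewrite iotaN.
have [j|I IE] := choice (fun j => @linear_exists R N Y (fun x => (0, i j x)) _).
  move=> c x y; congr pair => /=; first by rewrite scaler0 addr0.
  by rewrite actmod_scaleE beE -linearP iotaN.
have [j|P PE] := choice (fun j => @linear_exists R Y N (fun y => p j y.2) _).
  move=> c x y; rewrite /= actmod_scaleE beE linearP.
  by rewrite iotaN.
exists k, I, P => x; rewrite {1}[x]ip; apply: eq_bigr => j _.
by rewrite PE IE.
Qed.
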